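(* Let $\Gamma$ be a non-elementary Gromov-hyperbolic group, $S$ a finite symmetric generating set and $\rho:\Gamma\to\mathrm{GL}_d(\mathbb{R})$ a strongly irreducible and proximal representation. Fix an operator norm $\|\cdot\|$. Let $\nu$ be a Patterson--Sullivan measure on $\partial\Gamma$ for the $S$ word metric, and let $\Lambda\ge0$ be the constant such that $\frac1n\log\|\rho(\xi_n)\|\to\Lambda$ for $\nu$-almost every $\xi$ and every geodesic ray $\xi_n\to\xi$. Then for every $\epsilon>0$, \[ \limsup_{n\to\infty}\frac1n\log\nu\left(\xi\in\partial\Gamma:\ \text{for all }\xi_m\to\xi\text{ with }\xi_0=\mathrm{id},\ \left|\frac{\log\|\rho(\xi_n)\|}{n}-\Lambda\right|>\epsilon\right)<0 . \]
   Context: Word length $|\cdot|_S$; geodesic rays are sequences $(\xi_m)_{m\ge0}$ with $|\xi_m^{-1}\xi_k|_S=k-m$ for $k\ge m$; $\partial\Gamma$ is the set of rays modulo bounded distance $\sup_m|\xi_m^{-1}\xi'_m|_S<\infty$, and $\xi_m\to\xi$ means the ray lies in the class $\xi$. With $\lambda>1$ the exponential growth rate of $\#\{g:|g|_S=n\}$, a Patterson--Sullivan measure is a weak limit on $\Gamma\cup\partial\Gamma$ of $\frac{\sum_{|g|_S\le n}\lambda^{-|g|_S}\delta_g}{\sum_{|g|_S\le n}\lambda^{-|g|_S}}$ as $n\to\infty$ or of $\frac{\sum_g\lambda^{-s|g|_S}\delta_g}{\sum_g\lambda^{-s|g|_S}}$ as $s\searrow1$. Strongly irreducible: no finite union of proper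 nontrivial subspaces is $\rho(\Gamma)$-invariant; proximal: some $g_n\in\rho(\Gamma)$ has $g_n/\|g_n\|$ converging to a rank-one map. Such $\Lambda$ exists and equals $\lim_n\frac1n\frac{1}{\#S_n}\sum_{g\in S_n}\log\|\rho(g)\|$. *)

(* Defs.v *)
From HB Require Import structures.
From mathcomp Require Import all_boot all_order all_algebra.
From mathcomp Require Import all_classical all_reals all_analysis.
Set Implicit Arguments. Unset Strict Implicit. Unset Printing Implicit Defensive.
Import Order.TTheory GRing.Theory Num.Theory.
Import numFieldNormedType.Exports.
Local Open Scope classical_set_scope.
Local Open Scope ring_scope.

Section HypGroup.
Variable R : realType.
Variables (G : eqType) (mul : G -> G -> G) (inv : G -> G) (one : G).

Definition is_group : Prop :=
  associative mul /\ left_id one mul /\ right_id one mul /\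
  (forall x, mul (inv x) x = one) /\ (forall x, mul x (inv x) = one).

Fixpoint gpow (x : G) (n : nat) : G :=
  match n with 0 => one | n.+1 => mul x (gpow x n) end.
Definition gzpow (x : G) (m : int) : G :=
  match m with Posz n => gpow x n | Negz n => gpow (inv x) n.+1 end.

(* elementary = virtually cyclic (finite groups included, with a = one) *)
Definition virtually_cyclic : Prop :=
  exists (a : G) (cs : seq G), forall g, exists2 c, c \in cs &
    exists m : int, g = mul c (gzpow a m).
Definition non_elementary : Prop := ~ virtually_cyclic.

Variable S : seq G.
Definition prodw (w : seq G) : G := foldr mul one w.
Fixpoint words (k : nat) : seq (seq G) :=
  match k with 0 => [:: [::]] | k.+1 => [seq s :: w | s <- S, w <- words k] end.
Definition symmetric_set : Prop := forall s, s \in S -> inv s \in S.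
Definition generates : Prop := forall g, exists k, g \in map prodw (words k).
Definition inword (g : G) : pred nat := fun k => g \in map prodw (words k).
Definition wlen (g : G) : nat :=
  match pselect (exists k, inword g k) with left h => ex_minn h | right _ => 0%N end.
Definition wdist (x y : G) : nat := wlen (mul (inv x) y).

Definition gprod (w x y : G) : R :=
  ((wdist w x)%:R + (wdist w y)%:R - (wdist x y)%:R) / 2.
Definition hyperbolic : Prop :=
  exists delta : R, forall w x y z,
    Num.min (gprod w x y) (gprod w y z) - delta <= gprod w x z.

Definition is_ray (r : nat -> G) : Prop :=
  forall m k, (m <= k)%N -> wdist (r m) (r k) = (k - m)%N.
Definition ray_equiv (r r' : nat -> G) : Prop :=
  exists C : nat, forall m, (wdist (r m) (r' m) <= C)%N.
Definition is_bpoint (X : set (nat -> G)) : Prop :=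
  exists r, is_ray r /\ X = [set r' | is_ray r' /\ ray_equiv r r'].
Definition Bd : set (set (nat -> G)) := [set X | is_bpoint X].

(* points of Gamma ∪ ∂Gamma: inl g, or inr X with X in Bd *)
Definition cpt_valid (p : G + set (nat -> G)) : Prop :=
  match p with inl _ => True | inr X => is_bpoint X end.
Definition seqs_of (p : G + set (nat -> G)) : set (nat -> G) :=
  match p with inl g => [set fun _ => g] | inr X => X end.
Definition liminf2 (a b : nat -> G) : \bar R :=
  ereal_sup (range (fun N : nat => ereal_inf
    [set z | exists m n, (N <= m)%N /\ (N <= n)%N /\ z = (gprod one (a m) (b n))%:E])).
Definition gpx (p q : G + set (nat -> G)) : \bar R :=
  ereal_sup [set z | exists a b, seqs_of p a /\ seqs_of q b /\ z = liminf2 a b].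

Definition bd_open : set (set (set (nat -> G))) :=
  [set U | U `<=` Bd /\ forall X, U X -> exists Rr : R,
      [set Y | Bd Y /\ (Rr%:E < gpx (inr X) (inr Y))%E] `<=` U].
(* Borel sigma-algebra of the boundary (on the ambient type; Bd is measurable) *)
Definition BdT := g_sigma_algebraType bd_open.

(* continuity on the compactification Gamma ∪ ∂Gamma (Gamma is discrete) *)
Definition cpt_continuous (f : G + set (nat -> G) -> R) : Prop :=
  forall X, is_bpoint X -> forall e : R, 0 < e -> exists Rr : R,
    forall q, cpt_valid q -> (Rr%:E < gpx (inr X) q)%E -> `|f q - f (inr X)| < e.

Definition sph (n : nat) : seq G :=
  undup [seq g <- map prodw (words n) | wlen g == n].
Definition growth_rate (lam : R) : Prop :=
  (fun n : nat => (size (sph n))%:R `^ (n%:R^-1)) @ \oo --> lam.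

Definition ps_n (lam : R) (f : G + set (nat -> G) -> R) (n : nat) : R :=
  (\sum_(k < n.+1) lam ^- k * \sum_(g <- sph k) f (inl g)) /
  (\sum_(k < n.+1) lam ^- k * (size (sph k))%:R).
Definition ps_s (lam : R) (f : G + set (nat -> G) -> R) (s : R) : R :=
  limn (fun N : nat => \sum_(k < N) lam `^ (- (s * k%:R)) * \sum_(g <- sph k) f (inl g)) /
  limn (fun N : nat => \sum_(k < N) lam `^ (- (s * k%:R)) * (size (sph k))%:R).

Definition is_PS (lam : R) (nu : probability BdT R) : Prop :=
  nu (~` Bd) = 0%E /\
  ((exists nk : nat -> nat, (forall k, (nk k < nk k.+1)%N) /\
     forall f, cpt_continuous f ->
       (fun k => (ps_n lam f (nk k))%:E) @ \oo --> (\int[nu]_(x in Bd) (f (inr x))%:E)%E)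
   \/
   (exists sk : nat -> R, (forall k, 1 < sk k) /\ sk @ \oo --> (1 : R) /\
     forall f, cpt_continuous f ->
       (fun k => (ps_s lam f (sk k))%:E) @ \oo --> (\int[nu]_(x in Bd) (f (inr x))%:E)%E)).

End HypGroup.

Section Rep.
Variable R : realType.
Variable d : nat.

Definition is_vnorm (N : 'cV[R]_d -> R) : Prop :=
  (forall v, 0 <= N v) /\ (forall v, N v = 0 -> v = 0) /\
  (forall (a : R) v, N (a *: v) = `|a| * N v) /\ (forall u v, N (u + v) <= N u + N v).
Definition opnorm (N : 'cV[R]_d -> R) (A : 'M[R]_d) : R :=
  sup [set N (A *m v) | v in [set v | N v <= 1]].

Variables (G : eqType) (mul : G -> G -> G) (one : G).
Definition is_rep (rho : G -> 'M[R]_d) : Prop :=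
  (forall g h, rho (mul g h) = rho g *m rho h) /\ rho one = 1%:M /\
  (forall g, rho g \in unitmx).
Definition strongly_irreducible (rho : G -> 'M[R]_d) : Prop :=
  forall Ws : seq 'M[R]_d, Ws != [::] ->
    all (fun W => (0 < \rank W)%N && (\rank W < d)%N) Ws ->
    ~ (forall g (v : 'cV[R]_d), has (fun W => (v^T <= W)%MS) Ws ->
                                has (fun W => ((rho g *m v)^T <= W)%MS) Ws).
Definition proximal (N : 'cV[R]_d -> R) (rho : G -> 'M[R]_d) : Prop :=
  exists (gs : nat -> G) (M : 'M[R]_d), \rank M = 1%N /\
    forall i j, (fun n => rho (gs n) i j / opnorm N (rho (gs n))) @ \oo --> M i j.
End Rep.

Definition elog (R : realType) (x : \bar R) : \bar R :=
  match x with
  | EFin r => if (0 < r) then (ln r)%:E else -oo%E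
  | +oo%E => +oo%E
  | -oo%E => -oo%E
  end.

(* Main.v *)
(** A Patterson-Sullivan measure gives the shadow of [g] a mass comparable to
    [lam^-|g|], so proportions on spheres and [nu]-probabilities agree up to
    constants; in particular most elements [b] of a large sphere satisfy
    [log |rho b| = Lam |b| + o(|b|)].  For the upper deviations, cut a geodesic
    into blocks of a large length [T]: by submultiplicativity of the norm, a large
    value at time [n] forces a positive proportion of atypical blocks, and only
    exponentially few elements of the sphere have that.

    For the lower deviations, follow [log |u rho(r_k)|] along the ray for a fixed
    row vector [u].  By irreducibility and compactness there is a finite set of
    [f]'s such that for all [u] and [b] one of them gives
    [|u rho(f b)| >= const |u| |rho b|]; hence, whatever the past, the next block
    grows at rate almost [Lam] with a probability bounded below.  Retrying at
    rapidly increasing times, the probability that a fixed number of attempts all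
    fail becomes small, uniformly in [u], and a Katznelson-Weiss covering argument
    reduces the lower deviations to counting bad blocks as well. *)
Require Import Defs.
From HB Require Import structures.
From mathcomp Require Import all_boot all_order all_algebra.
From mathcomp Require Import all_classical all_reals all_analysis.
From mathcomp Require Import measurable_realfun zify ring lra.
Import Order.TTheory GRing.Theory Num.Theory.
Import numFieldNormedType.Exports.
Local Open Scope classical_set_scope.
Local Open Scope ring_scope.

Set Implicit Arguments.
Unset Strict Implicit.
Unset Printing Implicit Defensive.

(** * Word metrics *)

(** Weak limits only control integrals of functions continuous on the compactification, and the
    indicator of a shadow need not be one. Each shadow is therefore enclosed by a cutoff that is
    Lipschitz for a visual quasi-metric; Frink's chain argument provides it, by replacing the
    quasi-metric with an infimum over chains, which satisfies the triangle inequality.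

    The norm has no lower inequality to match its submultiplicativity: a product of two typical
    elements may have a much smaller norm than expected. Following a row vector turns the logarithm
    of the norm into an additive cocycle [ell], at the price that a block is good or bad relative to
    the direction reached so far. A good block succeeds at one of several times, which is why a
    covering argument replaces a plain sum over blocks.

    Sets defined by the existence of a ray are not shown to be measurable, hence the outer
    probability: a disjoint union is only split when one of its pieces is measurable. *)

Section WordMetric.
Variables (G : eqType) (mul : G -> G -> G) (inv : G -> G) (one : G) (S : seq G).
Hypothesis grp : is_group mul inv one.
Hypothesis symS : symmetric_set inv S.
Hypothesis genS : generates mul one S.

Local Notation "x ** y" := (mul x y) (at level 40, left associativity).
Local Notation len := (wlen mul one S).
Local Notation d := (wdist mul inv one S).
Local Notation pr := (prodw mul one).

Lemma gmulA x y z : x ** (y ** z) = x ** y ** z.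
Proof. by case: grp. Qed.
Lemma gmul1 x : one ** x = x.
Proof. by case: grp => _ []. Qed.
Lemma gmulr1 x : x ** one = x.
Proof. by case: grp => _ [_ []]. Qed.
Lemma gmulV x : inv x ** x = one.
Proof. by case: grp => _ [_ [_ []]]. Qed.
Lemma gmulrV x : x ** inv x = one.
Proof. by case: grp => _ [_ [_ []]]. Qed.
Lemma gmulK x y : inv x ** (x ** y) = y.
Proof. by rewrite gmulA gmulV gmul1. Qed.
Lemma gmulKV x y : x ** (inv x ** y) = y.
Proof. by rewrite gmulA gmulrV gmul1. Qed.
Lemma gmulI x y z : x ** y = x ** z -> y = z.
Proof. by move=> e; rewrite -(gmulK x y) e gmulK. Qed.
Lemma ginvK x : inv (inv x) = x.
Proof. by apply: (@gmulI (inv x)); rewrite gmulrV gmulV. Qed.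
Lemma ginvM x y : inv (x ** y) = inv y ** inv x.
Proof. by apply: (@gmulI (x ** y)); rewrite gmulrV -gmulA gmulKV gmulrV. Qed.
Lemma ginv1 : inv one = one.
Proof. by rewrite -[LHS]gmul1 gmulrV. Qed.

Lemma mem_words k (w : seq G) :
  (w \in words S k) = (size w == k) && all (mem S) w.
Proof.
elim: k w => [|k IH] w /=.
  by rewrite inE; case: w.
apply/allpairsP/idP => [[[s u] /= [sS uw ->]]|].
  by rewrite /= sS andTb eqSS -IH.
case: w => [//|s w] /=; rewrite eqSS => /andP[sz /andP[sS al]].
by exists (s, w); split => //=; rewrite IH sz.
Qed.

Lemma inwordP g k : reflect (exists w, [/\ size w = k, all (mem S) w & pr w = g])
  (inword mul one S g k).
Proof.
apply: (iffP mapP) => [[w]|[w [sz al <-]]].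
  by rewrite mem_words => /andP[/eqP sz al] ->; exists w.
by exists w => //; rewrite mem_words sz eqxx.
Qed.

Lemma prodw_cat u v : pr (u ++ v) = pr u ** pr v.
Proof. by elim: u => [|s u IH] /=; rewrite ?gmul1 // IH gmulA. Qed.

Lemma wlenP g : exists w, [/\ size w = len g, all (mem S) w & pr w = g].
Proof.
apply/inwordP; rewrite /wlen; case: pselect => [h|nh].
  by case: ex_minnP.
by exfalso; apply: nh; exact: genS.
Qed.

Lemma wlen_le w : all (mem S) w -> (len (pr w) <= size w)%N.
Proof.
move=> al; rewrite /wlen; case: pselect => // h.
by case: ex_minnP => m _; apply; apply/inwordP; exists w.
Qed.

Lemma wlen1 : len one = 0%N.
Proof. by apply/eqP; rewrite -leqn0; apply: (@wlen_le [::]). Qed.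

Lemma wlen_eq0 g : len g = 0%N -> g = one.
Proof. by have [w [sz _ e]] := wlenP g => h; move: sz e; rewrite h; case: w. Qed.

Lemma wlenM g h : (len (g ** h) <= len g + len h)%N.
Proof.
have [u [<- alu <-]] := wlenP g; have [v [<- alv <-]] := wlenP h.
by rewrite -prodw_cat -size_cat; apply: wlen_le; rewrite all_cat alu alv.
Qed.

Lemma wlenV_le g : (len (inv g) <= len g)%N.
Proof.
have [u [<- alu <-]] := wlenP g.
elim: u alu => [|s u IH] /=; first by rewrite ginv1 wlen1.
move=> /andP[sS /IH le]; rewrite ginvM.
apply: (leq_trans (wlenM _ _)); rewrite -addn1; apply: leq_add => //.
by rewrite -[inv s]gmulr1; apply: (@wlen_le [:: inv s]); rewrite /= andbT; exact: symS.
Qed.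

Lemma wlenV g : len (inv g) = len g.
Proof.
apply/eqP; rewrite eqn_leq wlenV_le /=.
by rewrite -{1}(ginvK g) wlenV_le.
Qed.

Lemma wlen_split g m : (m <= len g)%N ->
  exists p, len p = m /\ len (inv p ** g) = (len g - m)%N.
Proof.
have [u [sz alu pu]] := wlenP g => le.
exists (pr (take m u)).
move: alu; rewrite -{1}(cat_take_drop m u) all_cat => /andP[al1 al2].
have e : inv (pr (take m u)) ** g = pr (drop m u).
  by rewrite -pu -{2}(cat_take_drop m u) prodw_cat gmulK.
have l1 : (len (pr (take m u)) <= m)%N.
  by apply: leq_trans (wlen_le al1) _; rewrite size_take sz; case: ltnP; lia.
have l2 : (len (pr (drop m u)) <= len g - m)%N.
  by apply: leq_trans (wlen_le al2) _; rewrite size_drop sz.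
have l3 : (len g <= len (pr (take m u)) + len (pr (drop m u)))%N.
  by rewrite -pu -{1}(cat_take_drop m u) prodw_cat wlenM.
rewrite e; lia.
Qed.

Lemma wdxx x : d x x = 0%N.
Proof. by rewrite /wdist gmulV wlen1. Qed.
Lemma wdC x y : d x y = d y x.
Proof. by rewrite /wdist -wlenV ginvM ginvK. Qed.
Lemma wd_tri y x z : (d x z <= d x y + d y z)%N.
Proof.
by rewrite /wdist; apply: leq_trans (wlenM _ _); rewrite -gmulA gmulKV.
Qed.
Lemma wdM g x y : d (g ** x) (g ** y) = d x y.
Proof. by rewrite /wdist ginvM -gmulA gmulK. Qed.
Lemma wd1 g : d one g = len g.
Proof. by rewrite /wdist ginv1 gmul1. Qed.
Lemma wdMr g x : d g (g ** x) = len x.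
Proof. by rewrite -{1}(gmulr1 g) wdM wd1. Qed.

Lemma wd_geod x y m : (m <= d x y)%N ->
  exists z, d x z = m /\ d z y = (d x y - m)%N.
Proof.
move=> /wlen_split[p [lp lpg]]; exists (x ** p).
by rewrite wdMr; split => //; rewrite /wdist ginvM -gmulA.
Qed.

Lemma mem_sph n g : (g \in sph mul one S n) = (len g == n).
Proof.
rewrite mem_undup mem_filter; apply: andb_idr => /eqP <-.
by have [w [sz al e]] := wlenP g; apply/mapP; exists w; rewrite ?e // mem_words sz eqxx.
Qed.

Definition ball (n : nat) : seq G := flatten [seq sph mul one S k | k <- iota 0 n].

Lemma mem_ball n g : (g \in ball n) = (len g < n)%N.
Proof.
apply/flatten_mapP/idP => [[k]|h].
  by rewrite mem_iota mem_sph => /andP[_ kn] /eqP ->.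
by exists (len g); rewrite ?mem_iota ?mem_sph.
Qed.

Lemma ballS n : ball n.+1 = ball n ++ sph mul one S n.
Proof. by rewrite /ball -addn1 iotaD map_cat flatten_cat /= cats0. Qed.

Lemma ball_uniq n : uniq (ball n).
Proof.
elim: n => [//|n IH]; rewrite ballS cat_uniq IH undup_uniq /= andbT.
apply/hasPn => g; rewrite mem_sph => /eqP lg.
by rewrite /= mem_ball lg ltnn.
Qed.

Lemma sph_uniq n : uniq (sph mul one S n).
Proof. exact: undup_uniq. Qed.

Lemma size_sphD n m :
  (size (sph mul one S (n + m)) <= size (sph mul one S n) * size (sph mul one S m))%N.
Proof.
rewrite -(size_allpairs mul); apply: uniq_leq_size (sph_uniq _) _ => g.
rewrite mem_sph => /eqP lg.
have [p [lp lpg]] := @wlen_split g n ltac:(lia).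
apply/allpairsP; exists (p, inv p ** g); split => /=; last by rewrite gmulKV.
  by rewrite mem_sph lp.
by rewrite mem_sph lpg; lia.
Qed.

Lemma is_rayP r : (forall m, d (r m) (r m.+1) <= 1)%N ->
  (forall m, m <= d (r 0%N) (r m))%N -> is_ray mul inv one S r.
Proof.
move=> h1 h0.
have up m k : (d (r m) (r (m + k)%N) <= k)%N.
  elim: k => [|k IH]; first by rewrite addn0 wdxx.
  by rewrite addnS; have := wd_tri (r (m + k)%N) (r m) (r (m + k).+1);
     have := h1 (m + k)%N; lia.
move=> m k mk; have := up m (k - m)%N; have := up 0%N m; have := h0 k.
rewrite subnKC // add0n; have := wd_tri (r m) (r 0%N) (r k); lia.
Qed.

End WordMetric.

(** * Hyperbolicity and geodesic rays *)

Lemma infinite_pigeonhole (T : eqType) (s : seq T) (P : T -> nat -> Prop) :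
  (forall K : nat, exists2 k, (K <= k)%N & exists2 z, z \in s & P z k) ->
  exists2 z, z \in s & forall K : nat, exists2 k, (K <= k)%N & P z k.
Proof.
elim: s => [|z s IH] h; first by have [k _ [z]] := h 0%N.
have [hz|hz] := pselect (forall K : nat, exists2 k, (K <= k)%N & P z k).
  by exists z; rewrite ?mem_head.
move/existsNP: hz => [K0 hK0].
have [|y ys hy] := IH; last by exists y; rewrite // inE ys orbT.
move=> K; have [k hk [y]] := h (maxn K K0).
rewrite inE => /orP[/eqP ->|ys] Py.
  by exfalso; apply: hK0; exists k => //; lia.
by exists k; [lia | exists y].
Qed.

Section Hyperbolic.
Variables (G : eqType) (mul : G -> G -> G) (inv : G -> G) (one : G) (S : seq G).
Hypothesis grp : is_group mul inv one.
Hypothesis symS : symmetric_set inv S.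
Hypothesis genS : generates mul one S.

Local Notation len := (wlen mul one S).
Local Notation d := (wdist mul inv one S).

(* Doubling the Gromov products makes every term a natural number. *)
Definition four_point (D : nat) := forall w x y z,
  (d x z + d w y <= maxn (d x y + d w z) (d y z + d w x) + D)%N.

Lemma hyperbolic_four_point (R : realType) :
  hyperbolic R mul inv one S -> exists D, four_point D.
Proof.
(* [delta] may be negative, whence the absolute value; the factor 2 clears the halves in [gprod]. *)
move=> [delta hd]; exists (Num.trunc (2 * `|delta|)).+1 => w x y z.
have := hd w x y z; rewrite /gprod.
have hD : 2 * `|delta| < (Num.trunc (2 * `|delta|)).+1%:R by exact: truncnS_gt.
have := ler_norm delta.
move: (Num.trunc _).+1 hD => DD hD.
rewrite -(ler_nat R) !(natrD, natr_max).
set a := (d x z)%:R; set b := (d w y)%:R; set c := (d x y)%:R; set e := (d w z)%:R.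
set f := (d y z)%:R; set g := (d w x)%:R.
rewrite maxEle minEle; case: ifP => h1; case: ifP => h2; lra.
Qed.

Variable D : nat.
Hypothesis H4 : four_point D.

Local Notation dC := (wdC grp symS genS).
Local Notation tri := (wd_tri grp genS).
Local Notation d1 := (wd1 S grp).

(* [h] lies in the shadow of [g] seen from [one]: twice the Gromov product of [g] and [h] is at least [2 |g| - rho]. *)
Definition shadow (rho : nat) (g h : G) : bool := (len g + d g h <= len h + rho)%N.

Lemma len_lip x y : (len x <= len y + d x y)%N.
Proof. by rewrite -!d1 [d x y]dC tri. Qed.

Lemma shadow_refl rho g : shadow rho g g.
Proof. by rewrite /shadow wdxx //; lia. Qed.

Lemma shadow_le a b g h : (a <= b)%N -> shadow a g h -> shadow b g h.
Proof. by rewrite /shadow; lia. Qed.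

(** Four-point inequality at [one], [p], [h], [q]: both [p] and [q] lie close to a geodesic from
    [one] to [h], so their distance is nearly the difference of their lengths. *)
Lemma shadow_near a b p q h : shadow a p h -> shadow b q h ->
  (d p q <= maxn (a + len q - len p) (b + len p - len q) + D)%N.
Proof.
rewrite /shadow; have := H4 one p h q; rewrite !d1 [d h q]dC; have := len_lip p q.
have := len_lip q p; rewrite [d q p]dC; lia.
Qed.

(** Needed for the cutoffs: between a shadow and the complement of a slightly larger one the doubled
    Gromov product is at most [2 * len g], so the visual distance is bounded below. *)
Lemma shadow_separated rho g x y : shadow rho g x -> ~~ shadow (rho + D) g y ->
  (len x + len y <= d x y + 2 * len g)%N.
Proof. rewrite /shadow; have := H4 one g x y; rewrite !d1; lia. Qed.

(** The ultrametric inequality for doubled Gromov products at [one]; the triangle inequality keeps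
    the natural subtractions from truncating. *)
Lemma gprod2_ultra x y z :
  (minn (len x + len y - d x y) (len y + len z - d y z) <= len x + len z - d x z + D)%N.
Proof.
have := H4 one x y z; rewrite !d1; have := len_lip x y; have := len_lip y z.
have := len_lip z x; have := len_lip x z; rewrite [d z x]dC; have := tri one x y.
have := tri one y z; have := tri one x z; rewrite !d1 ![d _ one]dC !d1; lia.
Qed.

(* The Gromov product of [g] and [h] exceeds [j], so the geodesics to [g] and to [h] fellow-travel up to
   distance [j]. *)
Lemma not_shadow_trap j rho g h : (2 * j <= rho)%N ->
  (d g h + rho < len g + len h)%N ->
  (j <= len g)%N /\
  forall p, len p = j -> d p g = (len g - j)%N -> shadow D p h.
Proof.
move=> jr hgh; have l1 := len_lip h g; rewrite dC in l1.
split; first by lia.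
move=> p lp dpg; rewrite /shadow lp.
by have := H4 one p g h; rewrite !d1 lp dpg; lia.
Qed.

Local Notation ray := (is_ray mul inv one S).

Lemma ray_len r m : ray r -> r 0%N = one -> len (r m) = m.
Proof. by move=> h e; have := h 0%N m (leq0n _); rewrite e d1 subn0. Qed.

Lemma ray_shadow r m k : ray r -> r 0%N = one -> (m <= k)%N -> shadow 0 (r m) (r k).
Proof. by move=> h e mk; rewrite /shadow !ray_len // h //; lia. Qed.

Lemma ray_shadow_near r rho g k : ray r -> r 0%N = one -> (len g <= k)%N ->
  shadow rho g (r k) -> (d (r (len g)) g <= rho + D)%N.
Proof.
move=> h e gk /shadow_near - /(_ 0%N (r (len g)) (ray_shadow h e gk)).
by rewrite ray_len // dC; lia.
Qed.

Lemma ray_near_shadow r rho g k : ray r -> r 0%N = one -> (len g <= k)%N ->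
  (d (r (len g)) g <= rho)%N -> shadow rho g (r k).
Proof.
move=> h e gk le; rewrite /shadow ray_len //.
by have := tri (r (len g)) g (r k); rewrite h // [d g (r (len g))]dC; lia.
Qed.

(** The bound does not grow as one moves back from [k], which lets a statement about the whole past
    pass from one ray to another. *)
Lemma ray_fellow r r' C k m : ray r -> r 0%N = one -> ray r' -> r' 0%N = one ->
  (m <= k)%N -> (d (r k) (r' k) <= C)%N -> (d (r m) (r' m) <= C + D)%N.
Proof.
move=> h e h' e' mk dk.
have s1 : shadow C (r' m) (r k).
  rewrite /shadow !ray_len //.
  by have := tri (r' k) (r' m) (r k); rewrite h' // [d (r' k) _]dC; lia.
by have := shadow_near (ray_shadow h e mk) s1; rewrite !ray_len //; lia.
Qed.

(** Koenig's lemma: [P m p] says that [p] lies at distance [m] on geodesics from [one] to infinitely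
    many [r k]. Balls are finite, so some neighbour of [p] one step further inherits this. *)
Lemma exists_ray_from_one r : ray r ->
  exists r', [/\ ray r', r' 0%N = one & ray_equiv mul inv one S r r'].
Proof.
move=> hr; pose a := len (r 0%N).
have lr k : (k <= len (r k) + a)%N.
  by have := tri one (r 0%N) (r k); rewrite hr // d1 dC d1 /a; lia.
have lr' k : (len (r k) <= k + a)%N.
  by have := len_lip (r k) (r 0%N); rewrite dC hr // /a; lia.
pose P m p := len p = m /\ forall K : nat, exists2 k, (K <= k)%N & shadow 0 p (r k).
have P0 : P 0%N one.
  split; first exact: wlen1; move=> K; exists K => //.
  by rewrite /shadow wlen1 d1; lia.
have PS m p : P m p -> exists2 p', d p p' = 1%N & P m.+1 p'.
  move=> [lp hp].
  have [K|z zb hz] := @infinite_pigeonhole G (ball mul one S m.+2)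
      (fun z k => [/\ d p z = 1%N, len z = m.+1 & shadow 0 z (r k)]).
    have [k kK hk] := hp (K + m + a + 1)%N; exists k; first by lia.
    have lpk := len_lip (r k) p; have lk := lr k; move: lpk; rewrite dC => lpk.
    have [z [dpz dzr]] := wd_geod grp genS (m := 1) (x := p) (y := r k) ltac:(lia).
    have lz1 := len_lip z p; rewrite dC in lz1.
    have lz2 := len_lip (r k) z; rewrite dC in lz2.
    rewrite /shadow in hk.
    have lz : len z = m.+1 by lia.
    exists z; first by rewrite mem_ball // lz.
    by split => //; rewrite /shadow; lia.
  have [_ _ [dpz lz _]] := hz 0%N.
  exists z => //; split => // K; have [k kK [_ _ hk]] := hz K; by exists k.
pose T m := {p | P m p}.
pose next m (p : T m) : T m.+1 :=
  let: exist2 q _ hq := cid2 (PS m (sval p) (svalP p)) in exist _ q hq.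
have nextP m (p : T m) : d (sval p) (sval (next m p)) = 1%N.
  by rewrite /next; case: cid2.
pose f := fix f m : T m := if m is m'.+1 then next m' (f m') else exist _ one P0.
pose r' m := sval (f m).
have lr1 m : len (r' m) = m by have [] := svalP (f m).
have ray' : ray r'.
  apply: (is_rayP grp genS) => m; first by rewrite /r' /= nextP.
  by rewrite /r' /= -/(r' m) d1 lr1.
(* A far point [r k] sees [r m] with defect at most [2 * a] and [r' m] with none, and the lengths of
   [r m] and [r' m] differ by at most [a]. *)
exists r'; split=> //; exists (3 * a + D)%N => m.
have [_ /(_ m)[k mk hk]] := svalP (f m); rewrite -/(r' m) in hk.
have s2 : shadow (2 * a) (r m) (r k).
  by rewrite /shadow hr //; have := lr k; have := lr' m; lia.
have := shadow_near s2 hk; rewrite lr1; have := lr m; have := lr' m; lia.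
Qed.

Lemma bpoint_ray X : is_bpoint mul inv one S X ->
  exists r, [/\ X r, ray r & r 0%N = one].
Proof.
move=> [r0 [h0 ->]]; have [r [hr e eq]] := exists_ray_from_one h0.
by exists r.
Qed.

Lemma bpoint_mem_ray X r : is_bpoint mul inv one S X -> X r -> ray r.
Proof. by move=> [r0 [h0 ->]] []. Qed.

Lemma bpoint_equiv X r r' : is_bpoint mul inv one S X -> X r -> X r' ->
  ray_equiv mul inv one S r r'.
Proof.
move=> [r0 [h0 ->]] /= [_ [C hC]] [_ [C' hC']]; exists (C + C')%N => m.
have := tri (r0 m) (r m) (r' m); rewrite [d (r m) (r0 m)]dC.
have := hC m; have := hC' m; lia.
Qed.

End Hyperbolic.

(** * Frink's chain lemma for quasi-ultrametrics *)

Section Frink.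
Variables (R : realType) (T : Type) (rho : T -> T -> R) (K : R).
Hypothesis rho_ge0 : forall x y, 0 <= rho x y.
Hypothesis rhoxx : forall x, rho x x = 0.
Hypothesis rho_ultra : forall x y z, rho x z <= K * Num.max (rho x y) (rho y z).
Hypothesis K_ge0 : 0 <= K.
Hypothesis K2 : K ^+ 2 <= 2.

Fixpoint chain_sum (x : T) (s : seq T) : R :=
  if s is y :: s' then rho x y + chain_sum y s' else 0.

Lemma chain_sum_ge0 x s : 0 <= chain_sum x s.
Proof. by elim: s x => [//|y s IH] x /=; rewrite addr_ge0. Qed.

Lemma chain_sum_rcons x s y :
  chain_sum x (rcons s y) = chain_sum x s + rho (last x s) y.
Proof. by elim: s x => [|z s IH] x /=; rewrite ?add0r ?addr0 // IH addrA. Qed.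

(** [y] is the first vertex at which the partial sum reaches [t]; the link into [y] is left out of
    both parts. *)
Lemma chain_split x s t : s <> [::] -> 0 <= t -> t <= chain_sum x s ->
  exists s1 y s2, [/\ s = s1 ++ y :: s2, chain_sum x s1 <= t &
    chain_sum y s2 <= chain_sum x s - t].
Proof.
elim: s x t => [//|y s IH] x t _ t0 /= ht.
have [le|lt] := leP t (rho x y).
  by exists [::], y, s; split => //=; rewrite lerBrDr addrC lerD2r.
have sn0 : s <> [::] by move=> e; move: ht; rewrite e /=; lra.
have h1 : 0 <= t - rho x y by lra.
have h2 : t - rho x y <= chain_sum y s by lra.
have [s1 [z [s2 [-> h3 h4]]]] := IH y (t - rho x y) sn0 h1 h2.
by exists (y :: s1), z, s2; split => //=; lra.
Qed.

(** Split at half of the total [C]: by induction the two outer parts have endpoints at most [C]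
    apart, the middle link is at most [C], and two uses of the quasi-ultrametric inequality cost
    [K ^+ 2 <= 2]. *)
Lemma frink_chain x s : rho x (last x s) <= 2 * chain_sum x s.
Proof.
have [n] := ubnP (size s); elim: n => // n IH in x s *; rewrite ltnS => sn.
have [->|s0] := pselect (s = [::]); first by rewrite /= rhoxx mulr0.
set C := chain_sum x s; have C0 : 0 <= C by exact: chain_sum_ge0.
have hC1 : 0 <= C / 2 by lra.
have hC2 : C / 2 <= C by lra.
have [s1 [y [s2 [es h1 h2]]]] := chain_split s0 hC1 hC2.
rewrite -/C in h2; move: sn; rewrite es size_cat /= => sn.
have i1 := IH x s1 ltac:(lia); have i2 := IH y s2 ltac:(lia).
have i3 : rho (last x s1) y <= C.
  rewrite /C es; have -> : s1 ++ y :: s2 = rcons s1 y ++ s2 by rewrite cat_rcons.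
  have : chain_sum x (rcons s1 y ++ s2) = chain_sum x (rcons s1 y) + chain_sum y s2.
    elim: (s1) (x) => [|z s' IHs] w /=; first by rewrite addr0.
    by rewrite IHs addrA.
  by move=> ->; rewrite chain_sum_rcons; have := chain_sum_ge0 x s1;
     have := chain_sum_ge0 y s2; lra.
have -> : last x (s1 ++ y :: s2) = last y s2 by rewrite last_cat.
have j1 : rho (last x s1) (last y s2) <= K * C.
  apply: le_trans (rho_ultra _ y _) _; apply: ler_wpM2l => //.
  by rewrite ge_max i3 /=; lra.
have K1 : rho x (last y s2) <= K * Num.max C (K * C).
  apply: le_trans (rho_ultra _ (last x s1) _) _; apply: ler_wpM2l => //.
  by rewrite ge_max !le_max j1 orbT andbT; apply/orP; left; lra.
apply: le_trans K1 _; rewrite maxr_pMr //; rewrite ge_max.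
have KC : K <= 2 by clear s0; move: K2; rewrite expr2; nra.
apply/andP; split; first exact: ler_wpM2r.
by rewrite mulrA -expr2 ler_wpM2r.
Qed.

End Frink.

(** * Counting in shadows *)

Lemma ler_sum_inj (R : numDomainType) (T : eqType) (s t : seq T) (P Q : pred T)
    (phi : T -> T) (F F' : T -> R) :
  uniq s -> uniq t -> injective phi ->
  (forall g, 0 <= F' g) ->
  (forall g, g \in s -> P g -> [/\ phi g \in t, Q (phi g) & F g <= F' (phi g)]) ->
  \sum_(g <- s | P g) F g <= \sum_(g <- t | Q g) F' g.
Proof.
move=> us ut iphi F0 h.
apply: (@le_trans _ _ (\sum_(g <- s | P g) F' (phi g))).
  by rewrite big_seq_cond [leRHS]big_seq_cond; apply: ler_sum => g /andP[gs Pg];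
     have [] := h g gs Pg.
rewrite -big_filter -(big_map phi xpredT F').
set u := map phi _.
have uu : uniq u by rewrite map_inj_uniq ?filter_uniq.
have sub y : y \in u -> (y \in t) && Q y.
  by case/mapP => g; rewrite mem_filter => /andP[Pg gs] ->; have [-> ->] := h g gs Pg.
have -> : \sum_(y <- u) F' y = \sum_(y <- t | y \in u) F' y.
  rewrite -[RHS]big_filter; apply: perm_big; apply: uniq_perm; rewrite ?filter_uniq //.
  by move=> y; rewrite mem_filter; apply/idP/andP => [yu|[]//]; have /andP[] := sub _ yu.
rewrite big_mkcond [leRHS]big_mkcond; apply: ler_sum => y _.
by case: ifP => [/sub/andP[_ ->]//|_]; case: ifP.
Qed.

Lemma ler_bernoulli (R : realDomainType) (s : R) n : 0 <= s -> s <= 1 -> 1 - n%:R * s <= (1 - s) ^+ n.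
Proof.
move=> s0 s1; elim: n => [|n IH]; first by rewrite mul0r subr0 expr0.
rewrite exprS -natr1.
have h : (1 - s) * (1 - n%:R * s) <= (1 - s) * (1 - s) ^+ n by apply: ler_wpM2l => //; lra.
apply: le_trans h; have n0 : 0 <= n%:R :> R by [].
have : 0 <= n%:R * s * s by rewrite !mulr_ge0.
by lra.
Qed.

Section Counting.
Variables (G : eqType) (mul : G -> G -> G) (inv : G -> G) (one : G) (S : seq G).
Hypothesis grp : is_group mul inv one.
Hypothesis symS : symmetric_set inv S.
Hypothesis genS : generates mul one S.
Variable D : nat.
Hypothesis H4 : four_point mul inv one S D.
Variable R : realType.

Local Notation len := (wlen mul one S).
Local Notation d := (wdist mul inv one S).
Local Notation ball := (ball mul one S).
Local Notation sph := (sph mul one S).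
Local Notation shadow := (shadow mul inv one S).
Local Notation dC := (wdC grp symS genS).
Local Notation tri := (wd_tri grp genS).
Local Notation d1 := (wd1 S grp).

Definition sphere_card n : R := (size (sph n))%:R.
Local Notation asph := sphere_card.
(* The Poincare series truncated to [|g| < N]: [ball N] is the open ball. *)
Definition poinc (x : R) N : R := \sum_(g <- ball N) x ^+ len g.

Lemma sum_ball (F : G -> R) N :
  \sum_(g <- ball N) F g = \sum_(k < N) \sum_(g <- sph k) F g.
Proof.
elim: N => [|N IH]; first by rewrite big_nil big_ord0.
by rewrite ballS big_cat /= IH big_ord_recr.
Qed.

Lemma poincE x N : poinc x N = \sum_(k < N) x ^+ k * asph k.
Proof.
rewrite /poinc sum_ball; apply: eq_bigr => k _.
rewrite big_seq (eq_bigr (fun=> x ^+ k)); last first.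
  by move=> g; rewrite mem_sph // => /eqP ->.
by rewrite -big_seq big_const_seq count_predT iter_addr_0 /sphere_card mulr_natr.
Qed.

Lemma poincS x N : poinc x N.+1 = poinc x N + x ^+ N * asph N.
Proof. by rewrite !poincE big_ord_recr. Qed.

Lemma poinc_ge0 x N : 0 <= x -> 0 <= poinc x N.
Proof. by move=> x0; apply: sumr_ge0 => g _; apply: exprn_ge0. Qed.

Lemma poinc_mono x N M : 0 <= x -> (N <= M)%N -> poinc x N <= poinc x M.
Proof.
move=> x0 /subnK <-; elim: (M - N)%N => [//|k IH].
by rewrite addSn poincS; apply: le_trans IH _; rewrite lerDl mulr_ge0 // exprn_ge0.
Qed.

Lemma asph0 : asph 0 = 1.
Proof.
rewrite /sphere_card; have -> : size (sph 0) = size [:: one] :> nat.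
  apply: perm_size; apply: uniq_perm => //; first exact: sph_uniq.
  move=> g; rewrite mem_sph // inE; apply/eqP/eqP => [|->]; last exact: wlen1.
  exact: wlen_eq0.
by [].
Qed.

Lemma poinc_ge1 x N : 0 <= x -> (0 < N)%N -> 1 <= poinc x N.
Proof.
by move=> x0 N0; apply: le_trans (poinc_mono x0 N0); rewrite poincE big_ord1 expr0 asph0 mulr1.
Qed.

Lemma count_near (s : seq G) z r : uniq s ->
  (size [seq g <- s | (d z g <= r)%N] <= size (ball r.+1))%N.
Proof.
move=> us; rewrite -(size_map (mul (inv z))); apply: uniq_leq_size.
  by rewrite map_inj_uniq ?filter_uniq // => a b; exact: (gmulI grp).
by move=> y /mapP[g]; rewrite mem_filter => /andP[h _] ->; rewrite mem_ball.
Qed.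

(** Such elements cluster around the point at distance [n] on a geodesic to [h], or around [h]
    itself when [h] is shorter than [n]. *)
Lemma shadow_multiplicity rho n h :
  (size [seq g <- sph n | shadow rho g h] <= size (ball (rho + D).+1))%N.
Proof.
suff [z hz] : exists z, forall g, len g = n -> shadow rho g h -> (d z g <= rho + D)%N.
  apply: leq_trans (count_near z (rho + D) (sph_uniq mul one S n)).
  apply: uniq_leq_size => [|g]; first by rewrite filter_uniq ?sph_uniq.
  rewrite !mem_filter => /andP[sg gn]; rewrite gn andbT; apply: hz => //.
  by apply/eqP; rewrite -(mem_sph genS).
have [nh|hn] := leqP n (len h).
  have [z [dz dzh]] := wd_geod grp genS (m := n) (x := one) (y := h) ltac:(by rewrite d1).
  rewrite !d1 in dz dzh; exists z => g lg sg.
  have sz : shadow 0 z h by rewrite /shadow; lia.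
  by have := shadow_near grp symS genS H4 sz sg; lia.
exists h => g lg; rewrite /shadow dC; lia.
Qed.

Section Weight.
Variable x : R.
Hypothesis x0 : 0 < x.
Hypothesis x1 : x <= 1.

Let xge0 : 0 <= x. Proof. exact: ltW. Qed.

(** Translate the shadow by [inv g]. The image stays inside the ball when [rho <= len g]; otherwise
    [x ^+ rho <= x ^+ len g] already suffices. *)
Lemma shadow_sum_upper rho g N :
  (\sum_(h <- ball N | shadow rho g h) x ^+ len h) * x ^+ rho <= x ^+ len g * poinc x N.
Proof.
have [le|lt] := leqP rho (len g); last first.
  rewrite mulrC; apply: ler_pM.
  - by rewrite exprn_ge0.
  - by apply: sumr_ge0 => h _; apply: exprn_ge0.
  - by apply: ler_wiXn2l => //; exact: ltnW.
  - rewrite /poinc big_mkcond; apply: ler_sum => h _.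
    by case: ifP => // _; apply: exprn_ge0.
rewrite mulr_suml mulr_sumr.
apply: (@ler_sum_inj _ _ _ _ _ xpredT (mul (inv g))).
- exact: ball_uniq.
- exact: ball_uniq.
- by move=> a b; exact: (gmulI grp).
- by move=> h; rewrite mulr_ge0 // exprn_ge0.
- move=> h; rewrite mem_ball // /shadow => hN sh; split=> //.
    by rewrite mem_ball // -/(d g h); lia.
  by rewrite -!exprD; apply: ler_wiXn2l.
Qed.

(** Cancellation beyond [rho] in [mul g h] forces [h] into the shadow of a single point [p] at
    distance [j] towards [inv g], and that shadow carries a share of order [x ^+ j] of the whole
    sum. *)
Lemma trap_sum j rho g M : (2 * j <= rho)%N ->
  (\sum_(h <- ball M | (len (mul g h) + rho < len g + len h)%N) x ^+ len h) * x ^+ D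
   <= x ^+ j * poinc x M.
Proof.
move=> jr; have lg : len (inv g) = len g by exact: wlenV.
have e h : d (inv g) h = len (mul g h) by rewrite /wdist (ginvK grp).
have [jg|gj] := leqP j (len g).
  have [p [lp dp]] := wd_geod grp genS (m := j) (x := one) (y := inv g) ltac:(by rewrite d1 lg).
  rewrite !d1 in lp dp.
  rewrite -lp; apply: le_trans (shadow_sum_upper D p M); rewrite ler_wpM2r ?exprn_ge0 //.
  rewrite big_mkcond [leRHS]big_mkcond; apply: ler_sum => h _; case: ifP => [c|_].
    have [|_ /(_ p lp dp) ->] := @not_shadow_trap _ _ _ _ _ grp symS genS _ H4 j rho (inv g) h jr; last by [].
    by rewrite e lg.
  by case: ifP => // _; apply: exprn_ge0.
rewrite big_pred0 ?mul0r ?mulr_ge0 ?exprn_ge0 ?poinc_ge0 // => h.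
apply/negbTE/negP => c.
have [|] := @not_shadow_trap _ _ _ _ _ grp symS genS _ H4 j rho (inv g) h jr.
  by rewrite e lg.
by rewrite lg; lia.
Qed.

Lemma shadow_sum_lower j g N : x ^+ j <= 2^-1 ->
  x ^+ len g * poinc x (N - len g) / 2 <=
  \sum_(h <- ball N | shadow (2 * (j + D)) g h) x ^+ len h.
Proof.
move=> xj; set n := len g; set M := (N - n)%N.
have tr := @trap_sum (j + D) (2 * (j + D)) g M (leqnn _).
have xD : 0 < x ^+ D by rewrite exprn_gt0.
rewrite exprD mulrAC -subr_ge0 -mulrBl pmulr_lge0 // subr_ge0 in tr.
set U := \sum_(h <- _ | _) _ in tr.
pose V := \sum_(h <- ball M | ~~ (len (mul g h) + 2 * (j + D) < len g + len h)%N) x ^+ len h.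
have UV : poinc x M = U + V by rewrite /poinc (bigID (fun h => (len (mul g h) + 2 * (j + D) < len g + len h)%N)).
have PM0 := poinc_ge0 M xge0.
have U2 : U <= 2^-1 * poinc x M by apply: le_trans tr _; exact: ler_wpM2r.
apply: (@le_trans _ _ (x ^+ n * V)).
  by rewrite -mulrA ler_wpM2l ?exprn_ge0 //; lra.
rewrite /V mulr_sumr.
apply: (@ler_sum_inj _ _ _ _ _ _ (mul g)).
- exact: ball_uniq.
- exact: ball_uniq.
- by move=> a b; exact: (gmulI grp).
- by move=> h; rewrite exprn_ge0.
- move=> h; rewrite mem_ball // -leqNgt => hM sh.
  have := wlenM grp genS g h; rewrite -/n => lgh; split.
  + by rewrite mem_ball //; move: hM; rewrite /M; lia.
  + by rewrite /shadow wdMr //; move: sh; lia.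
  + by rewrite -exprD; apply: ler_wiXn2l.
Qed.

(** Add up the lower bounds for the shadows of the sphere of radius [n], which cover each [h]
    boundedly often. The constant depends on [x] only through the condition on [j]. *)
Lemma sphere_poinc j n N : x ^+ j <= 2^-1 ->
  asph n * x ^+ n * poinc x (N - n) <= 2 * (size (ball (2 * (j + D) + D).+1))%:R * poinc x N.
Proof.
move=> xj; set r := (2 * (j + D))%N.
suff : \sum_(g <- sph n) (x ^+ n * poinc x (N - n) / 2) <=
       (size (ball (r + D).+1))%:R * poinc x N.
  by rewrite big_const_seq count_predT iter_addr_0 -[X in X <= _]mulr_natl -/(asph n); lra.
apply: (@le_trans _ _ (\sum_(g <- sph n) \sum_(h <- ball N | shadow r g h) x ^+ len h)).
  rewrite big_seq [leRHS]big_seq; apply: ler_sum => g; rewrite mem_sph // => /eqP <-.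
  exact: shadow_sum_lower.
rewrite (exchange_big_dep xpredT) //= /poinc mulr_sumr; apply: ler_sum => h _.
rewrite -big_filter big_const_seq count_predT iter_addr_0 -[X in X <= _]mulr_natl.
by rewrite ler_wpM2r ?exprn_ge0 // ler_nat shadow_multiplicity.
Qed.

End Weight.

End Counting.

Lemma exists_expr_le (R : archiRealFieldType) (q e : R) : 0 <= q -> q < 1 -> 0 < e ->
  exists n, q ^+ n <= e.
Proof.
move=> q0 q1 e0.
have /cvg_expr/cvgr_lt : `|q| < 1 by rewrite ger0_norm.
by move=> /(_ _ e0) [n _ h]; exists n; apply/ltW/h => /=.
Qed.

(** * Purely exponential growth of spheres *)

Section Growth.
Variables (G : eqType) (mul : G -> G -> G) (inv : G -> G) (one : G) (S : seq G).
Hypothesis grp : is_group mul inv one.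
Hypothesis symS : symmetric_set inv S.
Hypothesis genS : generates mul one S.
Variable D : nat.
Hypothesis H4 : four_point mul inv one S D.
Variable R : realType.

Local Notation len := (wlen mul one S).
Local Notation ball := (ball mul one S).
Local Notation asph := (sphere_card mul one S R).
Local Notation poinc := (@poinc G mul one S R).

Lemma poinc_bounded (x y K : R) : 0 <= x -> 0 <= y -> x * y < 1 ->
  (forall n, asph n <= K * y ^+ n) -> forall N, poinc x N <= K / (1 - x * y).
Proof.
move=> x0 y0 xy hK N.
have K0 : 0 <= K by have := hK 0%N; rewrite expr0 mulr1; apply: le_trans; rewrite /sphere_card.
have q0 : 0 <= x * y by rewrite mulr_ge0.
have geo : \sum_(k < N) (x * y) ^+ k <= (1 - x * y)^-1.
  rewrite -[leRHS]mul1r ler_pdivlMr ?subr_gt0 // mulrC -opprB mulNr -subrX1 opprB.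
  by rewrite lerBlDr lerDl exprn_ge0.
rewrite poincE //; apply: (@le_trans _ _ (\sum_(k < N) K * (x * y) ^+ k)).
  apply: ler_sum => k _; rewrite exprMn mulrCA; apply: ler_wpM2l; rewrite ?exprn_ge0 //.
by rewrite -mulr_sumr; apply: ler_wpM2l.
Qed.

Variable lam : R.
Hypothesis lam1 : 1 < lam.
Hypothesis growth : growth_rate mul one S lam.

Let lam0 : 0 < lam. Proof. by apply: lt_trans lam1. Qed.

(** Fekete's argument: sphere sizes are submultiplicative, so one value below [lam ^+ n] would keep
    the roots along the multiples of [n] strictly below [lam]. *)
Lemma sphere_lower n : lam ^+ n <= asph n.
Proof.
case: n => [|n]; first by rewrite expr0 asph0.
rewrite leNgt; apply/negP => lt.
have sub k : asph (n.+1 * k)%N <= asph n.+1 ^+ k.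
  elim: k => [|k IH]; first by rewrite muln0 asph0 // expr0.
  rewrite mulnS exprS; apply: (@le_trans _ _ (asph n.+1 * asph (n.+1 * k)%N)).
    by rewrite /sphere_card -natrM ler_nat (size_sphD grp genS).
  by apply: ler_wpM2l => //; rewrite /sphere_card.
have a0 : 0 <= asph n.+1 by rewrite /sphere_card.
have ltn : asph n.+1 `^ (n.+1%:R^-1) < lam.
  have -> : lam = (lam ^+ n.+1) `^ (n.+1%:R^-1).
    by rewrite -powR_mulrn ?ltW // -powRrM mulfV ?pnatr_eq0 // powRr1 // ltW.
  by apply: gt0_ltr_powR; rewrite ?invr_gt0 // nnegrE ?exprn_ge0 // ltW.
have /cvgr_gt/(_ _ ltn)[M _ hM] := growth.
have := hM (n.+1 * M.+1)%N; rewrite /= => /(_ ltac:(lia)).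
rewrite ltNge => /negP; apply; rewrite -/(asph _).
apply: (@le_trans _ _ ((asph n.+1 ^+ M.+1) `^ ((n.+1 * M.+1)%:R^-1))).
  by apply: ge0_ler_powR; rewrite ?nnegrE ?exprn_ge0 ?invr_ge0 // /sphere_card.
rewrite -powR_mulrn // -powRrM natrM invfM [_^-1 * _]mulrC mulrA mulfV ?pnatr_eq0 // mul1r.
exact: lexx.
Qed.

(** For [x < lam^-1] the Poincare series has a finite sum [sup A >= 1], and [sphere_poinc] becomes
    [asph n * x ^+ n * sup A <= M * sup A]. Dividing leaves a bound free of [x], so [x] may tend to
    [lam^-1]. *)
Lemma sphere_upper : exists2 C, 1 <= C & forall n, asph n <= C * lam ^+ n.
Proof.
have il1 : 0 < lam^-1 < 1 by rewrite invr_gt0 lam0 invf_lt1.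
have /andP[il0 il] := il1.
have [j hj] := exists_expr_le (ltW il0) il (e := 2^-1) ltac:(by rewrite invr_gt0).
pose M : R := 2 * (size (ball (2 * (j + D) + D).+1))%:R.
have M0 : 0 <= M by rewrite mulr_ge0.
suff key (x : R) n : 0 < x -> x < lam^-1 -> asph n * x ^+ n <= M.
  exists (M + 1); first by rewrite lerDr.
  move=> n; apply: (@le_trans _ _ (M * lam ^+ n)); last first.
    by rewrite ler_wpM2r ?exprn_ge0 ?lerDl // ltW.
  set c := asph n * lam^-1 ^+ n.
  suff cM : c <= M.
    by rewrite -ler_pdivrMr ?exprn_gt0 // -exprVn.
  have c0 : 0 <= c by rewrite mulr_ge0 ?exprn_ge0 // ltW.
  apply/ler_addgt0Pr => e e0.
  have n0 : 0 <= n%:R :> R by [].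
  (* With [x = lam^-1 * (1 - s)], Bernoulli's inequality loses [c * n * s], which this [s] keeps
     below [e]. *)
  pose s := Num.min 2^-1 (e / (c * n%:R + 1)).
  have cn : 0 < c * n%:R + 1 by rewrite ltr_wpDl // mulr_ge0.
  have s0 : 0 < s by rewrite lt_min invr_gt0 ltr0n divr_gt0.
  have s1 : s <= 2^-1 by rewrite ge_min lexx.
  have s2 : s * (c * n%:R + 1) <= e by rewrite -ler_pdivlMr // ge_min lexx orbT.
  have b := @ler_bernoulli R s n (ltW s0) ltac:(lra).
  have k1 : asph n * (lam^-1 * (1 - s)) ^+ n <= M.
    apply: key; first by rewrite mulr_gt0 //; lra.
    by rewrite -[ltRHS]mulr1 ltr_pM2l //; lra.
  rewrite exprMn mulrA -/c in k1.
  have := ler_wpM2l c0 b; lra.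
move=> x0 xl.
have x1 : x <= 1 by apply: ltW; apply: lt_trans xl il.
(* The growth rate only gives [asph m <= K * y ^+ m] for [y] above [lam]; [x * y < 1] still makes
   the series converge. *)
have [y ly yx] : exists2 y, lam < y & x * y < 1.
  exists ((lam + x^-1) / 2).
    have : lam < x^-1 by rewrite -[lam]invrK ltf_pV2 ?posrE.
    lra.
  have : x * lam < 1 by rewrite -ltr_pdivlMr // mul1r.
  have -> : x * ((lam + x^-1) / 2) = (x * lam + 1) / 2 by field; rewrite gt_eqF.
  lra.
have y1 : 1 <= y by apply/ltW/(lt_trans lam1).
have [K hK] : exists K, forall m, asph m <= K * y ^+ m.
  have /cvgr_lt/(_ _ ly)[n0 _ hn0] := growth.
  have P0 : 0 <= poinc 1 n0.+1 by exact: poinc_ge0.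
  exists (1 + poinc 1 n0.+1) => m.
  have ym : 1 <= y ^+ m by rewrite exprn_ege1.
  have [lt|le] := ltnP m n0.+1.
    apply: (@le_trans _ _ (poinc 1 n0.+1)); last first.
      by apply: (@le_trans _ _ (1 + poinc 1 n0.+1)); rewrite ?lerDr // ler_peMr //; lra.
    rewrite poincE // (bigD1 (Ordinal lt)) //= expr1n mul1r lerDl.
    by apply: sumr_ge0 => i _; rewrite expr1n mul1r.
  apply: (@le_trans _ _ (y ^+ m)); last by rewrite ler_peMl ?lerDl //; lra.
  have := hn0 m (ltnW le); rewrite /= -/(asph m) => h.
  have m0 : (m%:R : R) != 0 by rewrite pnatr_eq0 -lt0n; exact: leq_trans le.
  have a0 : 0 <= asph m by rewrite /sphere_card.
  rewrite -[leLHS](powRr1 a0) -[1](mulVf m0) powRrM powR_mulrn ?powR_ge0 //.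
  by apply: lerXn2r; rewrite ?nnegrE ?powR_ge0 //; [lra | exact: ltW].
pose A := [set poinc x N | N in [set: nat]].
have supA : has_sup A.
  split; first by exists (poinc x 0), 0%N.
  by exists (K / (1 - x * y)) => _ [N _ <-]; apply: poinc_bounded => //; lra.
have xj : x ^+ j <= 2^-1.
  by apply: le_trans hj; apply: lerXn2r; rewrite ?nnegrE // ltW.
have l1 : 1 <= sup A.
  apply: (@le_trans _ _ (poinc x 1)); first by rewrite poinc_ge1 // ltW.
  by apply: ub_le_sup; [exact: supA.2 | exists 1%N].
have [->|az] := eqVneq (asph n) 0; first by rewrite mul0r.
have a0 : 0 < asph n by rewrite lt_neqAle eq_sym az /sphere_card ler0n.
have ax : 0 < asph n * x ^+ n by rewrite mulr_gt0 ?exprn_gt0.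
have : sup A <= M * sup A / (asph n * x ^+ n).
  apply: ge_sup; first exact: supA.1.
  move=> _ [N _ <-]; rewrite ler_pdivlMr // mulrC.
  have := sphere_poinc grp symS genS H4 x0 x1 n (N + n) xj; rewrite addnK.
  move=> /le_trans; apply; apply: ler_wpM2l => //.
  by apply: ub_le_sup; [exact: supA.2 | exists (N + n)%N].
rewrite ler_pdivlMr // mulrC ler_pM2r //; lra.
Qed.

End Growth.

(** * Patterson-Sullivan sums *)

Section PattersonSullivanSums.
Variables (G : eqType) (mul : G -> G -> G) (inv : G -> G) (one : G) (S : seq G).
Hypothesis grp : is_group mul inv one.
Hypothesis symS : symmetric_set inv S.
Hypothesis genS : generates mul one S.
Variable D : nat.
Hypothesis H4 : four_point mul inv one S D.
Variable R : realType.

Local Notation len := (wlen mul one S).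
Local Notation ball := (ball mul one S).
Local Notation asph := (sphere_card mul one S R).
Local Notation poinc := (@poinc G mul one S R).
Local Notation shadow := (shadow mul inv one S).

Variables (lam C : R).
Hypothesis lam1 : 1 < lam.
Hypothesis lower : forall n, lam ^+ n <= asph n.
Hypothesis upper : forall n, asph n <= C * lam ^+ n.

(** The truncated numerator of the Patterson-Sullivan quotients. *)
Definition wpoinc (x : R) (f : G -> R) N : R := \sum_(g <- ball N) x ^+ len g * f g.

Lemma wpoincE x f N :
  wpoinc x f N = \sum_(k < N) x ^+ k * \sum_(g <- sph mul one S k) f g.
Proof.
rewrite /wpoinc sum_ball; apply: eq_bigr => k _; rewrite mulr_sumr.
rewrite big_seq [RHS]big_seq; apply: eq_bigr => g.
by rewrite mem_sph // => /eqP ->.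
Qed.

Let lam0 : 0 < lam. Proof. exact: lt_trans lam1. Qed.
Let il0 : 0 < lam^-1. Proof. by rewrite invr_gt0. Qed.
Let il1 : lam^-1 < 1. Proof. by rewrite invf_lt1. Qed.

Section Bounds.
Variables (rho : nat) (g : G) (f : G -> R).
Hypothesis f0 : forall h, 0 <= f h.

Section Upper.
Hypothesis fs : forall h, f h <= (shadow rho g h)%:R.

Lemma wpoinc_upper x N : 0 < x -> x <= 1 ->
  wpoinc x f N <= x ^+ len g / x ^+ rho * poinc x N.
Proof.
move=> x0 x1; rewrite mulrAC ler_pdivlMr ?exprn_gt0 //.
apply: le_trans (shadow_sum_upper grp genS x0 x1 rho g N).
rewrite ler_wpM2r ?exprn_ge0 ?(ltW x0) //.
rewrite /wpoinc [leRHS]big_mkcond; apply: ler_sum => h _.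
have xh : 0 <= x ^+ len h by rewrite exprn_ge0 // ltW.
case: ifP (fs h) => [_ le|_ le]; first by rewrite ler_piMr.
by rewrite mulr_ge0_le0.
Qed.

End Upper.

Section Lower.
Variable j : nat.
Hypothesis xj : lam^-1 ^+ j <= 2^-1.
Hypothesis fs : forall h, (shadow (2 * (j + D)) g h)%:R <= f h.

Lemma wpoinc_lower x N : 0 < x -> x <= lam^-1 ->
  x ^+ len g / 2 * poinc x (N - len g) <= wpoinc x f N.
Proof.
move=> x0 xl; have x1 : x <= 1 by rewrite (le_trans xl) // ltW.
have xj' : x ^+ j <= 2^-1.
  by apply: le_trans xj; apply: lerXn2r; rewrite ?nnegrE // ltW.
rewrite mulrAC; apply: le_trans (shadow_sum_lower grp symS genS H4 x0 x1 g N xj') _.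
rewrite /wpoinc big_mkcond; apply: ler_sum => h _.
have xh : 0 <= x ^+ len h by rewrite exprn_ge0 // ltW.
by case: ifP (fs h) => [_ le|_ le]; [rewrite ler_peMr | rewrite mulr_ge0].
Qed.

End Lower.
End Bounds.

Lemma ps_nE (F : G + set (nat -> G) -> R) n :
  ps_n mul one S lam F n = wpoinc lam^-1 (F \o inl) n.+1 / poinc lam^-1 n.+1.
Proof.
rewrite /ps_n poincE // wpoincE; congr (_ / _); apply: eq_bigr => k _; by rewrite exprVn.
Qed.

Lemma ps_sE (F : G + set (nat -> G) -> R) s (x := lam `^ (- s)) :
  ps_s mul one S lam F s = limn (wpoinc x (F \o inl)) / limn (poinc x).
Proof.
have e k : lam `^ (- (s * k%:R)) = x ^+ k.
  by rewrite -mulNr powRrM powR_mulrn // powR_ge0.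
rewrite /ps_s.
have -> : (fun N : nat => \sum_(k < N) lam `^ (- (s * k%:R)) *
    \sum_(g <- sph mul one S k) F (inl g)) = wpoinc x (F \o inl).
  by apply/funext => N; rewrite wpoincE; apply: eq_bigr => k _; rewrite e.
have -> // : (fun N : nat => \sum_(k < N) lam `^ (- (s * k%:R)) *
    (size (sph mul one S k))%:R) = poinc x.
by apply/funext => N; rewrite poincE //; apply: eq_bigr => k _; rewrite e.
Qed.

(** At [lam^-1] each sphere weighs at most [C], while by [poinc_ge] the sum diverges: a bounded
    shift of the radius becomes negligible. *)
Lemma poinc_diff N n : poinc lam^-1 N <= poinc lam^-1 (N - n) + C * n%:R.
Proof.
elim: n => [|n IH]; first by rewrite subn0 mulr0 addr0.
suff : poinc lam^-1 (N - n) <= poinc lam^-1 (N - n.+1) + C by rewrite -natr1; lra.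
case e : (N - n)%N => [|m].
  have -> : (N - n.+1)%N = 0%N by lia.
  rewrite lerDl; have := upper 0; rewrite expr0 mulr1; apply: le_trans.
  by rewrite /sphere_card.
have -> : (N - n.+1)%N = m by lia.
by rewrite poincS // lerD2l exprVn mulrC ler_pdivrMr ?exprn_gt0.
Qed.

Lemma poinc_ge N : N%:R <= poinc lam^-1 N.
Proof.
rewrite poincE // -[leLHS]mulr1 -[X in X%:R](card_ord N) -sum1_card natr_sum mulr1.
apply: ler_sum => k _.
by rewrite exprVn mulrC ler_pdivlMr ?exprn_gt0 // mul1r.
Qed.

Lemma cvg_bounded_sum (u : nat -> R) B : (forall n, u n <= u n.+1) -> (forall n, u n <= B) ->
  cvgn u.
Proof.
move=> hm hB; apply: nondecreasing_is_cvgn; first exact/nondecreasing_seqP.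
by exists B => _ [n _ <-].
Qed.

Section SLimits.
Variables (s : R).
Hypothesis s1 : 1 < s.
Let x := lam `^ (- s).

Lemma ps_x_gt0 : 0 < x. Proof. by rewrite powR_gt0. Qed.
Lemma ps_x_lt : x < lam^-1.
Proof.
by rewrite -powR_inv1 ?(ltW lam0) // /x /powR (gt_eqF lam0) ltr_expR ltr_pM2r ?ln_gt0 // ltrN2.
Qed.

Lemma poinc_cvg : cvgn (poinc x).
Proof.
have x0 := ps_x_gt0; have xl := ps_x_lt.
apply: (@cvg_bounded_sum _ (C / (1 - x * lam))) => n.
  by apply: poinc_mono; rewrite ?ltW.
by apply: poinc_bounded; rewrite ?(ltW x0) ?(ltW lam0) // -ltr_pdivlMr // mul1r.
Qed.

Lemma wpoinc_cvg f : (forall h, 0 <= f h <= 1) -> cvgn (wpoinc x f).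
Proof.
move=> f01; have x0 := ps_x_gt0.
apply: (@cvg_bounded_sum _ (limn (poinc x))) => n.
  rewrite /wpoinc ballS big_cat /= lerDl; apply: sumr_ge0 => h _.
  by have /andP[fh _] := f01 h; rewrite mulr_ge0 // exprn_ge0 // ltW.
apply: (@le_trans _ _ (poinc x n)).
  apply: ler_sum => h _; have /andP[_ fh] := f01 h.
  by rewrite ler_piMr // exprn_ge0 // ltW.
apply: nondecreasing_cvgn_le; last exact: poinc_cvg.
by move=> a b ab; apply: poinc_mono; rewrite ?ltW.
Qed.

Lemma lim_poinc_ge n : poinc x n <= limn (poinc x).
Proof.
apply: nondecreasing_cvgn_le; last exact: poinc_cvg.
by move=> a b ab; apply: poinc_mono; rewrite ?ltW // ps_x_gt0.
Qed.

Lemma lim_poinc_gt0 : 0 < limn (poinc x).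
Proof.
apply: lt_le_trans (lim_poinc_ge 1).
by rewrite (lt_le_trans ltr01) // poinc_ge1 // ltW // ps_x_gt0.
Qed.

Lemma ps_s_upper rho g F : (forall h, 0 <= F (inl h) <= (shadow rho g h)%:R) ->
  ps_s mul one S lam F s <= x ^+ len g / x ^+ rho.
Proof.
move=> hF; have x0 := ps_x_gt0.
rewrite ps_sE ler_pdivrMr ?lim_poinc_gt0 //; apply: limr_le.
  apply: wpoinc_cvg => h /=; have /andP[-> le] := hF h; apply: le_trans le _.
  by case: (shadow _ _ _).
apply: nearW => n; apply: (@le_trans _ _ (x ^+ len g / x ^+ rho * poinc x n)).
  have x1 : x <= 1 by apply: ltW; apply: lt_trans il1; apply: ps_x_lt.
  by apply: wpoinc_upper => // h; have /andP[] := hF h.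
by rewrite ler_wpM2l ?lim_poinc_ge // divr_ge0 // exprn_ge0 // ltW.
Qed.

Lemma ps_s_lower j g F : lam^-1 ^+ j <= 2^-1 ->
  (forall h, (shadow (2 * (j + D)) g h)%:R <= F (inl h) <= 1) ->
  x ^+ len g / 2 <= ps_s mul one S lam F s.
Proof.
move=> hj hF; have x0 := ps_x_gt0.
have F0 h : 0 <= F (inl h) by have /andP[le _] := hF h; apply: le_trans le.
rewrite ps_sE ler_pdivlMr ?lim_poinc_gt0 // mulrC -ler_pdivlMr ?divr_gt0 ?exprn_gt0 //.
apply: limr_le; first exact: poinc_cvg.
apply: nearW => n; rewrite ler_pdivlMr ?divr_gt0 ?exprn_gt0 // mulrC.
(* Enlarging the radius by [len g] undoes the shift in [wpoinc_lower]; the limit does not notice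
   it. *)
apply: (@le_trans _ _ (wpoinc x (F \o inl) (n + len g)%N)).
  have := @wpoinc_lower g (F \o inl) j hj (fun h => proj1 (andP (hF h))) x (n + len g) x0 (ltW ps_x_lt).
  by rewrite addnK.
apply: nondecreasing_cvgn_le.
  apply/nondecreasing_seqP => k; rewrite /wpoinc ballS big_cat /= lerDl.
  by apply: sumr_ge0 => h _; rewrite mulr_ge0 // exprn_ge0 // ltW.
by apply: wpoinc_cvg => h /=; rewrite F0; have /andP[] := hF h.
Qed.

End SLimits.

Lemma ps_n_upper rho g F n : (forall h, 0 <= F (inl h) <= (shadow rho g h)%:R) ->
  ps_n mul one S lam F n <= lam ^- len g * lam ^+ rho.
Proof.
move=> hF; rewrite ps_nE ler_pdivrMr; last first.
  by rewrite (lt_le_trans ltr01) // poinc_ge1 // ltW.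
have -> : lam ^- len g * lam ^+ rho = lam^-1 ^+ len g / lam^-1 ^+ rho.
  by rewrite !exprVn invrK.
by apply: wpoinc_upper; rewrite ?ltW // => h; have /andP[] := hF h.
Qed.

(** One factor 2 comes from [wpoinc_lower], the other from the shift of the radius by [len g], which
    costs at most half of the sum for such [n]. *)
Lemma ps_n_lower j g F n : lam^-1 ^+ j <= 2^-1 ->
  (forall h, (shadow (2 * (j + D)) g h)%:R <= F (inl h) <= 1) ->
  2 * C * (len g)%:R <= n%:R ->
  lam ^- len g / 4 <= ps_n mul one S lam F n.
Proof.
move=> hj hF hn.
have F0 h : 0 <= F (inl h) by have /andP[le _] := hF h; apply: le_trans le.
have P0 : 0 < poinc lam^-1 n.+1.
  by rewrite (lt_le_trans ltr01) // poinc_ge1 // ltW.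
rewrite ps_nE ler_pdivlMr //.
have h1 := @wpoinc_lower g (F \o inl) j hj (fun h => proj1 (andP (hF h))) lam^-1 n.+1 il0 (lexx _).
apply: le_trans h1; rewrite exprVn.
have h2 := poinc_diff n.+1 (len g); have h3 := poinc_ge n.+1.
have h4 : poinc lam^-1 n.+1 / 2 <= poinc lam^-1 (n.+1 - len g).
  move: h3; rewrite -natr1; lra.
have -> : lam ^- len g / 4 * poinc lam^-1 n.+1 = lam ^- len g / 2 * (poinc lam^-1 n.+1 / 2) by field; rewrite expf_neq0 // gt_eqF.
by rewrite ler_wpM2l // divr_ge0 // invr_ge0 exprn_ge0 // ltW.
Qed.

End PattersonSullivanSums.

(** * Shadow estimates in the limit *)

Section PSBounds.
Variables (R : realType) (G : eqType) (mul : G -> G -> G) (inv : G -> G) (one : G) (S : seq G).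
Hypothesis grp : is_group mul inv one.
Hypothesis symS : symmetric_set inv S.
Hypothesis genS : generates mul one S.
Variable D : nat.
Hypothesis H4 : four_point mul inv one S D.
Variables (lam C : R) (nu : probability (BdT R mul inv one S) R).
Hypothesis lam1 : 1 < lam.
Hypothesis lower : forall n, lam ^+ n <= sphere_card mul one S R n.
Hypothesis upper : forall n, sphere_card mul one S R n <= C * lam ^+ n.
Hypothesis PS : is_PS lam nu.

Local Notation len := (wlen mul one S).
Local Notation shadow := (shadow mul inv one S).

Let lam0 : 0 < lam. Proof. exact: lt_trans lam1. Qed.

Lemma PS_upper rho g F : cpt_continuous mul inv one S F ->
  (forall h, 0 <= F (inl h) <= (shadow rho g h)%:R) ->
  (\int[nu]_(x in Bd mul inv one S) (F (inr x))%:E <= (lam ^+ (2 * rho) / lam ^+ len g)%:E)%E.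
Proof.
move=> cF hF; case: PS => _ [[nk [_ /(_ F cF) cv]]|[sk [s1 [s_to /(_ F cF) cv]]]].
  apply: cvge_to_le cv _; apply: nearW => k; rewrite lee_fin.
  apply: le_trans (ps_n_upper grp genS lam1 _ hF) _.
  rewrite mulrC ler_wpM2r ?invr_ge0 ?exprn_ge0 ?(ltW lam0) // ler_weXn2l ?(ltW lam1) //; lia.
apply: cvge_to_le cv _; have /cvgr_lt/(_ 2 ltac:(lra)) := s_to.
apply: filterS => k sk2; rewrite lee_fin.
apply: le_trans (ps_s_upper grp genS lam1 upper (s1 k) hF) _.
set x := _ `^ _; have x0 : 0 < x by exact: ps_x_gt0.
have xl : x < lam^-1 by exact: ps_x_lt.
have xl2 : lam ^- 2 <= x.
  by rewrite -powR_invn ?(ltW lam0) // /x ler_powR ?(ltW lam1) // lerN2 ltW.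
rewrite mulrC; apply: ler_pM.
- by rewrite invr_ge0 exprn_ge0 // ltW.
- by rewrite exprn_ge0 // ltW.
- rewrite exprM -[leRHS]invrK lef_pV2 ?posrE ?invr_gt0 ?exprn_gt0 // -exprVn.
  by apply: lerXn2r; rewrite ?nnegrE ?invr_ge0 ?exprn_ge0 // ltW.
- by rewrite -exprVn; apply: lerXn2r; rewrite ?nnegrE ?invr_ge0 // ltW.
Qed.

Lemma PS_lower j g F : cpt_continuous mul inv one S F -> lam^-1 ^+ j <= 2^-1 ->
  (forall h, (shadow (2 * (j + D)) g h)%:R <= F (inl h) <= 1) ->
  ((lam ^- len g / 4)%:E <= \int[nu]_(x in Bd mul inv one S) (F (inr x))%:E)%E.
Proof.
move=> cF hj hF; case: PS => _ [[nk [nkS /(_ F cF) cv]]|[sk [s1 [s_to /(_ F cF) cv]]]].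
  apply: cvge_to_ge cv _; have [N0 hN0] : exists N0 : nat, 2 * C * (len g)%:R <= N0%:R.
    by exists (Num.trunc (2 * C * (len g)%:R)).+1; exact/ltW/truncnS_gt.
  exists N0 => // k /= kN; rewrite lee_fin.
  apply: (ps_n_lower grp symS genS H4 lam1 lower upper hj hF).
  apply: le_trans hN0 _; rewrite ler_nat; apply: leq_trans kN _.
  by elim: k => [|k IH] //; have := nkS k; lia.
apply: cvge_to_ge cv _.
have [e e0 he] : exists2 e, 0 < e & e * ((len g)%:R * ln lam) <= ln 2.
  have l2 : 0 < ln 2 :> R by rewrite ln_gt0 // ltr1n.
  have a0 : 0 < (len g)%:R * ln lam + 1.
    by rewrite ltr_wpDl // mulr_ge0 // ln_ge0 // ltW.
  exists (ln 2 / ((len g)%:R * ln lam + 1)); first by rewrite divr_gt0.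
  by rewrite mulrAC ler_pdivrMr // ler_wpM2l ?(ltW l2) // lerDl.
have /cvgr_lt/(_ (1 + e) ltac:(lra)) := s_to.
apply: filterS => k ske; rewrite lee_fin.
apply: le_trans (ps_s_lower grp symS genS H4 lam1 upper (s1 k) hj hF).
suff : lam ^- len g / 2 <= (lam `^ (- sk k)) ^+ len g by lra.
rewrite -[leRHS]powR_mulrn ?powR_ge0 // -powRrM -!exprVn.
have -> : lam^-1 ^+ len g = expR (- ((len g)%:R * ln lam)).
  by rewrite expRN exprVn mulrC expRM_natr lnK ?posrE.
have -> : 2^-1 = expR (- ln 2) :> R by rewrite expRN lnK ?posrE.
rewrite /powR (gt_eqF lam0) -expRD ler_expR.
have c0 : 0 <= (len g)%:R * ln lam by rewrite mulr_ge0 // ln_ge0 // ltW.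
have : (sk k - 1) * ((len g)%:R * ln lam) <= e * ((len g)%:R * ln lam).
  by rewrite ler_wpM2r //; lra.
lra.
Qed.

End PSBounds.

(** * Continuous cutoff functions on the compactification *)

Section Compactification.
Variables (R : realType) (G : eqType) (mul : G -> G -> G) (inv : G -> G) (one : G) (S : seq G).
Hypothesis grp : is_group mul inv one.
Hypothesis symS : symmetric_set inv S.
Hypothesis genS : generates mul one S.
Variable D : nat.
Hypothesis H4 : four_point mul inv one S D.

Local Notation len := (wlen mul one S).
Local Notation d := (wdist mul inv one S).
Local Notation shadow := (shadow mul inv one S).
Local Notation bpoint := (is_bpoint mul inv one S).
Local Notation dC := (wdC grp symS genS).
Local Notation tri := (wd_tri grp genS).
Local Notation d1 := (wd1 S grp).

Definition gprod2 x y : nat := (len x + len y - d x y)%N.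

Lemma gprod2E x y : gprod R mul inv one S one x y = (gprod2 x y)%:R / 2.
Proof.
rewrite /gprod /gprod2 !d1 natrB ?natrD //.
by have := tri one x y; rewrite [d x one]dC !d1.
Qed.

Variable theta : R.
Hypothesis th0 : 0 < theta.
Hypothesis th1 : theta < 1.

(** [theta ^+ gprod2 x y] is Gromov's visual quasi-metric seen from [one]; functions Lipschitz for
    it extend continuously to the boundary. *)
Definition vis_lipschitz (L : R) (f : G -> R) :=
  forall x y, `|f x - f y| <= L * theta ^+ gprod2 x y.

(** At a boundary point the limit is taken along a chosen ray; [bd_extend_cvg] shows that the choice
    does not matter. The value 0 is a default for the empty set. *)
Definition bd_extend (f : G -> R) (p : G + set (nat -> G)) : R :=
  match p with
  | inl g => f g
  | inr X => if pselect (exists r, X r) is left h then limn (f \o sval (cid h)) else 0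
  end.

Lemma exists_theta_le L e : 0 <= L -> 0 < e -> exists n, forall m, (n <= m)%N -> L * theta ^+ m <= e.
Proof.
move=> L0 e0; have Lp : 0 < L + 1 by lra.
have [n hn] := exists_expr_le (ltW th0) th1 (divr_gt0 e0 Lp).
exists n => m nm; have : theta ^+ m <= theta ^+ n by apply: ler_wiXn2l => //; exact: ltW.
move=> /le_trans/(_ hn); rewrite ler_pdivlMr // => h; apply: le_trans h.
by rewrite mulrC ler_wpM2l ?exprn_ge0 ?(ltW th0) //; lra.
Qed.

Lemma ray_gprod2 r r' C : is_ray mul inv one S r -> is_ray mul inv one S r' ->
  (forall m, (d (r m) (r' m) <= C)%N) ->
  forall k m n, (k + C + len (r 0%N) + len (r' 0%N) <= m)%N -> (m <= n)%N ->
  (k <= gprod2 (r m) (r' n))%N.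
Proof.
move=> hr hr' hC k m n km mn; rewrite /gprod2.
have h1 := tri (r' m) (r m) (r' n); rewrite hr' // in h1.
have h2 := hC m.
have h3 := tri (r m) (r 0%N) one; have h4 := tri one (r 0%N) (r m).
have h5 := tri one (r' 0%N) (r' n).
rewrite hr // subn0 [d _ one]dC !d1 in h4.
rewrite hr' // subn0 [d _ one]dC !d1 in h5.
lia.
Qed.

Section Lipschitz.
Variables (L : R) (f : G -> R).
Hypothesis L0 : 0 <= L.
Hypothesis fL : vis_lipschitz L f.

Lemma vis_lipschitz_ray r r' : is_ray mul inv one S r -> is_ray mul inv one S r' ->
  ray_equiv mul inv one S r r' ->
  forall e, 0 < e -> exists N, forall n, (N <= n)%N -> `|f (r N) - f (r' n)| <= e.
Proof.
move=> hr hr' [C hC] e e0; have [k hk] := exists_theta_le L0 e0.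
exists (k + C + len (r 0%N) + len (r' 0%N))%N => n hn.
apply: le_trans (fL _ _) _; apply: hk.
exact: (ray_gprod2 hr hr' hC).
Qed.

Lemma ray_equiv_refl r : ray_equiv mul inv one S r r.
Proof. by exists 0%N => m; rewrite wdxx. Qed.

Lemma vis_lipschitz_cvg r : is_ray mul inv one S r -> cvgn (f \o r).
Proof.
move=> hr; apply: cauchy_cvg; apply: cauchy_exP => e e0.
have e20 : 0 < e / 2 by rewrite divr_gt0.
have [N hN] := vis_lipschitz_ray hr hr (ray_equiv_refl r) e20.
exists (f (r N)); exists N => // n /= Nn.
by rewrite /ball /=; apply: le_lt_trans (hN n Nn) _; lra.
Qed.

Lemma bd_extend_cvg X r : bpoint X -> X r -> f \o r @ \oo --> bd_extend f (inr X).
Proof.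
move=> hX Xr; rewrite /=; case: pselect => [h|[]]; last by exists r.
case: cid => r0 Xr0 /=.
have hr := bpoint_mem_ray hX Xr; have hr0 := bpoint_mem_ray hX Xr0.
have c := vis_lipschitz_cvg hr; have c0 := vis_lipschitz_cvg hr0.
suff -> : limn (f \o r0) = limn (f \o r) by [].
have eq : ray_equiv mul inv one S r0 r by exact: bpoint_equiv hX Xr0 Xr.
have [C hC] := eq.
apply/eqP; rewrite -subr_eq0 -normr_le0; apply/ler_addgt0Pr => e e0; rewrite add0r.
have e30 : 0 < e / 3 by rewrite divr_gt0.
have [k hk] := exists_theta_le L0 e30.
have /cvgrPdist_le/(_ _ e30)[N1 _ h1] := c; have /cvgrPdist_le/(_ _ e30)[N2 _ h2] := c0.
pose n := (k + C + len (r0 0%N) + len (r 0%N) + N1 + N2)%N.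
have := h1 n; have := h2 n; rewrite /= => /(_ ltac:(rewrite /n; lia)) i2 /(_ ltac:(rewrite /n; lia)) i1.
have i3 : `|f (r0 n) - f (r n)| <= e / 3.
  by apply: le_trans (fL _ _) _; apply: hk; apply: (ray_gprod2 hr0 hr hC); rewrite /n; lia.
have -> : limn (f \o r0) - limn (f \o r) =
  (limn (f \o r0) - f (r0 n)) + (f (r0 n) - f (r n)) - (limn (f \o r) - f (r n)) by ring.
apply: le_trans (ler_normB _ _) _.
have := ler_normD (limn (f \o r0) - f (r0 n)) (f (r0 n) - f (r n)); lra.
Qed.

Lemma bd_extend_continuous : cpt_continuous mul inv one S (bd_extend f).
Proof.
move=> X hX e e0; have e40 : 0 < e / 4 by rewrite divr_gt0.
have [k hk] := exists_theta_le L0 e40.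
exists k%:R => q hq /ereal_sup_gt[_ [a [b [Xa [qb ->]]]]].
move=> /ereal_sup_gt[_ [N _ <-]] hN.
have ab m n : (N <= m)%N -> (N <= n)%N -> `|f (a m) - f (b n)| <= e / 4.
  move=> Nm Nn; apply: le_trans (fL _ _) _; apply: hk.
  have : (k%:R%:E < (gprod R mul inv one S one (a m) (b n))%:E)%E.
    by apply: lt_le_trans hN _; apply: ereal_inf_lbound; exists m, n.
  rewrite lte_fin gprod2E ltr_pdivlMr // -natrM ltr_nat; lia.
have ca : f \o a @ \oo --> bd_extend f (inr X) by apply: bd_extend_cvg.
have cb : f \o b @ \oo --> bd_extend f q.
  case: q hq qb => [g _ /= ->|Y hY Yb]; first exact: cvg_cst.
  exact: bd_extend_cvg.
have /cvgrPdist_le/(_ _ e40)[N1 _ h1] := ca; have /cvgrPdist_le/(_ _ e40)[N2 _ h2] := cb.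
pose n := (N + N1 + N2)%N.
have := h1 n; have := h2 n; rewrite [_ n]/= => /(_ ltac:(rewrite /n /=; lia)) i2.
rewrite [_ n]/= => /(_ ltac:(rewrite /n /=; lia)) i1.
have i3 := ab n n ltac:(rewrite /n; lia) ltac:(rewrite /n; lia).
have -> : bd_extend f q - bd_extend f (inr X) =
  (bd_extend f q - f (b n)) - ((bd_extend f (inr X) - f (a n)) + (f (a n) - f (b n))) by ring.
apply: le_lt_trans (ler_normB _ _) _.
have := ler_normD (bd_extend f (inr X) - f (a n)) (f (a n) - f (b n)).
rewrite /= in i1 i2; lra.
Qed.

End Lipschitz.

Section Cutoff.
Hypothesis thD : 2^-1 <= theta ^+ (2 * D).
Variables (rho : nat) (g : G).

(** The diagonal is set to 0 by hand, as [frink_chain] requires: the power itself is positive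
    there. *)
Definition vis x y : R := if x == y then 0 else theta ^+ gprod2 x y.

Lemma vis_ge0 x y : 0 <= vis x y.
Proof. by rewrite /vis; case: ifP => // _; rewrite exprn_ge0 // ltW. Qed.
Lemma visxx x : vis x x = 0. Proof. by rewrite /vis eqxx. Qed.

Lemma vis_ultra x y z : vis x z <= theta ^- D * Num.max (vis x y) (vis y z).
Proof.
have K1 : 1 <= theta ^- D.
  by rewrite -exprVn exprn_ege1 // -[1]invr1 lef_pV2 ?posrE // ltW.
have M0 : 0 <= Num.max (vis x y) (vis y z) by rewrite le_max vis_ge0.
have [->|xz] := eqVneq x z; first by rewrite visxx mulr_ge0 ?(le_trans ler01 K1) // le_max vis_ge0.
have le1 : Num.max (vis x y) (vis y z) <= theta ^- D * Num.max (vis x y) (vis y z).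
  by rewrite ler_peMl.
have [xy|xy] := eqVneq x y.
  by apply: le_trans le1; rewrite le_max xy lexx orbT.
have [yz|yz] := eqVneq y z.
  by apply: le_trans le1; rewrite le_max -yz lexx.
rewrite /vis (negbTE xy) (negbTE yz) (negbTE xz) mulrC ler_pdivlMr ?exprn_gt0 //.
rewrite -exprD.
have mono a b : (a <= b)%N -> theta ^+ b <= theta ^+ a.
  by move=> ab; apply: ler_wiXn2l => //; exact: ltW.
have := gprod2_ultra grp symS genS H4 x y z; rewrite -/(gprod2 x y) -/(gprod2 y z) -/(gprod2 x z).
by rewrite geq_min le_max => /orP[/mono ->|/mono ->] //; rewrite orbT.
Qed.

Lemma vis_chain x s : vis x (last x s) <= 2 * chain_sum vis x s.
Proof.
have tD : 0 < theta ^+ D by rewrite exprn_gt0.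
apply: (frink_chain vis_ge0 visxx vis_ultra); first by rewrite invr_ge0 ltW.
rewrite exprVn -exprM mulnC -[leRHS]invrK lef_pV2 ?posrE ?exprn_gt0 ?invr_gt0 //.
Qed.

(** Chains may start anywhere in the shadow, so their infimum is the chain distance to it. Appending
    a link gives [vis_dist_lip] with constant 1, which the quasi-metric itself would not give. *)
Let chains y : set R :=
  [set c | exists x s, [/\ shadow rho g x, last x s = y & c = chain_sum vis x s]].

Let vis_dist y := inf (chains y).

Lemma chains_inf y : has_inf (chains y).
Proof.
split.
  by exists (chain_sum vis g [:: y]), g, [:: y]; split => //; exact: shadow_refl.
by exists 0 => _ [x [s [_ _ ->]]]; exact: (chain_sum_ge0 vis_ge0).
Qed.

Lemma vis_dist_lip x y : vis_dist y <= vis_dist x + theta ^+ gprod2 x y.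
Proof.
rewrite -lerBlDr; apply: lb_le_inf; first by case: (chains_inf x).
move=> _ [z [s [zA lz ->]]]; rewrite lerBlDr.
apply: (@le_trans _ _ (chain_sum vis z (rcons s y))).
  apply: ge_inf; first by case: (chains_inf y).
  by exists z, (rcons s y); rewrite last_rcons.
rewrite chain_sum_rcons lerD2l lz /vis; case: ifP => // _.
by rewrite exprn_ge0 // ltW.
Qed.

(** The slope makes the function vanish from chain distance [theta ^+ (2 * len g) / 2] on, which is
    what [shadow_separated] and [vis_chain] guarantee outside the larger shadow. *)
Definition cutoff y : R := Num.max 0 (1 - 2 / theta ^+ (2 * len g) * vis_dist y).

Let c0 : 0 < 2 / theta ^+ (2 * len g).
Proof. by rewrite divr_gt0 // exprn_gt0. Qed.

Lemma cutoff_lipschitz : vis_lipschitz (2 / theta ^+ (2 * len g)) cutoff.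
Proof.
have sym a b : gprod2 a b = gprod2 b a by rewrite /gprod2 dC addnC.
have half a b : cutoff a <= cutoff b + 2 / theta ^+ (2 * len g) * theta ^+ gprod2 a b.
  have p : 0 <= 2 / theta ^+ (2 * len g) * theta ^+ gprod2 a b.
    by rewrite mulr_ge0 ?exprn_ge0 // ltW.
  rewrite /cutoff ge_max; apply/andP; split.
    by rewrite addr_ge0 // le_max lexx.
  have h : 1 - 2 / theta ^+ (2 * len g) * vis_dist b <=
    Num.max 0 (1 - 2 / theta ^+ (2 * len g) * vis_dist b) by rewrite le_max lexx orbT.
  have := ler_wpM2l (ltW c0) (vis_dist_lip a b); rewrite mulrDr; lra.
move=> x y; rewrite ler_norml; have := half x y; have := half y x; rewrite [gprod2 y x]sym.
by move=> h1 h2; apply/andP; split; lra.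
Qed.

Lemma vis_dist_ge0 y : 0 <= vis_dist y.
Proof.
apply: lb_le_inf; first by case: (chains_inf y).
by move=> _ [x [s [_ _ ->]]]; exact: (chain_sum_ge0 vis_ge0).
Qed.

Lemma cutoff_ge0 y : 0 <= cutoff y.
Proof. by rewrite le_max lexx. Qed.

Lemma cutoff_le1 y : cutoff y <= 1.
Proof.
rewrite ge_max ler01 /= lerBlDr lerDl mulr_ge0 ?vis_dist_ge0 //; exact: ltW.
Qed.

Lemma cutoff_in y : shadow rho g y -> cutoff y = 1.
Proof.
move=> sy; suff v0 : vis_dist y = 0 by rewrite /cutoff v0 mulr0 subr0 maxEle ler01.
apply/eqP; rewrite eq_le vis_dist_ge0 andbT; apply: ge_inf; first by case: (chains_inf y).
by exists y, [::].
Qed.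

Lemma cutoff_out y : ~~ shadow (rho + D) g y -> cutoff y = 0.
Proof.
move=> sy; rewrite /cutoff maxEge ifT // subr_le0 mulrAC ler_pdivlMr ?exprn_gt0 // mul1r.
rewrite mulrC -ler_pdivrMr //.
apply: lb_le_inf; first by case: (chains_inf y).
move=> _ [x [s [sx lx ->]]]; rewrite ler_pdivrMr // mulrC.
apply: le_trans (vis_chain x s); rewrite lx /vis.
have xy : x != y.
  by apply/eqP => e; move: sy; rewrite -e (shadow_le _ sx) //; lia.
rewrite (negbTE xy); apply: ler_wiXn2l => //; [exact: ltW|exact: ltW|].
have := shadow_separated grp H4 sx sy; rewrite /gprod2; lia.
Qed.

End Cutoff.
End Compactification.

(** * The measure of shadows *)

Section Shadows.
Variables (R : realType) (G : eqType) (mul : G -> G -> G) (inv : G -> G) (one : G) (S : seq G).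
Hypothesis grp : is_group mul inv one.
Hypothesis symS : symmetric_set inv S.
Hypothesis genS : generates mul one S.
Variable D : nat.
Hypothesis H4 : four_point mul inv one S D.
Variables (lam C : R) (nu : probability (BdT R mul inv one S) R).
Hypothesis lam1 : 1 < lam.
Hypothesis lower : forall n, lam ^+ n <= sphere_card mul one S R n.
Hypothesis upper : forall n, sphere_card mul one S R n <= C * lam ^+ n.
Hypothesis PS : is_PS lam nu.

Local Notation len := (wlen mul one S).
Local Notation d := (wdist mul inv one S).
Local Notation shadow := (shadow mul inv one S).
Local Notation Bd := (Bd mul inv one S : set (BdT R mul inv one S)).

Lemma bd_open_measurable (U : set (BdT R mul inv one S)) :
  bd_open R mul inv one S U -> measurable U.
Proof. exact: sub_sigma_algebra. Qed.

Lemma Bd_measurable : measurable Bd.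
Proof.
apply: bd_open_measurable; split => // X hX.
by exists 0 => Y [].
Qed.

Lemma cpt_continuous_open (F : G + set (nat -> G) -> R) t : cpt_continuous mul inv one S F ->
  bd_open R mul inv one S [set X | Bd X /\ t < F (inr X)].
Proof.
move=> cF; split=> [X []//|X [hX tX]].
have [Rr hRr] := cF X hX (F (inr X) - t) ltac:(lra).
exists Rr => Y [hY gY]; split => //.
by have := hRr (inr Y) hY gY; rewrite ltr_norml => /andP[]; lra.
Qed.

Lemma cpt_continuous_measurable (F : G + set (nat -> G) -> R) : cpt_continuous mul inv one S F ->
  measurable_fun Bd (EFin \o (fun X : BdT R mul inv one S => F (inr X))).
Proof.
move=> cF; apply/measurable_EFinP.
apply: (measurability _ (RGenOInfty.measurableE R)).
move=> _ [_ [t ->] <-].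
rewrite (_ : _ `&` _ = [set X | Bd X /\ t < F (inr X)]); last first.
  by apply/seteqP; split => X /= [hX]; rewrite in_itv /= andbT.
by apply: bd_open_measurable; exact: cpt_continuous_open.
Qed.

Lemma exists_theta : exists2 theta : R, 0 < theta < 1 & 2^-1 <= theta ^+ (2 * D).
Proof.
have D0 : 0 <= D%:R :> R by [].
pose s : R := (4 * (D%:R + 1))^-1.
have s0 : 0 < s by rewrite invr_gt0; lra.
have s1 : s <= 2^-1 by rewrite lef_pV2 ?posrE; lra.
exists (1 - s); first lra.
apply: le_trans (ler_bernoulli (2 * D) (ltW s0) _); last lra.
have : s * (4 * (D%:R + 1)) = 1 by rewrite mulVf //; lra.
rewrite natrM; nra.
Qed.

Lemma integral_le_measure F (U : set (BdT R mul inv one S)) :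
  cpt_continuous mul inv one S F -> measurable U ->
  (forall X, Bd X -> 0 <= F (inr X)) -> (forall X, Bd X -> F (inr X) <= (X \in U)%:R) ->
  (\int[nu]_(x in Bd) (F (inr x))%:E <= nu U)%E.
Proof.
move=> cF mU F0 FU.
apply: (@le_trans _ _ (\int[nu]_(x in Bd) (\1_U x)%:E)%E).
  apply: ge0_le_integral => //.
  - exact: Bd_measurable.
  - exact: cpt_continuous_measurable.
  - by apply/measurable_EFinP; exact: measurable_indic.
rewrite integral_indic //; last exact: Bd_measurable.
by apply: le_measure; rewrite ?inE //; apply: measurableI => //; exact: Bd_measurable.
Qed.

Lemma measure_le_integral F (U : set (BdT R mul inv one S)) :
  cpt_continuous mul inv one S F -> measurable U -> U `<=` Bd ->
  (forall X, Bd X -> 0 <= F (inr X)) -> (forall X, U X -> 1 <= F (inr X)) ->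
  (nu U <= \int[nu]_(x in Bd) (F (inr x))%:E)%E.
Proof.
move=> cF mU UB F0 FU.
apply: (@le_trans _ _ (\int[nu]_(x in Bd) (\1_U x)%:E)%E).
  by rewrite integral_indic ?setIidl //; exact: Bd_measurable.
apply: ge0_le_integral => //.
- exact: Bd_measurable.
- by apply/measurable_EFinP; exact: measurable_indic.
- exact: cpt_continuous_measurable.
- move=> X hX; rewrite lee_fin indicE.
  by have [/set_mem XU|] := boolP (X \in U); [exact: FU | move=> _; exact: F0].
Qed.

(** [U] is where a continuous cutoff is positive, hence open. That cutoff lies below the indicator
    of [U] and bounds its mass from below; a second, wider cutoff equals 1 on [U] and bounds it from
    above. *)
Lemma exists_shadow_sets : exists (R1 : nat) (c C' : R), [/\ 0 < c, 0 < C' &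
  forall g : G, exists U : set (BdT R mul inv one S),
  [/\ measurable U, U `<=` Bd,
    (forall X r, U X -> X r -> r 0%N = one -> (d (r (len g)) g <= R1)%N),
    (forall X r, Bd X -> X r -> r 0%N = one -> r (len g) = g -> U X) &
    ((c / lam ^+ len g)%:E <= nu U)%E /\ (nu U <= (C' / lam ^+ len g)%:E)%E]].
Proof.
have [theta /andP[th0 th1] thD] := exists_theta.
have il1 : 0 < lam^-1 < 1 by rewrite invr_gt0 invf_lt1 (lt_trans ltr01 lam1).
have /andP[il0 il] := il1.
have [j hj] := exists_expr_le (ltW il0) il (e := 2^-1) ltac:(by rewrite invr_gt0).
pose rho := (2 * (j + D))%N.
(* Rays of [U] end up in the shadow of width [rho + D], and [ray_shadow_near] adds [D]. The wider
   cutoff starts from width [rho + D] and vanishes beyond [rho + D + D]. *)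
exists (rho + D + D)%N, (4^-1), (lam ^+ (2 * (rho + D + D))); split.
- by [].
- by rewrite exprn_gt0 // (lt_trans ltr01 lam1).
move=> g.
pose f a := cutoff mul inv one S theta a g.
pose F a := bd_extend (f a).
have L0 : 0 <= 2 / theta ^+ (2 * len g) by rewrite divr_ge0 // exprn_ge0 // ltW.
have fL a : vis_lipschitz mul inv one S theta (2 / theta ^+ (2 * len g)) (f a).
  exact: cutoff_lipschitz.
have cF a : cpt_continuous mul inv one S (F a).
  exact: (bd_extend_continuous grp symS genS th0 th1 L0 (fL a)).
have f01 a h : 0 <= f a h <= 1 by rewrite cutoff_ge0 cutoff_le1.
have Fcv a X r : Bd X -> X r -> f a \o r @ \oo --> F a (inr X).
  exact: (bd_extend_cvg grp symS genS th0 th1 L0 (fL a)).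
have F01 a X : Bd X -> 0 <= F a (inr X) <= 1.
  move=> hX; have [r [Xr _ _]] := bpoint_ray grp symS genS H4 hX.
  have cv := Fcv a X r hX Xr; apply/andP; split.
    by rewrite -(cvg_lim _ cv) //; apply: limr_ge; [apply/cvg_ex; eexists; exact: cv|];
       apply: nearW => n; have /andP[] := f01 a (r n).
  by rewrite -(cvg_lim _ cv) //; apply: limr_le; [apply/cvg_ex; eexists; exact: cv|];
       apply: nearW => n; have /andP[] := f01 a (r n).
pose U : set (BdT R mul inv one S) := [set X | Bd X /\ 0 < F rho (inr X)].
have mU : measurable U by apply: bd_open_measurable; exact: cpt_continuous_open.
have Ush X r : U X -> X r -> exists N, forall n, (N <= n)%N -> shadow (rho + D) g (r n).
  move=> [hX FX] Xr; have /cvgr_gt/(_ _ FX)[N _ hN] := Fcv rho X r hX Xr.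
  exists N => n /hN /=; apply: contraTT => /(cutoff_out grp symS genS H4 th0 th1 thD) e.
  by rewrite /f e ltxx.
exists U; split => //.
- by move=> X [].
- move=> X r UX Xr r0; have [hX _] := UX; have [N hN] := Ush X r UX Xr.
  have := hN (N + len g)%N ltac:(lia).
  apply: (ray_shadow_near grp symS genS H4) => //; last lia.
  exact: bpoint_mem_ray hX Xr.
- move=> X r hX Xr r0 rg; split => //.
  have hr := bpoint_mem_ray hX Xr.
  suff -> : F rho (inr X) = 1 by [].
  rewrite -(cvg_lim _ (Fcv rho X r hX Xr)) //.
  apply: (cvg_lim (@Rhausdorff R)); apply: cvg_near_cst.
  exists (len g) => // n /= gn; apply: cutoff_in => //.
  by apply: (ray_near_shadow grp symS genS) => //; rewrite rg wdxx.
split.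
  apply: le_trans (integral_le_measure (cF rho) mU _ _).
  - rewrite mulrC; apply: (PS_lower grp symS genS H4 lam1 lower upper PS (cF rho) hj) => h.
    rewrite /F /=; have /andP[f0 f1] := f01 rho h; rewrite f1 andbT.
    by case: (boolP (shadow _ g h)) => // /cutoff_in e; rewrite /f e.
  - by move=> X /(F01 rho)/andP[].
  - move=> X hX; have /andP[F0 F1] := F01 rho X hX.
    case: (boolP (X \in U)) => // /negP XU; rewrite leNgt; apply/negP => F0'.
    by apply: XU; rewrite inE.
apply: (le_trans (measure_le_integral (cF (rho + D)%N) mU _ _ _)).
- by move=> X [].
- by move=> X /(F01 (rho + D)%N)/andP[].
- move=> X UX; have [hX _] := UX; have [r [Xr _ _]] := bpoint_ray grp symS genS H4 hX.
  have [N hN] := Ush X r UX Xr.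
  suff -> : F (rho + D)%N (inr X) = 1 by [].
  rewrite -(cvg_lim _ (Fcv (rho + D)%N X r hX Xr)) //.
  apply: (cvg_lim (@Rhausdorff R)); apply: cvg_near_cst.
  by exists N => // n /= /hN sh; apply: cutoff_in.
apply: (PS_upper grp genS lam1 upper PS (cF (rho + D)%N)) => h.
rewrite /F /=; have /andP[f0 f1] := f01 (rho + D)%N h; rewrite f0 /=.
by case: (boolP (shadow _ g h)) => // /(cutoff_out grp symS genS H4 th0 th1 thD) e; rewrite /f e.
Qed.

End Shadows.

(** * Norms of matrices *)

Section EntryNorm.
Variable R : realType.

(** The entrywise l1 norm serves vectors and matrices alike and is submultiplicative; by [opnorm_nm]
    it changes logarithms of operator norms only by a bounded amount. *)
Definition nm m n (A : 'M[R]_(m, n)) : R := \sum_i \sum_j `|A i j|.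

Lemma nm_ge0 m n (A : 'M[R]_(m, n)) : 0 <= nm A.
Proof. by apply: sumr_ge0 => i _; apply: sumr_ge0. Qed.

Lemma nm_entry m n (A : 'M[R]_(m, n)) i j : `|A i j| <= nm A.
Proof.
rewrite /nm (bigD1 i) //= (bigD1 j) //= -addrA lerDl.
by rewrite addr_ge0 ?sumr_ge0 // => k _; apply: sumr_ge0.
Qed.

Lemma nm_eq0 m n (A : 'M[R]_(m, n)) : nm A = 0 -> A = 0.
Proof.
move=> h; apply/matrixP => i j; rewrite mxE; apply/eqP; rewrite -normr_le0 -h.
exact: nm_entry.
Qed.

Lemma nm_gt0 m n (A : 'M[R]_(m, n)) : A != 0 -> 0 < nm A.
Proof.
by move=> A0; rewrite lt_neqAle nm_ge0 eq_sym andbT; apply: contraNneq A0 => /nm_eq0 ->.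
Qed.

Lemma nmZ m n a (A : 'M[R]_(m, n)) : nm (a *: A) = `|a| * nm A.
Proof.
rewrite /nm mulr_sumr; apply: eq_bigr => i _; rewrite mulr_sumr; apply: eq_bigr => j _.
by rewrite mxE normrM.
Qed.

Lemma nm0 m n : nm (0 : 'M[R]_(m, n)) = 0.
Proof. by rewrite -(scale0r 0) nmZ normr0 mul0r. Qed.

Lemma nm_tr m n (A : 'M[R]_(m, n)) : nm A^T = nm A.
Proof.
by rewrite /nm exchange_big; apply: eq_bigr => i _; apply: eq_bigr => j _; rewrite mxE.
Qed.

Lemma nmM m n p (A : 'M[R]_(m, n)) (B : 'M[R]_(n, p)) : nm (A *m B) <= nm A * nm B.
Proof.
rewrite /nm mulr_suml; apply: ler_sum => i _.
apply: (@le_trans _ _ (\sum_j \sum_k `|A i k| * `|B k j|)).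
  apply: ler_sum => j _; rewrite mxE; apply: le_trans (ler_norm_sum _ _ _) _.
  by apply: ler_sum => k _; rewrite normrM.
rewrite exchange_big mulr_suml; apply: ler_sum => k _; rewrite -mulr_sumr.
rewrite ler_wpM2l // (bigD1 k) //= lerDl; apply: sumr_ge0 => l _; exact: sumr_ge0.
Qed.

Lemma continuous_sumr (T : topologicalType) (I : Type) (s : seq I) (f : I -> T -> R) :
  (forall i, continuous (f i)) -> continuous (fun x => \sum_(i <- s) f i x).
Proof.
move=> cf; elim: s => [|i s IH] x.
  by under eq_fun do rewrite big_nil; exact: cst_continuous.
under eq_fun do rewrite big_cons.
by apply: continuousD; [exact: cf | exact: IH].
Qed.

Lemma nm_continuous n : continuous (@nm 1 n).
Proof.
rewrite /nm; apply: continuous_sumr => i; apply: continuous_sumr => j v.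
apply: continuous_comp; first exact: coord_continuous.
exact: norm_continuous.
Qed.

Lemma compact_sphere n : compact [set v : 'rV[R]_n | nm v = 1].
Proof.
apply: (@subclosed_compact _ _ [set v : 'rV[R]_n | forall i, `[-1, 1]%classic (v ord0 i)]).
- apply: (@preimage_closed _ _ (@nm 1 n) [set 1]); last exact: closed_eq.
  by move=> v _; exact: nm_continuous.
- by apply: (@rV_compact R n (fun=> `[-1, 1]%classic)) => i; exact: segment_compact.
- move=> v /= v1 i; rewrite /= in_itv /= -ler_norml -v1; exact: nm_entry.
Qed.

End EntryNorm.

Section OperatorNorm.
Variables (R : realType) (d : nat) (N : 'cV[R]_d -> R).
Hypothesis vN : is_vnorm N.

Lemma vnorm0 : N 0 = 0.
Proof.
by case: vN => _ [_ [/(_ 0 0) + _]]; rewrite scaler0 normr0 mul0r.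
Qed.

Lemma vnorm_gt0 v : v != 0 -> 0 < N v.
Proof.
case: vN => N0 [N00 _] v0; rewrite lt_neqAle N0 andbT eq_sym.
by apply: contraNneq v0 => /N00 ->.
Qed.

Lemma vnorm_sum (I : Type) (s : seq I) (f : I -> 'cV[R]_d) :
  N (\sum_(i <- s) f i) <= \sum_(i <- s) N (f i).
Proof.
have [_ [_ [_ ND]]] := vN; elim: s => [|i s IH]; first by rewrite !big_nil vnorm0.
by rewrite !big_cons; apply: le_trans (ND _ _) _; rewrite lerD2l.
Qed.

Lemma vnorm_upper : exists2 C, 0 < C & forall v, N v <= C * nm v.
Proof.
have [N0 [_ [NZ _]]] := vN.
exists (1 + \sum_(i < d) N (delta_mx i 0)).
  by rewrite ltr_pwDl // sumr_ge0.
move=> v; have e : v = \sum_i v i 0 *: delta_mx i 0.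
  by rewrite {1}[v]matrix_sum_delta; apply: eq_bigr => i _; rewrite big_ord1.
rewrite {1}e; apply: le_trans (vnorm_sum _ _) _.
rewrite mulrDl mul1r mulr_suml; apply: ler_wpDl; first exact: nm_ge0.
apply: ler_sum => i _; rewrite NZ mulrC ler_wpM2l //; exact: nm_entry.
Qed.

Lemma vnorm_lower : exists2 c, 0 < c & forall v, c * nm v <= N v.
Proof.
have [N0 [N00 [NZ ND]]] := vN; have [C C0 hC] := vnorm_upper.
pose M (u : 'rV[R]_d) := N u^T.
have MB u v : `|M u - M v| <= C * nm (u - v).
  have NN w : N (- w) = N w by rewrite -scaleN1r NZ normrN1 mul1r.
  have h a b : N a - N b <= N (a - b).
    by rewrite lerBlDr; apply: le_trans (ND _ _); rewrite subrK.
  rewrite -nm_tr linearB /=; apply: le_trans (hC _); rewrite ler_norml /M h andbT.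
  rewrite lerNl opprB; apply: le_trans (h _ _) _.
  by rewrite -NN opprB.
have cM : continuous M.
  move=> u; apply/(@cvgrPdist_lt _ _ _ (nbhs u) (nbhs_filter u)) => e e0.
  have cb : {for u, continuous (fun v : 'rV[R]_d => u - v)}.
    by apply: continuousB; [exact: cst_continuous | exact: cvg_id].
  have : nm (u - v) @[v --> u] --> nm (u - u).
    exact: (@continuous_comp _ _ _ (fun v : 'rV[R]_d => u - v) (@nm R 1 d) u cb (@nm_continuous R d _)).
  rewrite subrr nm0.
  move=> /cvgr_lt/(_ (e / C) (divr_gt0 e0 C0)); apply: filterS => v.
  rewrite ltr_pdivlMr // mulrC; exact: le_lt_trans.
have [A0|] := pselect ([set v : 'rV[R]_d | nm v = 1] !=set0); last first.
  move=> /set0P/negP/negPn/eqP A0; exists 1 => // v; have [->|v0] := eqVneq v 0.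
    by rewrite vnorm0 nm0 mulr0.
  have : [set v : 'rV[R]_d | nm v = 1] ((nm v)^-1 *: v^T).
    by rewrite /= nmZ nm_tr ger0_norm ?invr_ge0 ?nm_ge0 // mulVf // gt_eqF // nm_gt0.
  by rewrite A0.
have [u /set_mem /= u1 hu] := compact_EVT_min A0 (@compact_sphere R d)
  (continuous_subspaceT cM).
have M0 : 0 < M u.
  apply: vnorm_gt0; apply/eqP => /(congr1 trmx); rewrite trmxK trmx0 => u0.
  by move: u1; rewrite u0 nm0 => /eqP; rewrite eq_sym oner_eq0.
exists (M u) => // v; have [->|v0] := eqVneq v 0.
  by rewrite vnorm0 nm0 mulr0.
have nv : 0 < nm v by exact: nm_gt0.
have := hu ((nm v)^-1 *: v^T); rewrite inE /= nmZ nm_tr ger0_norm ?invr_ge0 ?nm_ge0 //.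
rewrite mulVf ?gt_eqF // => /(_ erefl); rewrite {2}/M linearZ /= trmxK NZ.
by rewrite ger0_norm ?invr_ge0 ?nm_ge0 // mulrC ler_pdivlMr.
Qed.

Lemma opnorm_nm : (0 < d)%N -> exists2 K, 1 <= K &
  forall A : 'M[R]_d, K^-1 * nm A <= opnorm N A /\ opnorm N A <= K * nm A.
Proof.
move=> d0; have [N0 [_ [NZ _]]] := vN.
have [C C0 hC] := vnorm_upper; have [c c0 hc] := vnorm_lower.
have d0' : 0 < d%:R :> R by rewrite ltr0n.
have ub A v : N v <= 1 -> N (A *m v) <= C / c * nm A.
  move=> v1; apply: le_trans (hC _) _; rewrite -mulrA ler_pM2l //.
  apply: le_trans (nmM _ _) _; rewrite mulrC ler_wpM2r ?nm_ge0 //.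
  by rewrite -[c^-1]mul1r ler_pdivlMr // mulrC; apply: le_trans v1.
have hs A : has_sup [set N (A *m v) | v in [set v | N v <= 1]].
  split; first by exists (N (A *m 0)), 0 => //=; rewrite vnorm0.
  by exists (C / c * nm A) => _ [v /= v1 <-]; exact: ub.
have up A : opnorm N A <= C / c * nm A.
  by apply: ge_sup; [exact: (hs A).1 | move=> _ [v /= v1 <-]; exact: ub].
have lo A : c / C * nm A <= d%:R * opnorm N A.
  have -> : nm A = \sum_j nm (col j A).
    rewrite /nm exchange_big; apply: eq_bigr => j _; apply: eq_bigr => i _.
    by rewrite big_ord1 mxE.
  rewrite mulr_sumr; have -> : d%:R * opnorm N A = \sum_(j < d) opnorm N A.
    by rewrite sumr_const card_ord mulr_natl.
  apply: ler_sum => j _; pose e : 'cV[R]_d := delta_mx j 0.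
  have e0 : e != 0.
    by apply/eqP => /matrixP/(_ j 0); rewrite !mxE !eqxx => /eqP; rewrite oner_eq0.
  have Ne : 0 < N e by exact: vnorm_gt0.
  have NC : N e <= C.
    apply: le_trans (hC _) _; rewrite ler_piMr ?(ltW C0) //.
    rewrite /nm (bigD1 j) //= big_ord1 !mxE !eqxx normr1 big1 ?addr0 // => i ij.
    by rewrite big_ord1 !mxE (negbTE ij) normr0.
  apply: (@le_trans _ _ (N (A *m ((N e)^-1 *: e)))); last first.
    apply: ub_le_sup; first exact: (hs A).2.
    exists ((N e)^-1 *: e) => //=.
    by rewrite NZ ger0_norm ?invr_ge0 ?N0 // mulVf // gt_eqF.
  rewrite -scalemxAr NZ -colE ger0_norm ?invr_ge0 ?N0 //.
  rewrite mulrAC mulrC; apply: ler_pM; rewrite ?invr_ge0 ?mulr_ge0 ?nm_ge0 ?(ltW C0) ?(ltW c0) //.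
  by rewrite lef_pV2 ?posrE.
pose K := 1 + C / c + d%:R * (C / c).
have Cc : 0 < C / c by rewrite divr_gt0.
have dCc : 0 < d%:R * (C / c) by rewrite mulr_gt0.
have K0 : 0 < K by rewrite /K; lra.
exists K => [|A]; first by rewrite /K; lra.
have op0 : 0 <= opnorm N A.
  by apply: le_trans (N0 (A *m 0)) _; apply: ub_le_sup; [exact: (hs A).2|exists 0 => //=; rewrite vnorm0].
split.
  rewrite mulrC ler_pdivrMr // mulrC.
  apply: (@le_trans _ _ (d%:R * (C / c) * opnorm N A)); last by rewrite ler_wpM2r // /K; lra.
  have := lo A; rewrite -(ler_pM2l Cc) [X in X <= _](_ : _ = nm A).
    by rewrite mulrCA mulrA.
  by field; rewrite !gt_eqF.
by apply: le_trans (up A) _; rewrite ler_wpM2r ?nm_ge0 // /K; lra.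
Qed.

End OperatorNorm.

(** * Growth along a direction *)

Section Representation.
Variables (R : realType) (G : eqType) (mul : G -> G -> G) (inv : G -> G) (one : G) (S : seq G).
Hypothesis grp : is_group mul inv one.
Hypothesis symS : symmetric_set inv S.
Hypothesis genS : generates mul one S.
Variables (d : nat) (rho : G -> 'M[R]_d).
Hypothesis d_gt0 : (0 < d)%N.
Hypothesis rep : is_rep mul one rho.
Hypothesis irr : strongly_irreducible rho.

Local Notation len := (wlen mul one S).
Local Notation dist := (wdist mul inv one S).

Lemma repM g h : rho (mul g h) = rho g *m rho h. Proof. by case: rep. Qed.
Lemma rep1 : rho one = 1%:M. Proof. by case: rep => _ []. Qed.
Lemma rep_unit g : rho g \in unitmx. Proof. by case: rep => _ []. Qed.

(** A span of maximal dimension cannot grow. Linear conditions on all of [rho g] can then be tested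
    on finitely many elements. *)
Lemma exists_spanning_seq : exists Fs : seq G, forall g, rho g \in <<map rho Fs>>%VS.
Proof.
pose P n := `[< exists Fs : seq G, \dim <<map rho Fs>>%VS = n >].
have Pb n : P n -> (n <= dim 'M[R]_d)%N.
  by move=> /asboolP[Fs <-]; rewrite -dimvf; apply: dimvS; exact: subvf.
have exP : exists n, P n by exists (\dim <<map rho [::]>>%VS); apply/asboolP; exists [::].
case: (ex_maxnP exP Pb) => n /asboolP[Fs dF] hmax.
exists Fs => g; apply: contraT => gF.
have : P (\dim <<map rho (g :: Fs)>>%VS) by apply/asboolP; exists (g :: Fs).
move=> /hmax; rewrite /= span_cons -dF leqNgt => /negP[].
rewrite (ltn_leqif (dimv_leqif_eq (addvSr _ _))).
apply: contra gF => /eqP ->.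
by apply: (subvP (addvSl _ _)); exact: memv_line.
Qed.

Lemma rV_dot_eq0 (u : 'rV[R]_d) : u *m u^T = 0 -> u = 0.
Proof.
move=> /matrixP/(_ 0 0); rewrite !mxE => h.
apply/rowP => j; rewrite mxE; apply/eqP; rewrite -sqrf_eq0.
have /eqP := h; rewrite psumr_eq0 => [/allP/(_ j (mem_index_enum _))|k _].
  by rewrite mxE /= -expr2.
by rewrite mxE -expr2 sqr_ge0.
Qed.

(** Otherwise the vectors orthogonal to all [u *m rho g] form an invariant subspace, which contains
    [y] but not [u], since [u *m u^T] is nonzero: this contradicts irreducibility. *)
Lemma span_nonvanishing Fs (u y : 'rV[R]_d) : (forall g, rho g \in <<map rho Fs>>%VS) ->
  u != 0 -> y != 0 -> exists2 f, f \in Fs & u *m rho f *m y^T != 0.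
Proof.
move=> hF u0 y0; apply: contrapT => hn.
have z f : f \in Fs -> u *m rho f *m y^T = 0.
  by move=> fF; apply/eqP; apply: contraT => c; case: hn; exists f.
pose E := (\sum_(i < size Fs) <<u *m rho (nth one Fs i)>>)%MS.
have spanz (v : 'rV[R]_d) :
    (forall f, f \in Fs -> u *m rho f *m v^T = 0) -> forall g, u *m rho g *m v^T = 0.
  move=> hv g; rewrite (coord_span (X := in_tuple (map rho Fs)) (hF g)).
  rewrite mulmx_sumr mulmx_suml big1 // => i _.
  have iF : (i < size Fs)%N by rewrite -[X in (_ < X)%N](size_map rho).
  by rewrite -scalemxAr -scalemxAl (nth_map one) ?hv ?scaler0 ?mem_nth.
have uE f : f \in Fs -> (u *m rho f <= E)%MS.
  move=> fF; have iF : (index f Fs < size Fs)%N by rewrite index_mem.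
  apply: submx_trans (sumsmx_sup (Ordinal iF) isT (submx_refl _)).
  by rewrite genmxE /= nth_index.
have WP (v : 'rV[R]_d) : (v <= kermx E^T)%MS <-> forall g, u *m rho g *m v^T = 0.
  rewrite sub_kermx; split=> [/eqP vE|hv].
    apply: spanz => f /uE /submxP[B ->].
    by rewrite -mulmxA -[E *m v^T]trmxK trmx_mul trmxK vE trmx0 mulmx0.
  have : (E <= kermx v^T)%MS.
    by apply/sumsmx_subP => i _; rewrite genmxE sub_kermx hv.
  by rewrite sub_kermx -trmx_eq0 trmx_mul trmxK.
have WF : (0 < \rank (kermx E^T) < d)%N.
  apply/andP; split.
    rewrite lt0n mxrank_eq0; apply: contra y0 => /eqP k0.
    by have /WP := spanz y z; rewrite k0 submx0.
  rewrite ltn_neqAle rank_leq_col andbT; apply: contra u0 => /eqP rk.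
  have : row_full (kermx E^T) by rewrite /row_full rk.
  move=> /(submx_full u)/WP/(_ one).
  by rewrite rep1 mulmx1 => /rV_dot_eq0 ->.
apply: (irr (Ws := [:: kermx E^T])) => //=; first by rewrite WF.
move=> g v; rewrite !orbF => /WP hv; apply/WP => h.
by rewrite trmxK mulmxA -(mulmxA u) -repM -[v]trmxK hv.
Qed.

(** [Phi] is continuous and positive on a product of two unit spheres, so it has a positive minimum;
    one of its terms is at least the average, and homogeneity does the rest. *)
Lemma exists_transversal : exists (Fs : seq G) (c : R), 0 < c /\
  forall u y : 'rV[R]_d, exists2 f, f \in Fs & c * (nm u * nm y) <= nm (u *m rho f *m y^T).
Proof.
have [Fs hF] := exists_spanning_seq.
pose K := [set v : 'rV[R]_d | nm v = 1].
pose Phi (p : 'rV[R]_d * 'rV[R]_d) := \sum_(f <- Fs) nm (p.1 *m rho f *m p.2^T).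
have cPhi : continuous Phi.
  apply: continuous_sumr => f; rewrite /nm; apply: continuous_sumr => i; apply: continuous_sumr => j p.
  apply: continuous_comp; last exact: norm_continuous.
  have -> : (fun p : 'rV[R]_d * 'rV[R]_d => (p.1 *m rho f *m p.2^T) i j) =
    (fun p : 'rV[R]_d * 'rV[R]_d => \sum_k \sum_l p.1 i l * rho f l k * p.2 j k).
    apply/funext => q; rewrite mxE; apply: eq_bigr => k _; rewrite !mxE mulr_suml.
    by apply: eq_bigr.
  apply: continuous_sumr => k; apply: continuous_sumr => l q.
  apply: (@continuousM _ _ (fun p : 'rV[R]_d * 'rV[R]_d => p.1 i l * rho f l k) (fun p => p.2 j k)).
    apply: (@continuousM _ _ (fun p : 'rV[R]_d * 'rV[R]_d => p.1 i l) (fun=> rho f l k)).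
      by apply: (@continuous_comp _ _ _ fst (fun M : 'rV[R]_d => M i l)); [exact: cvg_fst | exact: coord_continuous].
    exact: cst_continuous.
  by apply: (@continuous_comp _ _ _ snd (fun M : 'rV[R]_d => M j k)); [exact: cvg_snd | exact: coord_continuous].
pose e : 'rV[R]_d := delta_mx 0 (Ordinal d_gt0).
have Ke : K e.
  rewrite /K /= /nm big_ord1 (bigD1 (Ordinal d_gt0)) //= !mxE !eqxx normr1 big1 ?addr0 // => i ij.
  by rewrite !mxE (negbTE ij) normr0.
have KK0 : (K `*` K) !=set0 by exists (e, e).
have cK : compact (K `*` K) by apply: compact_setX; exact: compact_sphere.
have [[u0 y0] /set_mem /= [u1 y1] hmin] := compact_EVT_min KK0 cK (continuous_subspaceT cPhi).
have neq0 (v : 'rV[R]_d) : nm v = 1 -> v != 0.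
  by move=> v1; apply/eqP => v0; move: v1; rewrite v0 nm0 => /eqP; rewrite eq_sym oner_eq0.
have Phi0 : 0 < Phi (u0, y0).
  have [f fF nz] := span_nonvanishing hF (neq0 _ u1) (neq0 _ y1).
  rewrite /Phi (big_rem f) //= ltr_wpDr ?nm_gt0 //.
  by apply: sumr_ge0 => h _; exact: nm_ge0.
have sF : (0 < size Fs)%N.
  by rewrite lt0n size_eq0; apply/eqP => Fs0; move: Phi0; rewrite /Phi Fs0 big_nil ltxx.
exists Fs, (Phi (u0, y0) / (size Fs)%:R); split; first by rewrite divr_gt0 // ltr0n.
move=> u y; have [f0 f0F] : exists f, f \in Fs.
  by case: (Fs) sF => // f0 s _; exists f0; rewrite mem_head.
have [->|un] := eqVneq u 0; first by exists f0; rewrite // nm0 mul0r mulr0 nm_ge0.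
have [->|yn] := eqVneq y 0; first by exists f0; rewrite // nm0 mulr0 mulr0 nm_ge0.
apply: contrapT => hn.
have lt f : f \in Fs -> nm (u *m rho f *m y^T) < Phi (u0, y0) / (size Fs)%:R * (nm u * nm y).
  by move=> fF; rewrite ltNge; apply/negP => le; apply: hn; exists f.
have nu0 := nm_gt0 un; have ny0 := nm_gt0 yn.
have ni (v : 'rV[R]_d) : v != 0 -> nm ((nm v)^-1 *: v) = 1.
  by move=> v0; rewrite nmZ ger0_norm ?invr_ge0 ?nm_ge0 // mulVf // gt_eqF // nm_gt0.
have := hmin ((nm u)^-1 *: u, (nm y)^-1 *: y).
rewrite inE /= => /(_ (conj (ni u un) (ni y yn))); rewrite leNgt => /negP; apply.
have -> : Phi ((nm u)^-1 *: u, (nm y)^-1 *: y) = (nm u * nm y)^-1 * Phi (u, y).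
  rewrite /Phi mulr_sumr; apply: eq_bigr => f _ /=.
  rewrite linearZ /= -scalemxAr -!scalemxAl scalerA nmZ invfM.
  rewrite ger0_norm ?mulr_ge0 ?invr_ge0 ?nm_ge0 //.
  by congr (_ * _); rewrite mulrC.
rewrite mulrC ltr_pdivrMr ?mulr_gt0 //.
apply: (@lt_le_trans _ _ (\sum_(f <- Fs) Phi (u0, y0) / (size Fs)%:R * (nm u * nm y))).
  rewrite /Phi big_seq [ltRHS]big_seq; apply: ltr_sum; first by apply/hasP; exists f0.
  by move=> f fF; exact: lt.
rewrite big_const_seq count_predT iter_addr_0 -mulr_natl.
rewrite [leLHS](_ : _ = Phi (u0, y0) * (nm u * nm y)) //.
by field; rewrite pnatr_eq0 -lt0n.
Qed.

Definition dir := {u : 'rV[R]_d | u != 0}.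
Definition lognorm (g : G) : R := ln (nm (rho g)).
(** The logarithmic growth of the row vector [u]: an additive cocycle over the right action
    [dir_act]. *)
Definition ell (u : dir) (g : G) : R := ln (nm (sval u *m rho g)) - ln (nm (sval u)).

Lemma rep_neq0 (u : 'rV[R]_d) g : u != 0 -> u *m rho g != 0.
Proof.
apply: contra => /eqP h; apply/eqP.
by rewrite -(mulmxK (rep_unit g) u) h mul0mx.
Qed.

Definition dir_act (u : dir) (g : G) : dir :=
  exist _ (sval u *m rho g) (rep_neq0 g (svalP u)).

Lemma nm_rep_gt0 g : 0 < nm (rho g).
Proof.
have e0 : (delta_mx 0 (Ordinal d_gt0) : 'rV[R]_d) != 0.
  by apply/eqP => /matrixP/(_ 0 (Ordinal d_gt0)); rewrite !mxE !eqxx => /eqP; rewrite oner_eq0.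
by apply: nm_gt0; apply: contraNneq (rep_neq0 g e0) => ->; rewrite mulmx0.
Qed.

Lemma ell1 u : ell u one = 0.
Proof. by rewrite /ell rep1 mulmx1 subrr. Qed.

Lemma ellM u g h : ell u (mul g h) = ell u g + ell (dir_act u g) h.
Proof. by rewrite /ell /= repM mulmxA; ring. Qed.

Lemma ell_le u g : ell u g <= lognorm g.
Proof.
have un := nm_gt0 (svalP u); rewrite /ell lerBlDr -lnM ?posrE ?nm_rep_gt0 //.
rewrite ler_ln ?posrE ?mulr_gt0 ?nm_rep_gt0 ?nm_gt0 ?rep_neq0 ?(svalP u) //.
by rewrite mulrC; exact: nmM.
Qed.

Lemma lognormM g h : lognorm (mul g h) <= lognorm g + lognorm h.
Proof.
rewrite /lognorm -lnM ?posrE ?nm_rep_gt0 // ler_ln ?posrE ?mulr_gt0 ?nm_rep_gt0 //.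
by rewrite repM; exact: nmM.
Qed.

Lemma nm_mul_rep_bound : exists2 B, 1 <= B & forall m (A : 'M[R]_(m, d)) h,
  nm (A *m rho h) <= nm A * B ^+ len h.
Proof.
pose B := 1 + \sum_(s <- S) nm (rho s).
have B1 : 1 <= B by rewrite /B lerDl sumr_ge0 // => s _; exact: nm_ge0.
exists B => // m A h; have [w [<- al <-]] := wlenP genS h.
elim: w A al => [|s w IH] A /=; first by rewrite rep1 mulmx1 mulr1.
move=> /andP[sS al]; rewrite repM mulmxA; apply: le_trans (IH _ al) _.
rewrite exprS mulrA ler_wpM2r ?exprn_ge0 ?(le_trans ler01 B1) //.
apply: le_trans (nmM _ _) _; rewrite ler_wpM2l ?nm_ge0 //.
rewrite /B (big_rem s) //=; have := nm_ge0 (rho s).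
have : 0 <= \sum_(t <- rem s S) nm (rho t) by apply: sumr_ge0 => t _; exact: nm_ge0.
lra.
Qed.

(** Moving from [g] to [h] multiplies on the right by a word of length [dist g h], and each letter
    costs at most a factor [B]. *)
Lemma log_lipschitz : exists2 L0, 0 <= L0 &
  (forall g h, `|lognorm g - lognorm h| <= L0 * (dist g h)%:R) /\
  (forall u g h, `|ell u g - ell u h| <= L0 * (dist g h)%:R).
Proof.
have [B B1 hB] := nm_mul_rep_bound; exists (ln B); first exact: ln_ge0.
have B0 : 0 < B by apply: lt_le_trans B1.
have half m (A : 'M[R]_(m, d)) g h : (forall k, 0 < nm (A *m rho k)) ->
    ln (nm (A *m rho h)) - ln (nm (A *m rho g)) <= ln B * (dist g h)%:R.
  move=> A0; rewrite lerBlDl mulr_natr -lnXn // -lnM ?posrE ?exprn_gt0 //.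
  rewrite ler_ln ?posrE ?mulr_gt0 ?exprn_gt0 //.
  by rewrite /wdist; apply: le_trans (hB _ _ _); rewrite -mulmxA -repM (gmulKV grp).
split=> [g h|u g h].
  have := half _ 1%:M; rewrite /lognorm => hf.
  have A0 k : 0 < nm (1%:M *m rho k) by rewrite mul1mx nm_rep_gt0.
  have := hf g h A0; have := hf h g A0; rewrite !mul1mx [dist h g](wdC grp symS genS).
  by rewrite ler_norml => h1 h2; apply/andP; split; lra.
have A0 k : 0 < nm (sval u *m rho k) by exact/nm_gt0/rep_neq0/(svalP u).
have := half _ (sval u) g h A0; have := half _ (sval u) h g A0.
rewrite /ell [dist h g](wdC grp symS genS).
by rewrite ler_norml => h1 h2; apply/andP; split; lra.
Qed.

(** Apply the transversality to a column of [rho b] that carries at least the fraction [1 / d] of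
    its norm. *)
Lemma ell_transversal : exists (Fs : seq G) (c : R), forall u b,
  exists2 f, f \in Fs & lognorm b - c <= ell u (mul f b).
Proof.
have [Fs [c [c0 hc]]] := exists_transversal.
have d0 : 0 < d%:R :> R by rewrite ltr0n.
exists Fs, (- ln (c / d%:R)) => u b.
have [j hj] : exists j, nm (rho b) <= d%:R * nm (col j (rho b)).
  apply: contrapT => hn; have lt j : d%:R * nm (col j (rho b)) < nm (rho b).
    by rewrite ltNge; apply/negP => le; apply: hn; exists j.
  have e : nm (rho b) = \sum_j nm (col j (rho b)).
    rewrite /nm exchange_big; apply: eq_bigr => j _; apply: eq_bigr => i _.
    by rewrite big_ord1 mxE.
  have : \sum_(j < d) d%:R * nm (col j (rho b)) < \sum_(j < d) nm (rho b).
    apply: ltr_sum; first by apply/hasP; exists (Ordinal d_gt0); rewrite ?mem_index_enum.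
    by move=> j _; exact: lt.
  by rewrite -mulr_sumr -e sumr_const card_ord mulr_natl ltxx.
have [f fF hf] := hc (sval u) (col j (rho b))^T.
exists f => //; rewrite opprK nm_tr trmxK in hf *.
have un := nm_gt0 (svalP u); have bn := nm_rep_gt0 b.
have id0 : 0 < d%:R^-1 :> R by rewrite invr_gt0.
have A0 : 0 < nm (sval u *m rho (mul f b)) by exact/nm_gt0/rep_neq0/(svalP u).
rewrite /lognorm /ell lerBrDr -!lnM ?posrE ?mulr_gt0 //.
rewrite ler_ln ?posrE ?mulr_gt0 //.
apply: (@le_trans _ _ (nm (sval u *m rho f *m col j (rho b)))); last first.
  rewrite repM mulmxA /nm; apply: ler_sum => i _; rewrite big_ord1 -[leLHS]addr0.
  rewrite [leRHS](bigD1 j) //= lerD ?sumr_ge0 // colE mulmxA -colE mxE.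
  exact: lexx.
apply: le_trans hf; rewrite [leLHS](_ : _ = c * (nm (sval u) * (nm (rho b) / d%:R))).
  by rewrite ler_pM2l // ler_pM2l // ler_pdivrMr // mulrC.
by field; rewrite gt_eqF.
Qed.

End Representation.

(** * Outer probability *)

Section OuterProbability.
Variables (disp : measure_display) (R : realType) (T : measurableType disp) (mu : probability T R).

(** [mu_ext] never exceeds 1 here, so [fine] loses nothing. *)
Definition outer (A : set T) : R := fine (mu_ext mu A).

Lemma mu_ext_le1 A : (mu_ext mu A <= 1)%E.
Proof.
rewrite -(probability_setT mu) -(measurable_mu_extE mu measurableT).
exact: le_mu_ext.
Qed.

Lemma outerE A : mu_ext mu A = (outer A)%:E.
Proof.
rewrite /outer fineK // ge0_fin_numE ?mu_ext_ge0 //.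
by apply: le_lt_trans (mu_ext_le1 A) _; rewrite ltry.
Qed.

Lemma outer_ge0 A : 0 <= outer A.
Proof. by rewrite -lee_fin -outerE mu_ext_ge0. Qed.

Lemma outer_le1 A : outer A <= 1.
Proof. by rewrite -lee_fin -outerE mu_ext_le1. Qed.

Lemma outer_mono A B : A `<=` B -> outer A <= outer B.
Proof. by move=> AB; rewrite -lee_fin -!outerE; exact: le_mu_ext. Qed.

Lemma outer_measurable A : measurable A -> mu A = (outer A)%:E.
Proof. by move=> mA; rewrite -outerE measurable_mu_extE. Qed.

Lemma outer_sum (I : Type) (s : seq I) (A : I -> set T) :
  outer (\big[setU/set0]_(i <- s) A i) <= \sum_(i <- s) outer (A i).
Proof.
elim: s => [|i s IH].
  rewrite !big_nil -lee_fin -outer_measurable; last exact: measurable0.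
  by rewrite measure0.
rewrite !big_cons; apply: (@le_trans _ _ (outer (A i) + outer (\big[setU/set0]_(i <- s) A i))).
  by rewrite -lee_fin EFinD -!outerE; exact: outer_measureU2.
by rewrite lerD2l.
Qed.

(** Caratheodory's identity for [V], with [W] as test set; [E] may be any set. *)
Lemma outer_disjoint V E W : measurable V -> V `&` E = set0 -> V `<=` W -> E `<=` W ->
  outer V + outer E <= outer W.
Proof.
move=> mV VE VW EW; have := caratheodory_measurable_mu_ext mu mV W.
rewrite /= !outerE -EFinD => -[->]; apply: lerD; apply: outer_mono.
  by move=> x Vx; split => //; exact: VW.
move=> x Ex; split; first exact: EW.
by move=> Vx; have : (V `&` E) x by []; rewrite VE.
Qed.

(** Integrate the sum of the indicators, which is at most [M] on [W]. *)
Lemma outer_overlap (I : Type) (s : seq I) (V : I -> set T) (W : set T) (M : nat) :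
  (forall i, measurable (V i)) -> measurable W -> (forall i, V i `<=` W) ->
  (forall x, (count (fun i => x \in V i) s <= M)%N) ->
  \sum_(i <- s) outer (V i) <= M%:R * outer W.
Proof.
move=> mV mW VW hM; rewrite -lee_fin -sumEFin EFinM -outer_measurable //.
under eq_bigr do rewrite -outer_measurable //.
have -> : (\sum_(i <- s) mu (V i) = \sum_(i <- s) \int[mu]_(x in W) (\1_(V i) x)%:E)%E.
  by apply: eq_bigr => i _; rewrite integral_indic // setIidl.
have mI i : measurable_fun W (fun x => (\1_(V i) x)%:E : \bar R).
  by apply/measurable_EFinP; exact: measurable_indic.
rewrite -ge0_integral_sum //.
rewrite -integral_cst //; apply: ge0_le_integral => //.
- by move=> x _; apply: sume_ge0 => i _; rewrite lee_fin.
- exact: emeasurable_sum.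
move=> x _; rewrite sumEFin lee_fin; under eq_bigr do rewrite indicE.
rewrite -natr_sum ler_nat; apply: leq_trans (hM x); rewrite -sum1_count [leqRHS]big_mkcond.
by apply: leq_sum => i _; case: (_ \in _).
Qed.

(** The unions of the [V k] for [k >= n] decrease to a null set, and a finite measure is continuous
    from above. *)
Lemma outer_lim_sup (V : nat -> set T) (A : set T) : (forall n, measurable (V n)) ->
  mu.-negligible A -> lim_sup_set V `<=` A ->
  forall e, 0 < e -> exists N, forall n, (N <= n)%N -> outer (V n) <= e.
Proof.
move=> mV nA VA e e0.
have mL : measurable (lim_sup_set V).
  by apply: bigcapT_measurable => n; apply: bigcup_measurable => k _; exact: mV.
have L0 : mu (lim_sup_set V) = 0%E.
  by apply/(negligibleP mu mL); exact: negligibleS VA nA.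
have mU n : measurable (\bigcup_(k in [set k | (n <= k)%N]) V k).
  by apply: bigcup_measurable => k _; exact: mV.
have fin : (mu (\bigcup_(k in [set k | (0 <= k)%N]) V k) < +oo)%E.
  by apply: le_lt_trans (probability_le1 _ (mU 0%N)) _; rewrite ltry.
have cv : mu (\bigcup_(k in [set k | (n <= k)%N]) V k) @[n --> \oo] --> 0%E.
  by rewrite -L0; exact: lim_sup_set_cvg.
have /fine_cvgP[_ /cvgr_lt/(_ _ e0)[N _ hN]] := cv.
exists N => n Nn; apply: ltW; apply: le_lt_trans (hN n Nn).
rewrite /= -lee_fin -outer_measurable // fineK; last exact: fin_num_measure.
apply: le_measure; rewrite ?inE //.
by apply: bigcup_sup => /=.
Qed.

End OuterProbability.

(** * Large deviations *)

Section Deviations.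
Variables (R : realType) (G : eqType) (mul : G -> G -> G) (inv : G -> G) (one : G) (S : seq G).
Hypothesis grp : is_group mul inv one.
Hypothesis symS : symmetric_set inv S.
Hypothesis genS : generates mul one S.
Variable D : nat.
Hypothesis H4 : four_point mul inv one S D.

Local Notation len := (wlen mul one S).
Local Notation d := (wdist mul inv one S).
Local Notation shad := (shadow mul inv one S).
Local Notation ball := (ball mul one S).
Local Notation sph := (sph mul one S).
Local Notation "x ** y" := (mul x y) (at level 40, left associativity).
Local Notation Bd := (Bd mul inv one S : set (BdT R mul inv one S)).
Local Notation dC := (wdC grp symS genS).
Local Notation tri := (wd_tri grp genS).

Variables (lam C : R) (nu : probability (BdT R mul inv one S) R).
Hypothesis lam1 : 1 < lam.
Hypothesis lower : forall n, lam ^+ n <= (size (sph n))%:R.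
Hypothesis upper : forall n, (size (sph n))%:R <= C * lam ^+ n.

Variables (R1 : nat) (c C' : R) (U : G -> set (BdT R mul inv one S)).
Hypothesis c0 : 0 < c.
Hypothesis C'0 : 0 < C'.
Hypothesis mU : forall g, measurable (U g).
Hypothesis UBd : forall g, U g `<=` Bd.
Hypothesis Unear : forall g X r, U g X -> X r -> r 0%N = one -> (d (r (len g)) g <= R1)%N.
Hypothesis Umem : forall X r n, Bd X -> X r -> r 0%N = one -> U (r n) X.
Hypothesis Ulow : forall g, c / lam ^+ len g <= outer nu (U g).
Hypothesis Uup : forall g, outer nu (U g) <= C' / lam ^+ len g.

(** In the application [phi] is [lognorm rho], and [U] comes from [exists_shadow_sets]. *)
Variables (phi : G -> R) (Lam L0 : R).
Hypothesis L0_ge0 : 0 <= L0.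
Hypothesis phiL : forall g h, `|phi g - phi h| <= L0 * (d g h)%:R.
Hypothesis phi_ae : {ae nu, forall X, Bd X -> forall r, X r ->
  (fun n : nat => phi (r n) / n%:R) @ \oo --> Lam}.

Let lam0 : 0 < lam. Proof. exact: lt_trans lam1. Qed.
Let lamn n : 0 < lam ^+ n. Proof. by rewrite exprn_gt0. Qed.

Lemma lipschitz_le (f : G -> R) g h k : (forall g h, `|f g - f h| <= L0 * (d g h)%:R) ->
  (d g h <= k)%N -> f g <= f h + L0 * k%:R.
Proof.
move=> fL gh; have := fL g h; rewrite ler_norml => /andP[_ h1].
have : L0 * (d g h)%:R <= L0 * k%:R by rewrite ler_wpM2l // ler_nat.
lra.
Qed.

Lemma Bd_ray X : Bd X -> exists r, [/\ X r, is_ray mul inv one S r & r 0%N = one].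
Proof. exact: (bpoint_ray grp symS genS H4). Qed.

Lemma near_level r h n w : is_ray mul inv one S r -> (d (r (len h)) h <= R1)%N ->
  (len h <= n + w)%N -> (n <= len h + w)%N -> (d (r n) h <= R1 + w)%N.
Proof.
move=> hr dh h1 h2; have := tri (r (len h)) (r n) h.
have [le|lt] := leqP n (len h).
  by rewrite hr //; move: dh h1 h2 le; clear; lia.
by rewrite [d (r n) (r (len h))]dC hr ?(ltnW lt) //; move: dh h1 h2 lt; clear; lia.
Qed.

(** A ray to [X] passes near each counted [b] at time [len b], so all of them lie near [r n]. *)
Lemma shadow_count s n w X : uniq s ->
  (forall b, b \in s -> (n <= len b + w)%N /\ (len b <= n + w)%N) ->
  (count (fun b => X \in U b) s <= size (ball (R1 + w).+1))%N.
Proof.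
move=> us hs; have [XB|XB] := pselect (Bd X); last first.
  rewrite (eq_in_count (a2 := pred0)) ?count_pred0 // => b _.
  by apply/negbTE/negP => /set_mem/UBd.
have [r [Xr hr r0]] := Bd_ray XB.
apply: leq_trans (count_near grp genS (r n) (R1 + w) us).
rewrite -size_filter; apply: uniq_leq_size; first by rewrite filter_uniq.
move=> b; rewrite !mem_filter => /andP[/set_mem XU bs]; rewrite bs andbT.
have [h1 h2] := hs b bs; exact: (near_level hr (Unear XU Xr r0) h2 h1).
Qed.

Lemma bigU_measurable (s : seq G) : measurable (\big[setU/set0]_(b <- s) U b).
Proof. by elim: s => [|b s IH]; rewrite ?big_nil ?big_cons //; exact: measurableU. Qed.

Lemma bigU_mem (I : eqType) (T : Type) (s : seq I) (V : I -> set T) X :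
  (\big[setU/set0]_(b <- s) V b) X -> exists2 b, b \in s & V b X.
Proof.
elim: s => [|b s IH]; rewrite ?big_nil ?big_cons // => -[VX|/IH[b' bs VX]].
  by exists b; rewrite ?mem_head.
by exists b'; rewrite // inE bs orbT.
Qed.

Lemma mem_bigU (I : eqType) (T : Type) (s : seq I) (V : I -> set T) b : b \in s ->
  V b `<=` \big[setU/set0]_(b <- s) V b.
Proof.
elim: s => [//|a s IH]; rewrite inE big_cons => /orP[/eqP ->|/IH h] X VX; first by left.
by right; exact: h.
Qed.

Lemma sphere_shadow_overlap s n : uniq s -> (forall b, b \in s -> len b = n) ->
  (size s)%:R * (c / lam ^+ n) <=
  (size (ball R1.+1))%:R * outer nu (\big[setU/set0]_(b <- s) U b).
Proof.
move=> us hs; pose V b := if b \in s then U b else set0.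
apply: (@le_trans _ _ (\sum_(b <- s) outer nu (V b))).
  rewrite mulr_natl -iter_addr_0 -(count_predT s) -big_const_seq.
  rewrite big_seq [leRHS]big_seq; apply: ler_sum => b bs.
  by rewrite /V bs -(hs b bs); exact: Ulow.
apply: outer_overlap.
- by move=> b; rewrite /V; case: ifP.
- exact: bigU_measurable.
- by move=> b; rewrite /V; case: ifP => [bs|_]; [exact: (@mem_bigU _ _ s U b bs) | exact: sub0set].
- move=> X; rewrite (eq_in_count (a2 := fun b => X \in U b)) => [|b bs]; last by rewrite /V bs.
  rewrite -(addn0 R1); apply: (@shadow_count s n) => // b bs.
  by rewrite hs // !addn0.
Qed.

(** A point in infinitely many [V T] has a ray passing within [R1] of atypical elements at
    arbitrarily late times, against the almost sure convergence. So [V T] has probability tending to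
    0, and bounded overlap turns this into a count. *)
Lemma typical e eta : 0 < e -> 0 < eta -> exists T0, forall T, (T0 <= T)%N ->
  (size [seq b <- sph T | e * T%:R < `|phi b - Lam * T%:R|])%:R <= eta * lam ^+ T.
Proof.
move=> e0 eta0.
pose B T := [seq b <- sph T | e * T%:R < `|phi b - Lam * T%:R|].
pose V T := \big[setU/set0]_(b <- B T) U b.
pose M : R := (size (ball R1.+1))%:R.
have M0 : 0 < M + 1 by rewrite ltr_wpDl // /M.
have e1 : 0 < eta * c / (M + 1) by rewrite divr_gt0 // mulr_gt0.
have [||N hN] := outer_lim_sup (V := V) _ phi_ae _ e1.
- by move=> T; exact: bigU_measurable.
- move=> X hX good; have XB : Bd X.
    have [T _ XV] := hX 0%N I; have [b _] := bigU_mem XV; exact: UBd.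
  have [r [Xr hr r0]] := Bd_ray XB.
  have /cvgrPdist_lt/(_ (e / 2) ltac:(lra))[N _ hN] := good XB r Xr.
  have [N' hN'] : exists N' : nat, L0 * R1%:R * 2 / e <= N'%:R.
    by exists (Num.trunc (L0 * R1%:R * 2 / e)).+1; exact/ltW/truncnS_gt.
  have [T TN XV] := hX (N + N').+1 I; rewrite /= in TN.
  have [b] := bigU_mem XV; rewrite mem_filter mem_sph // => /andP[be /eqP lb] XU.
  have := Unear XU Xr r0; rewrite lb => db.
  have T0 : 0 < T%:R :> R by rewrite ltr0n; exact: leq_trans TN.
  have NT : (N <= T)%N by apply: leq_trans (leq_trans (leq_addr N' N) (leqnSn _)) TN.
  have NT' : N'%:R <= T%:R :> R.
    by rewrite ler_nat; apply: leq_trans (leq_trans (leq_addl N N') (leqnSn _)) TN.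
  have h1 : `|Lam * T%:R - phi (r T)| < e / 2 * T%:R.
    have := hN T NT; rewrite /= -(ltr_pM2r T0) -{2}(gtr0_norm T0) -normrM mulrBl.
    by rewrite divfK // gt_eqF.
  have h2 : `|phi (r T) - phi b| <= L0 * R1%:R.
    by apply: le_trans (phiL _ _) _; rewrite ler_wpM2l // ler_nat.
  have h3 : L0 * R1%:R * 2 <= e * T%:R.
    by move: (le_trans hN' NT'); rewrite ler_pdivrMr // mulrC [_ * e]mulrC.
  move: be h1 h2; rewrite ltr_norml ler_norml ltNge => /negP be /andP[h4 h5] /andP[h6 h7].
  by apply: be; rewrite ler_norml; apply/andP; split; lra.
exists N => T NT; have us : uniq (B T) by rewrite filter_uniq // sph_uniq.
have hB b : b \in B T -> len b = T by rewrite mem_filter mem_sph // => /andP[_ /eqP].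
have := sphere_shadow_overlap us hB; rewrite -/(V T) -/M => h1.
have h2 : M * outer nu (V T) <= eta * c.
  apply: (@le_trans _ _ ((M + 1) * (eta * c / (M + 1)))).
    by apply: ler_pM; rewrite ?outer_ge0 ?lerDl ?hN // /M.
  by rewrite mulrCA mulfV ?gt_eqF // mulr1.
have := le_trans h1 h2; rewrite mulrA ler_pdivrMr // mulrAC ler_pM2r //.
Qed.

Lemma ball_upper : exists2 Cb, 0 <= Cb & forall n, (size (ball n))%:R <= Cb * lam ^+ n.
Proof.
have C0 : 0 <= C by have := upper 0; rewrite expr0 mulr1; apply: le_trans.
have l1 : 0 < lam - 1 by rewrite subr_gt0.
exists (C / (lam - 1)); first by rewrite divr_ge0 // ltW.
elim=> [|n IH]; first by rewrite mulr_ge0 ?divr_ge0 // ltW.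
rewrite ballS size_cat natrD; apply: le_trans (lerD IH (upper n)) _.
rewrite exprS [leRHS](_ : _ = C / (lam - 1) * lam ^+ n + C * lam ^+ n) //.
by field; rewrite gt_eqF.
Qed.

(** The counting analogue of [trap_sum]: translation by [inv p] moves the cancelling elements into a
    smaller ball. *)
Lemma trap_count j rho g M : (2 * j <= rho)%N ->
  (size [seq h <- ball M | (len (g ** h) + rho < len g + len h)%N] <= size (ball (M + D - j)))%N.
Proof.
move=> jr; have lg : len (inv g) = len g by exact: wlenV.
have e h : d (inv g) h = len (g ** h) by rewrite /wdist (ginvK grp).
have [jg|gj] := leqP j (len g).
  have [p [lp dp]] := wd_geod grp genS (m := j) (x := one) (y := inv g) ltac:(by rewrite wd1 // lg).
  rewrite !wd1 // in lp dp.
  rewrite -(size_map (mul (inv p))); apply: uniq_leq_size.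
    by rewrite map_inj_uniq ?filter_uniq ?ball_uniq // => a b; exact: (gmulI grp).
  move=> y /mapP[h]; rewrite mem_filter mem_ball // => /andP[ht hM] ->.
  rewrite mem_ball // -/(d p h).
  have [|_ /(_ p lp dp)] := @not_shadow_trap _ _ _ _ _ grp symS genS _ H4 j rho (inv g) h jr.
    by rewrite e lg.
  by rewrite /shadow lp; lia.
rewrite (eq_filter (a2 := pred0)) ?filter_pred0 // => h; apply/negbTE/negP => ht.
have [|] := @not_shadow_trap _ _ _ _ _ grp symS genS _ H4 j rho (inv g) h jr.
  by rewrite e lg.
by rewrite lg; lia.
Qed.

(** * Growth along a direction by repeated attempts *)

Section Stage.
Variables (dir : Type) (ell : dir -> G -> R) (act : dir -> G -> dir) (Fs : seq G) (ce : R).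
Hypothesis ellL : forall u g h, `|ell u g - ell u h| <= L0 * (d g h)%:R.
Hypothesis ellM : forall u g h, ell u (g ** h) = ell u g + ell (act u g) h.
Hypothesis ell1 : forall u, ell u one = 0.
Hypothesis ell_trans : forall u b, exists2 f, f \in Fs & phi b - ce <= ell u (f ** b).

(** The element [f] to be inserted will depend on [b] and on the direction, so cancellation is
    excluded for every [f] in [Fs] at once. This costs a quarter of [lam ^+ m] by the choice of [j],
    and atypical [b] cost another quarter. *)
Lemma stage_count : exists j : nat, forall e, 0 < e -> exists m0, forall m, (m0 <= m)%N -> forall g,
  lam ^+ m / 2 <= (size [seq b <- sph m | (`|phi b - Lam * m%:R| <= e * m%:R) &&
    all (fun f => (len g + len (f ** b) <= len (g ** (f ** b)) + 2 * j)%N) Fs])%:R.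
Proof.
have [Cb Cb0 hCb] := ball_upper; pose CF := \max_(f <- Fs) len f.
have CFP f : f \in Fs -> (len f <= CF)%N by move=> fF; exact: (leq_bigmax_seq (F := fun f => len f)).
pose Q := (size Fs)%:R * (Cb * lam ^+ (CF + 1 + D)).
have Q0 : 0 <= Q by rewrite mulr_ge0 // mulr_ge0 // ltW.
have il : 0 < lam^-1 < 1 by rewrite invr_gt0 lam0 invf_lt1.
have [j hj] : exists j, Q <= lam ^+ j / 4.
  have /andP[i0 i1] := il; have e0 : 0 < (4 * (Q + 1))^-1 by rewrite invr_gt0; lra.
  have [j] := exists_expr_le (ltW i0) i1 e0.
  rewrite exprVn lef_pV2 ?posrE //; last lra.
  by move=> h; exists j; lra.
exists j => e e0; have [T0 hT0] := typical e0 (eta := 4^-1) ltac:(by rewrite invr_gt0).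
exists (T0 + j)%N => m mT g.
have h1 := hT0 m (leq_trans (leq_addr j T0) mT).
pose bad f := [seq b <- sph m | ~~ (len g + len (f ** b) <= len (g ** (f ** b)) + 2 * j)%N].
have hbad f : f \in Fs -> ((size (bad f))%:R : R) <= Cb * lam ^+ (m + CF + 1 + D - j).
  move=> fF; apply: le_trans (hCb _); rewrite ler_nat.
  apply: leq_trans (trap_count g (m + CF + 1) (leqnn (2 * j))).
  rewrite -(size_map (mul f)); apply: uniq_leq_size.
    by rewrite map_inj_uniq ?filter_uniq ?sph_uniq // => x y; exact: (gmulI grp).
  move=> y /mapP[b bb ->]; move: bb.
  rewrite /bad mem_filter mem_sph // -ltnNge => /andP[hb /eqP lb].
  rewrite mem_filter hb mem_ball //.
  move: (wlenM grp genS f b) (CFP f fF); rewrite lb; clear; lia.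
have sbad : \sum_(f <- Fs) ((size (bad f))%:R : R) <= lam ^+ m / 4.
  apply: (@le_trans _ _ (\sum_(f <- Fs) Cb * lam ^+ (m + CF + 1 + D - j))).
    by rewrite big_seq [leRHS]big_seq; apply: ler_sum => f fF; exact: hbad.
  rewrite big_const_seq count_predT iter_addr_0 -[leLHS]mulr_natl.
  have jm : (j <= m)%N by apply: leq_trans (leq_addl T0 j) mT.
  rewrite (_ : m + CF + 1 + D - j = (CF + 1 + D) + (m - j))%N; last by move: jm; clear; lia.
  rewrite [leLHS](_ : _ = Q * lam ^+ (m - j)); last by rewrite /Q exprD !mulrA.
  apply: (@le_trans _ _ (lam ^+ j / 4 * lam ^+ (m - j))).
    by rewrite ler_wpM2r // ltW.
  by rewrite mulrAC -exprD subnKC.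
set good := [seq _ <- _ | _].
have cover : (size (sph m) <= size good + size [seq b <- sph m | (e * m%:R < `|phi b - Lam * m%:R|)%R] +
    \sum_(f <- Fs) size (bad f))%N.
  have -> : (\sum_(f <- Fs) size (bad f) = size (flatten (map bad Fs)))%N.
    by rewrite size_flatten /shape -map_comp sumnE big_map.
  rewrite -!size_cat; apply: uniq_leq_size; first exact: sph_uniq.
  move=> b bS; rewrite !mem_cat !mem_filter bS !andbT leNgt.
  case: ltP => //= _; rewrite orbF; case: allP => //= nall.
  have [f fF hf] : exists2 f, f \in Fs & ~~ (len g + len (f ** b) <= len (g ** (f ** b)) + 2 * j)%N.
    by apply: contrapT => hn; apply: nall => f fF; apply: contraT => c'; case: hn; exists f.
  by apply/flatten_mapP; exists f => //; rewrite mem_filter hf.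
have := lower m; move: cover; rewrite -(ler_nat R) !natrD natr_sum.
move: sbad h1; lra.
Qed.

(** The points [H b] lie beyond [g], with the inserted element adapted to the direction [act u g].
    There are at least [lam ^+ m / 2] of them and their shadows overlap boundedly, so they fill a
    fixed proportion of the shadow of [g], uniformly in [g], [u] and [m]. *)
Lemma stage : exists (c1 : R) (C1 : nat) (C2 : R), [/\ 0 < c1, 0 <= C2 & forall e, 0 < e ->
  exists m0, forall m, (m0 <= m)%N -> forall g u, exists V : set (BdT R mul inv one S),
  [/\ measurable V, V `<=` Bd, c1 / lam ^+ len g <= outer nu V,
    (forall X r, V X -> X r -> r 0%N = one -> (d (r (len g)) g <= C1)%N) &
    (forall X r, V X -> X r -> r 0%N = one ->
      (Lam - e) * m%:R - C2 <= ell u (r (len g + m)%N) - ell u g)]].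
Proof.
have [j hj] := stage_count; pose CF := \max_(f <- Fs) len f.
have CFP f : f \in Fs -> (len f <= CF)%N by move=> fF; exact: (leq_bigmax_seq (F := fun f => len f)).
pose w := (CF + 2 * j)%N; pose M := (size Fs * size (ball (R1 + w).+1))%N.
have M1 : 0 < M.+1%:R :> R by [].
exists (c / (2 * lam ^+ w * M.+1%:R)), (R1 + 2 * j + D)%N, (L0 * (R1 + w)%:R + `|ce|); split.
- by rewrite divr_gt0 // !mulr_gt0.
- by rewrite addr_ge0 // mulr_ge0.
move=> e e0; have [m0 hm0] := hj e e0; exists (m0 + w)%N => m mm g u.
have := hm0 m (leq_trans (leq_addr w m0) mm) g; set good := [seq _ <- _ | _] => hgood.
have [F hF] : exists F : G -> G, forall b, F b \in Fs /\ phi b - ce <= ell (act u g) (F b ** b).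
  have /choice[F hF] : forall b, exists f, f \in Fs /\ phi b - ce <= ell (act u g) (f ** b).
    by move=> b; have [f fF h] := ell_trans (act u g) b; exists f.
  by exists F.
pose H b := g ** (F b ** b).
have goodP b : b \in good -> [/\ len b = m, (Lam - e) * m%:R <= phi b,
    (len g + len (F b ** b) <= len (H b) + 2 * j)%N, (len (H b) <= len g + m + w)%N &
    (len g + m <= len (H b) + w)%N].
  rewrite mem_filter mem_sph // => /andP[/andP[h1 /allP h2] /eqP lb].
  have [fF _] := hF b; have h3 := h2 _ fF; have h4 := CFP _ fF.
  have h5 := wlenM grp genS (F b) b; have h6 := wlenM grp genS g (F b ** b).
  have h7 : (len b <= len (F b) + len (F b ** b))%N.
    have := wlenM grp genS (inv (F b)) (F b ** b).
    by rewrite (gmulK grp) (wlenV grp symS genS).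
  split => //.
  - by move: h1; rewrite ler_norml => /andP[h1 _]; lra.
  - by move: h5 h6; rewrite lb /H /w; move: h4; clear; lia.
  - by move: h3 h7; rewrite lb /H /w; move: h4; clear; lia.
pose V := \big[setU/set0]_(b <- good) U (H b).
have VP X r : V X -> X r -> r 0%N = one -> exists b, [/\ b \in good,
    (d (r (len (H b))) (H b) <= R1)%N & (d (r (len g + m)%N) (H b) <= R1 + w)%N].
  move=> XV Xr r0; have [b bg XU] := bigU_mem XV; exists b.
  have db := Unear XU Xr r0; have hr := bpoint_mem_ray (UBd XU) Xr.
  have [_ _ _ h1 h2] := goodP b bg; split => //.
  exact: (near_level hr db h1 h2).
exists V; split.
- by rewrite /V; elim: (good) => [|b s IH]; rewrite ?big_nil ?big_cons //; exact: measurableU.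
- by move=> X XV; have [b _ /UBd] := bigU_mem XV.
- have ov : \sum_(b <- good) outer nu (U (H b)) <= M.+1%:R * outer nu V.
    pose U' b := if b \in good then U (H b) else set0.
    rewrite big_seq (eq_bigr (fun b => outer nu (U' b))); last by move=> b bg; rewrite /U' bg.
    rewrite -big_seq; apply: outer_overlap.
    + by move=> b; rewrite /U'; case: ifP.
    + by rewrite /V; elim: (good) => [|b s IH]; rewrite ?big_nil ?big_cons //; exact: measurableU.
    + by move=> b; rewrite /U'; case: ifP => [bg|_]; [exact: (@mem_bigU _ _ good (fun b => U (H b)) b bg) | exact: sub0set].
    move=> X; have [XB|XB] := pselect (Bd X); last first.
      rewrite (eq_in_count (a2 := pred0)) ?count_pred0 // => b bg.
      by rewrite /U' bg; apply/negbTE/negP => /set_mem/UBd.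
    have [r [Xr hr r0]] := Bd_ray XB.
    apply: leq_trans (leqnSn _); rewrite -size_filter /M -(size_allpairs pair).
    (* [b] can be recovered from [F b] and the position of [H b] relative to the ray, and both range
       over fixed finite sets. *)
    pose psi b := (F b, inv (r (len g + m)%N) ** H b).
    rewrite -(size_map psi); apply: uniq_leq_size.
      rewrite map_inj_uniq ?filter_uniq ?sph_uniq // => x y [Fxy].
      by move=> /(gmulI grp)/(gmulI grp); rewrite Fxy => /(gmulI grp).
    move=> y /mapP[b]; rewrite mem_filter => /andP[+ bg] ->; rewrite /U' bg => /set_mem XU.
    apply: allpairs_f; first by have [] := hF b.
    rewrite mem_ball // ltnS -/(d (r (len g + m)%N) (H b)).
    have db := Unear XU Xr r0; have [_ _ _ h1 h2] := goodP b bg.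
    exact: (near_level hr db h1 h2).
  have lowsum : lam ^+ m / 2 * (c / lam ^+ (len g + m + w)) <= \sum_(b <- good) outer nu (U (H b)).
    apply: (@le_trans _ _ (\sum_(b <- good) c / lam ^+ (len g + m + w))).
      rewrite big_const_seq count_predT iter_addr_0 -[leRHS]mulr_natl ler_wpM2r //.
      by rewrite divr_ge0 // ltW.
    rewrite big_seq [leRHS]big_seq; apply: ler_sum => b bg; apply: le_trans (Ulow _).
    rewrite ler_wpM2l ?(ltW c0) // lef_pV2 ?posrE // ler_weXn2l ?(ltW lam1) //.
    by have [] := goodP b bg.
  have := le_trans lowsum ov; rewrite -ler_pdivrMl // => h.
  apply: le_trans h; rewrite [lam ^+ (len g + m + w)]exprD [lam ^+ (len g + m)]exprD.
  have aux (x y z k : R) : 0 < x -> 0 < y -> 0 < z -> 0 < k ->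
      c / (2 * z * k) / x = k^-1 * (y / 2 * (c / (x * y * z))).
    by move=> *; field; rewrite !gt_eqF.
  by rewrite (aux _ (lam ^+ m) _ _ (lamn _) (lamn _) (lamn _) M1).
- move=> X r XV Xr r0; have [b [bg db1 db2]] := VP X r XV Xr r0.
  have hr : is_ray mul inv one S r by have [b' _ /UBd XB] := bigU_mem XV; exact: bpoint_mem_ray XB Xr.
  have [lb _ h1 h2 h3] := goodP b bg.
  have s1 : shad (2 * j) g (H b) by rewrite /shadow /H wdMr.
  have le : (len g <= len (H b))%N.
    by move: (leq_trans (leq_addl m0 w) mm) h3; clear; lia.
  have s2 : shad R1 (r (len g)) (H b).
    rewrite /shadow (ray_len grp _ hr r0) //.
    by have := tri (r (len (H b))) (r (len g)) (H b); rewrite hr //; move: db1 le; clear; lia.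
  by have := shadow_near grp symS genS H4 s2 s1; rewrite (ray_len grp _ hr r0) //; clear; lia.
- move=> X r XV Xr r0; have [b [bg db1 db2]] := VP X r XV Xr r0.
  have [_ h1 _ _ _] := goodP b bg; have [_ h2] := hF b.
  have h3 : ell u (H b) = ell u g + ell (act u g) (F b ** b) by exact: ellM.
  rewrite dC in db2; have h4 := lipschitz_le (ellL u) db2.
  have := ler_norm ce; lra.
Qed.

(** The slack [t] absorbs the passage to a nearby ray. Index 0 is left out: at time [a 0 = 0] the
    inequality would be false for [t = 0]. *)
Definition fails e (a : nat -> nat) (i : nat) (u : dir) (t : R) (r : nat -> G) : Prop :=
  forall j, (0 < j <= i)%N -> ell u (r (a j)) < (Lam - e) * (a j)%:R + t.

Definition fail_set e a i u t : set (BdT R mul inv one S) :=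
  [set X | Bd X /\ exists r, [/\ X r, r 0%N = one & fails e a i u t r]].

(* Conditionally on having failed up to time [a i], the next block succeeds with probability at least [c2];
   the fixed loss [C3] in the threshold comes from replacing the ray by a nearby one. *)
Lemma exists_retry_times e : 0 < e -> exists (c2 C3 : R), [/\ 0 < c2, 0 <= C3 & forall T, 0 <= T ->
  exists a : nat -> nat, [/\ a 0%N = 0%N, (forall i, (a i < a i.+1)%N) &
  forall i u t, t <= T -> outer nu (fail_set e a i.+1 u t) + c2 * outer nu (fail_set e a i u t) <=
    outer nu (fail_set e a i u (t + C3))]].
Proof.
move=> e0; have [c1 [C1 [C2 [c10 C20 hst]]]] := stage.
pose M : R := (size (ball C1.+1)).+1%:R; have M0 : 0 < M by rewrite /M.
have [m0 hm0] := hst (e / 2) ltac:(lra).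
exists (c1 / (M * C')), (L0 * (C1 + D)%:R); split; first by rewrite divr_gt0 // mulr_gt0.
  by rewrite mulr_ge0.
move=> T T0.
(* So long a block that [e / 2] times its length outweighs [C2], the slack [T] and whatever was lost
   up to time [x]. *)
pose step x := (m0 + Num.trunc ((C2 + (L0 + `|Lam|) * x%:R + T) * 2 / e) + 1)%N.
pose a i := iter i (fun x => (x + step x)%N) 0%N.
have aS i : a i.+1 = (a i + step (a i))%N by [].
have amono i j : (i <= j)%N -> (a i <= a j)%N.
  move=> /subnK <-; elim: (j - i)%N => [//|k IH]; rewrite addSn aS.
  exact: leq_trans IH (leq_addr _ _).
exists a; split => // [i|i u t tT]; first by rewrite aS /step addn1 addnS ltnS leq_addr.
set n := a i; set m := step n.
have mm0 : (m0 <= m)%N by rewrite /m /step -addnA leq_addr.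
have hm : C2 + (L0 + `|Lam|) * n%:R + T <= e / 2 * m%:R.
  have h := truncnS_gt ((C2 + (L0 + `|Lam|) * n%:R + T) * 2 / e).
  have h' : (Num.trunc ((C2 + (L0 + `|Lam|) * n%:R + T) * 2 / e)).+1%:R <= m%:R :> R.
    by rewrite ler_nat /m /step -addnA addn1 leq_addl.
  have h2 := lt_le_trans h h'; rewrite ltr_pdivrMr // in h2; lra.
have /choice[V hV] := fun g => hm0 m mm0 g u.
(* The positions at time [n] of rays that have failed so far: conditioning on the past becomes a sum
   over these elements. *)
pose P := [seq g <- sph n | `[< exists X r, [/\ Bd X, X r, r 0%N = one, r n = g & fails e a i u t r] >]].
have PP g : g \in P -> len g = n /\ exists X r, [/\ Bd X, X r, r 0%N = one, r n = g & fails e a i u t r].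
  by rewrite mem_filter mem_sph // => /andP[/asboolP h /eqP ->].
have uP : uniq P by rewrite filter_uniq // sph_uniq.
have rayP X r : Bd X -> X r -> is_ray mul inv one S r by exact: bpoint_mem_ray.
have EU : fail_set e a i u t `<=` \big[setU/set0]_(g <- P) U g.
  move=> X [XB [r [Xr r0 rf]]].
  have rP : r n \in P.
    rewrite mem_filter mem_sph // (ray_len grp _ (rayP X r XB Xr) r0) eqxx andbT.
    by apply/asboolP; exists X, r.
  by apply: (mem_bigU (V := U) rP); exact: Umem.
pose W := \big[setU/set0]_(g <- P) V g.
pose V' g := if g \in P then V g else set0.
have mW : measurable W.
  by rewrite /W; elim: (P) => [|g s IH]; rewrite ?big_nil ?big_cons //;
     apply: measurableU => //; have [] := hV g.
have h1 : (size P)%:R * (c1 / lam ^+ n) <= M * outer nu W.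
  apply: (@le_trans _ _ (\sum_(g <- P) outer nu (V' g))).
    rewrite mulr_natl -iter_addr_0 -(count_predT P) -big_const_seq.
    rewrite big_seq [leRHS]big_seq; apply: ler_sum => g gP.
    by rewrite /V' gP -(proj1 (PP g gP)); have [] := hV g.
  apply: outer_overlap => //.
  - by move=> g; rewrite /V'; case: ifP => // _; have [] := hV g.
  - by move=> g; rewrite /V'; case: ifP => [gP|_]; [exact: (mem_bigU (V := V) gP) | exact: sub0set].
  move=> X; apply: leq_trans (leqnSn _).
  have [XB|XB] := pselect (Bd X); last first.
    rewrite (eq_in_count (a2 := pred0)) ?count_pred0 // => g gP.
    by rewrite /V' gP; apply/negbTE/negP => /set_mem; have [_ VB _ _ _] := hV g; move=> /VB.
  have [r [Xr hr r0]] := Bd_ray XB.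
  apply: leq_trans (count_near grp genS (r n) C1 uP).
  rewrite -size_filter; apply: uniq_leq_size; first by rewrite filter_uniq.
  move=> g; rewrite mem_filter => /andP[gV gP]; rewrite mem_filter gP andbT.
  move: gV; rewrite /V' gP => /set_mem XV.
  have [lg _] := PP g gP; have [_ _ _ /(_ X r XV Xr r0) + _] := hV g.
  by rewrite lg.
have h2 : outer nu (fail_set e a i u t) <= (size P)%:R * (C' / lam ^+ n).
  apply: le_trans (outer_mono nu EU) _; apply: le_trans (outer_sum nu _ _) _.
  rewrite [leRHS]mulr_natl -iter_addr_0 -(count_predT P) -big_const_seq.
  rewrite big_seq [leRHS]big_seq; apply: ler_sum => g gP.
  by rewrite -(proj1 (PP g gP)); exact: Uup.
(* Both sides are compared with [size P / lam ^+ n]: the failures are covered by the shadows of [P],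
   and [W] fills a proportion of each. *)
have h3 : c1 / (M * C') * outer nu (fail_set e a i u t) <= outer nu W.
  have k0 : 0 < c1 / (M * C') by rewrite divr_gt0 // mulr_gt0.
  apply: (@le_trans _ _ (c1 / (M * C') * ((size P)%:R * (C' / lam ^+ n)))).
    by rewrite ler_pM2l.
  rewrite [leLHS](_ : _ = M^-1 * ((size P)%:R * (c1 / lam ^+ n))); first by rewrite ler_pdivrMl.
  by move: (lam ^+ n) (lamn n) => x x0; field; rewrite !gt_eqF.
rewrite addrC; apply: le_trans (lerD h3 (lexx _)) _.
have VX X r : W X -> X r -> r 0%N = one -> exists g, [/\ g \in P, V g X & Bd X].
  move=> XW Xr r0; have [g gP gX] := bigU_mem XW; exists g; split => //.
  by have [_ VB _ _ _] := hV g; exact: VB.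
apply: outer_disjoint => //.
- rewrite -subset0 => X [XW [XB [r [Xr r0 rf]]]].
  have [g [gP gX _]] := VX X r XW Xr r0; have [lg _] := PP g gP.
  have [_ _ _ _ /(_ X r gX Xr r0)] := hV g; rewrite lg => h4.
  have := rf i.+1 ltac:(by rewrite ltnSn); rewrite aS -/n -/m => h5.
  have h6 : - (L0 * n%:R) <= ell u g.
    have := ellL u g one; rewrite ell1 subr0 ler_norml [d g one]dC wd1 // lg.
    by move=> /andP[].
  have h7 := ler_norm Lam; have n0 : 0 <= n%:R :> R by [].
  have h8 : Lam * n%:R <= `|Lam| * n%:R by rewrite ler_wpM2r.
  have h9 : 0 <= e * n%:R by rewrite mulr_ge0 // ltW.
  move: h5 hm h4; rewrite natrD mulrDr mulrBl mulrBl mulrBl mulrDl; lra.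
(* A ray to [X] comes within [C1] of a point [g] reached by some failing ray; by [ray_fellow] it was
   [C1 + D] close to that ray before, so it failed too, with slack larger by [L0 * (C1 + D)]. *)
- move=> X XW; have XB : Bd X.
    by have [g gP gX] := bigU_mem XW; have [_ VB _ _ _] := hV g; exact: VB.
  split => //; have [r [Xr hr r0]] := Bd_ray XB; exists r; split => // j /andP[j0 ji].
  have [g [gP gX _]] := VX X r XW Xr r0; have [lg [X' [r' [XB' Xr' r0' rg rf]]]] := PP g gP.
  have [_ _ _ /(_ X r gX Xr r0) + _] := hV g; rewrite lg -rg => dn.
  have := ray_fellow grp symS genS H4 hr r0 (rayP X' r' XB' Xr') r0' (amono j i ji) dn.
  move=> /(lipschitz_le (ellL u)) h4; have := rf j ltac:(by rewrite j0).
  lra.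
- move=> X [XB [r [Xr r0 rf]]]; split => //; exists r; split => // j /andP[j0 ji].
  have := rf j ltac:(by rewrite j0 (leq_trans ji)).
  have : 0 <= L0 * (C1 + D)%:R by rewrite mulr_ge0.
  lra.
Qed.

(** The slack changes by [C3] at each attempt, so the failure probabilities are not simply
    geometric. But if the last one exceeds [eta], so do all earlier ones; each attempt then removes
    at least [c2 * eta], and [K] attempts exhaust the total mass. *)
Lemma retry e eta t0 : 0 < e -> 0 < eta -> 0 <= t0 ->
  exists (K : nat) (a : nat -> nat), [/\ (0 < K)%N, a 0%N = 0%N, (forall i, (a i < a i.+1)%N) &
    forall u, outer nu (fail_set e a K u t0) <= eta].
Proof.
move=> e0 eta0 t00; have [c2 [C3 [c20 C30 h]]] := exists_retry_times e0.
have [K hK] : exists K : nat, (c2 * eta)^-1 <= K%:R.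
  by exists (Num.trunc (c2 * eta)^-1).+1; exact/ltW/truncnS_gt.
have ce0 : 0 < c2 * eta by rewrite mulr_gt0.
have K0 : (0 < K)%N.
  by rewrite -(ltr_nat R); apply: lt_le_trans hK; rewrite invr_gt0.
have [a [a0 aS ha]] := h (t0 + K%:R * C3) ltac:(by rewrite addr_ge0 // mulr_ge0).
exists K, a; split => // u; rewrite leNgt; apply/negP => lt.
have big i t : (i <= K)%N -> t0 <= t -> eta <= outer nu (fail_set e a i u t).
  move=> iK tt; apply: le_trans (ltW lt) _; apply: outer_mono => X [XB [r [Xr r0 rf]]].
  split => //; exists r; split => // j /andP[j0 ji].
  by have := rf j ltac:(by rewrite j0 (leq_trans ji)); lra.
have dec i : (i <= K)%N -> outer nu (fail_set e a i u (t0 + (K - i)%:R * C3)) <= 1 - i%:R * (c2 * eta).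
  elim: i => [|i IH] iK; first by rewrite mul0r subr0 outer_le1.
  have iK' := ltnW iK; have := IH iK'.
  have -> : (K - i)%:R = (K - i.+1)%:R + 1 :> R by rewrite natr1 subnSK.
  rewrite mulrDl mul1r addrA.
  have tle : t0 + (K - i.+1)%:R * C3 <= t0 + K%:R * C3.
    by rewrite lerD2l ler_wpM2r // ler_nat leq_subr.
  have tge : t0 <= t0 + (K - i.+1)%:R * C3 by rewrite lerDl mulr_ge0.
  have h1 := ha i u _ tle; have h2 := big i _ iK' tge.
  have h3 : c2 * eta <= c2 * outer nu (fail_set e a i u (t0 + (K - i.+1)%:R * C3)).
    by rewrite ler_pM2l.
  rewrite -natr1 mulrDl mul1r; lra.
have := dec K (leqnn K); rewrite subnn mul0r addr0 => h1.
have h2 : 1 <= K%:R * (c2 * eta) by rewrite -ler_pdivrMr // mul1r.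
lra.
Qed.

Definition geodesic_to (b : G) (p : nat -> G) : Prop :=
  [/\ p 0%N = one, p (len b) = b & forall i j, (i <= j <= len b)%N -> d (p i) (p j) = (j - i)%N].

(** Some failing geodesic is enough, because [b] does not determine the geodesic by which a ray
    crosses the block. *)
Definition bad_blocks e (a : nat -> nat) K u : seq G :=
  [seq b <- sph (a K) | `[< exists p, geodesic_to b p /\ fails e a K u 0 p >]].

(** A ray to a point of [U b] stays within [R1 + D] of the failing geodesic to [b], hence fails
    itself with slack [L0 * (R1 + D)]; [retry] makes this unlikely, and bounded overlap gives the
    count. *)
Lemma few_bad_blocks e eta : 0 < e -> 0 < eta ->
  exists (K : nat) (a : nat -> nat), [/\ (0 < K)%N, a 0%N = 0%N, (forall i, (a i < a i.+1)%N) &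
    forall u, (size (bad_blocks e a K u))%:R <= eta * lam ^+ a K].
Proof.
move=> e0 eta0; pose M : R := (size (ball R1.+1)).+1%:R; have M0 : 0 < M by rewrite /M.
have [K [a [K0 a0 aS h]]] := @retry e (eta * c / M) (L0 * (R1 + D)%:R) e0
  ltac:(by rewrite divr_gt0 // mulr_gt0) ltac:(by rewrite mulr_ge0).
exists K, a; split => // u.
have us : uniq (bad_blocks e a K u) by rewrite filter_uniq // sph_uniq.
have lb b : b \in bad_blocks e a K u -> len b = a K.
  by rewrite mem_filter mem_sph // => /andP[_ /eqP].
have h1 := sphere_shadow_overlap us lb.
have amono i j : (i <= j)%N -> (a i <= a j)%N.
  move=> /subnK <-; elim: (j - i)%N => [//|k IH]; rewrite addSn.
  exact: leq_trans IH (ltnW (aS _)).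
have sub : \big[setU/set0]_(b <- bad_blocks e a K u) U b `<=` fail_set e a K u (L0 * (R1 + D)%:R).
  move=> X XW; have [b bb XU] := bigU_mem XW; have XB := UBd XU; split => //.
  have [r [Xr hr r0]] := Bd_ray XB; exists r; split => // j jK.
  have lbK := lb b bb; move: bb; rewrite mem_filter => /andP[/asboolP[p [[p0 pb pg] pf]] _].
  have db := Unear XU Xr r0; rewrite lbK in pb pg db.
  have ajK : (a j <= a K)%N by apply: amono; case/andP: jK.
  have lp := pg 0%N (a j) ajK; rewrite p0 (wd1 S grp) subn0 in lp.
  have s1 : shad 0 (p (a j)) b.
    by rewrite /shadow lp lbK addn0; have := pg (a j) (a K); rewrite pb => ->; rewrite ?ajK ?leqnn // subnKC.
  have s2 : shad R1 (r (a j)) b.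
    rewrite /shadow (ray_len grp _ hr r0) lbK.
    by have := tri (r (a K)) (r (a j)) b; rewrite hr //; move: db ajK; clear; lia.
  have := shadow_near grp symS genS H4 s2 s1; rewrite lp (ray_len grp _ hr r0) => dd.
  have dd' : (d (r (a j)) (p (a j)) <= R1 + D)%N by move: dd; clear; lia.
  have := lipschitz_le (ellL u) dd'; have := pf j jK; lra.
have h2 := outer_mono nu sub; have h3 := h u.
have MR : (size (ball R1.+1))%:R <= M by rewrite /M ler_nat.
have h4 : (size (ball R1.+1))%:R * outer nu (\big[setU/set0]_(b <- bad_blocks e a K u) U b) <= eta * c.
  apply: (@le_trans _ _ (M * (eta * c / M))).
    by apply: ler_pM; rewrite ?outer_ge0 // (le_trans h2 h3).
  by rewrite mulrCA mulfV ?gt_eqF // mulr1.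
by have := le_trans h1 h4; rewrite mulrA ler_pdivrMr // mulrAC ler_pM2r.
Qed.

(** * Counting products with many bad blocks *)

Section Blocks.
Variables (T s : nat) (Bad : G -> seq G).

(* Products of an element of length [s] and of [q] blocks of length [T], with at least [j] of the blocks bad for the element they are appended to. *)
Fixpoint visited (q j : nat) : seq G :=
  match q, j with
  | 0, 0 => sph s
  | 0, _.+1 => [::]
  | q.+1, 0 => [seq h ** b | h <- visited q 0, b <- sph T]
  | q.+1, j'.+1 => [seq h ** b | h <- visited q j', b <- Bad h] ++
                   [seq h ** b | h <- visited q j, b <- sph T]
  end.

Lemma size_allpairs_dep_le (s1 : seq G) (t : G -> seq G) (B : R) :
  (forall h, (size (t h))%:R <= B) ->
  (size [seq h ** b | h <- s1, b <- t h])%:R <= (size s1)%:R * B.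
Proof.
move=> hB; elim: s1 => [|h s1 IH] /=; first by rewrite mul0r.
by rewrite size_cat size_map natrD -natr1 mulrDl mul1r addrC lerD.
Qed.

Variables (kappa : R).
Hypothesis kappa0 : 0 <= kappa.
Hypothesis hBad : forall h, (size (Bad h))%:R <= kappa * C * lam ^+ T.

Let C0 : 0 <= C.
Proof. by have := upper 0; rewrite expr0 mulr1; apply: le_trans. Qed.

(** The factor 2 per block pays for the choice of the blocks counted as bad; each of those gains a
    factor [kappa]. *)
Lemma size_visited q j :
  (size (visited q j))%:R <= C * lam ^+ s * (2 * C * lam ^+ T) ^+ q * kappa ^+ j.
Proof.
have l0 := ltW lam0; have CT : 0 <= C * lam ^+ T by rewrite mulr_ge0 ?exprn_ge0.
have CT2 : 0 <= 2 * C * lam ^+ T by rewrite -mulrA mulr_ge0.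
have X0 n : 0 <= C * lam ^+ s * (2 * C * lam ^+ T) ^+ n.
  by rewrite mulr_ge0 ?exprn_ge0 // mulr_ge0 ?exprn_ge0.
elim: q j => [|q IH] [|j] /=.
- by rewrite !mulr1.
- by rewrite mulr_ge0 ?exprn_ge0.
- apply: le_trans (size_allpairs_dep_le _ (fun=> upper T)) _.
  apply: le_trans (ler_wpM2r CT (IH 0%N)) _; rewrite !expr0 !mulr1 exprSr mulrA.
  by apply: ler_wpM2l => //; rewrite -mulrA ler_peMl // ler1n.
rewrite size_cat natrD.
have h1 := le_trans (size_allpairs_dep_le (visited q j) hBad)
  (ler_wpM2r _ (IH j)).
have h2 := le_trans (size_allpairs_dep_le (visited q j.+1) (fun=> upper T)) (ler_wpM2r CT (IH j.+1)).
apply: le_trans (lerD (h1 _) h2) _; first by rewrite -mulrA mulr_ge0.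
rewrite !exprSr; move: (lam ^+ T) (kappa ^+ j) ((2 * C * lam ^+ T) ^+ q) (C * lam ^+ s) => w z y x.
by rewrite [leRHS](_ : _ = x * y * z * (kappa * C * w) + x * y * (z * kappa) * (C * w)) //; ring.
Qed.

Definition block (r : nat -> G) i : G := inv (r (s + i * T)%N) ** r (s + i.+1 * T)%N.
Definition bad_count r q : nat := \sum_(i < q) (block r i \in Bad (r (s + i * T)%N)).

Lemma block_len r i : is_ray mul inv one S r -> len (block r i) = T.
Proof.
move=> hr; rewrite /block -/(d (r (s + i * T)%N) (r (s + i.+1 * T)%N)) hr; last by rewrite mulSn; lia.
by rewrite mulSn; lia.
Qed.

Lemma mem_visited r q j : is_ray mul inv one S r -> r 0%N = one ->
  (j <= bad_count r q)%N -> r (s + q * T)%N \in visited q j.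
Proof.
move=> hr r0; elim: q j => [|q IH] j.
  rewrite /bad_count big_ord0 leqn0 => /eqP -> /=.
  by rewrite mul0n addn0 mem_sph // (ray_len grp _ hr r0).
rewrite /bad_count big_ord_recr /= -/(bad_count r q) => jq.
have e : r (s + q.+1 * T)%N = r (s + q * T)%N ** block r q by rewrite /block (gmulKV grp).
have bS : block r q \in sph T by rewrite mem_sph // block_len.
case: j jq => [|j] jq.
  by rewrite e; apply: allpairs_f => //; apply: IH.
rewrite mem_cat; case: (boolP (block r q \in Bad (r (s + q * T)%N))) jq => [bb|nb] jq.
  apply/orP; left; rewrite e; apply/allpairsPdep.
  by exists (r (s + q * T)%N), (block r q); split => //; apply: IH; move: jq; rewrite addn1.
by apply/orP; right; rewrite e; apply: allpairs_f => //; apply: IH; move: jq; rewrite addn0.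
Qed.

Lemma outer_bad_count q j :
  outer nu [set X | Bd X /\ exists r, [/\ X r, r 0%N = one & (j <= bad_count r q)%N]] <=
  C' * C * (2 * C) ^+ q * kappa ^+ j.
Proof.
pose P := [seq h <- visited q j | len h == (s + q * T)%N].
have sub : [set X | Bd X /\ exists r, [/\ X r, r 0%N = one & (j <= bad_count r q)%N]] `<=`
    \big[setU/set0]_(h <- P) U h.
  move=> X [XB [r [Xr r0 rj]]]; have hr := bpoint_mem_ray XB Xr.
  have rP : r (s + q * T)%N \in P.
    by rewrite mem_filter mem_visited // (ray_len grp _ hr r0) eqxx.
  by apply: (mem_bigU (V := U) rP); exact: Umem.
apply: le_trans (outer_mono nu sub) _; apply: le_trans (outer_sum nu _ _) _.
apply: (@le_trans _ _ ((size P)%:R * (C' / lam ^+ (s + q * T)))).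
  rewrite [leRHS]mulr_natl -iter_addr_0 -(count_predT P) -big_const_seq.
  rewrite big_seq [leRHS]big_seq; apply: ler_sum => h.
  by rewrite mem_filter => /andP[/eqP <- _]; exact: Uup.
have c' : 0 <= C' / lam ^+ (s + q * T) by rewrite divr_ge0 // ltW.
apply: (@le_trans _ _ (C * lam ^+ s * (2 * C * lam ^+ T) ^+ q * kappa ^+ j * (C' / lam ^+ (s + q * T)))).
  rewrite ler_wpM2r //; apply: le_trans (size_visited q j); rewrite ler_nat.
  by rewrite size_filter count_size.
rewrite exprD mulnC exprM exprMn.
have x0 := lamn s; have y0 : 0 < (lam ^+ T) ^+ q by rewrite exprn_gt0.
move: (lam ^+ s) ((lam ^+ T) ^+ q) ((2 * C) ^+ q) (kappa ^+ j) x0 y0 => x y z k x0 y0.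
rewrite [leLHS](_ : _ = C' * C * z * k) //; by field; rewrite !gt_eqF.
Qed.

End Blocks.

(** * Exponential tails of the deviations *)

Lemma C_ge1 : 1 <= C.
Proof. by have := le_trans (lower 0) (upper 0); rewrite expr0 mulr1. Qed.

(** More than [q / k] bad blocks gain at least [(4 * C) ^- q], against the [(2 * C) ^+ q] of
    [outer_bad_count]. *)
Lemma block_tail k T s Bad q : (0 < k)%N ->
  (forall h, (size (Bad h))%:R <= (4 * C) ^- k * C * lam ^+ T) ->
  outer nu [set X | Bd X /\ exists r, [/\ X r, r 0%N = one & (q < bad_count T s Bad r q * k)%N]] <=
  C' * C * 2 ^- q.
Proof.
move=> k0 hBad; have C1 := C_ge1; have C0 : 0 < C by apply: lt_le_trans C1.
have kp : 0 <= (4 * C) ^- k by rewrite invr_ge0 exprn_ge0 // mulr_ge0 // ltW.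
apply: le_trans (outer_mono nu _) (le_trans (outer_bad_count s kp hBad q (q %/ k).+1) _).
  by move=> X [XB [r [Xr r0 rq]]]; split => //; exists r; split => //; rewrite ltn_divLR.
rewrite -mulrA; apply: ler_wpM2l; first by rewrite mulr_ge0 // ltW.
have h4 : 1 <= 4 * C by lra.
have -> : ((4 * C) ^- k) ^+ (q %/ k).+1 = (4 * C)^-1 ^+ (k * (q %/ k).+1).
  by rewrite exprM [(4 * C)^-1 ^+ k]exprVn.
rewrite -(exprVn 2).
have -> : 2^-1 ^+ q = (2 * C) ^+ q * (4 * C)^-1 ^+ q :> R.
  by rewrite -exprMn; congr (_ ^+ _); field; rewrite gt_eqF.
apply: ler_wpM2l; first by rewrite exprn_ge0 // mulr_ge0 // ltW.
apply: ler_wiXn2l.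
- by rewrite invr_ge0 mulr_ge0 // ltW.
- by rewrite invf_le1 // (lt_le_trans ltr01).
- by rewrite mulnC ltnW // ltn_ceil.
Qed.

Hypothesis Lam0 : 0 <= Lam.
Hypothesis phiM : forall g h, phi (g ** h) <= phi g + phi h.
Hypothesis ell_le : forall u g, ell u g <= phi g.

(** One [e] goes to the typical blocks, one to the term [p1] and the incomplete last block. The
    third is left to the atypical blocks; each costs at most [(p1 + L0) * T], so more than a
    fraction [1 / k.+1] of the blocks must be atypical. *)
Lemma upper_tail e : 0 < e -> exists T N0 : nat, (0 < T)%N /\ forall N, (N0 <= N)%N ->
  outer nu [set X | Bd X /\ exists r, [/\ X r, r 0%N = one &
    (Lam + 3 * e) * N%:R < phi (r N)]] <= C' * C * 2 ^- (N %/ T).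
Proof.
move=> e0; pose p1 := `|phi one|; have p10 : 0 <= p1 by exact: normr_ge0.
have [k hk] : exists k : nat, (p1 + L0) / e <= k.+1%:R.
  by exists (Num.trunc ((p1 + L0) / e)); exact/ltW/truncnS_gt.
rewrite ler_pdivrMr // in hk.
have C1 := C_ge1; have C0 : 0 < C by apply: lt_le_trans C1.
have [|T0 hT0] := typical e0 (eta := (4 * C) ^- k.+1 * C).
  by rewrite mulr_gt0 // invr_gt0 exprn_gt0 // mulr_gt0.
pose T := T0.+1; have T1 : 1 <= T%:R :> R by rewrite ler1n.
have [N0 hN0] : exists N0 : nat, (p1 + L0 * T%:R) / e <= N0%:R.
  by exists (Num.trunc ((p1 + L0 * T%:R) / e)).+1; exact/ltW/truncnS_gt.
rewrite ler_pdivrMr // in hN0.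
exists T, N0; split => // N N0N.
pose Bad (_ : G) := [seq b <- sph T | e * T%:R < `|phi b - Lam * T%:R|].
have hBad h : (size (Bad h))%:R <= (4 * C) ^- k.+1 * C * lam ^+ T by exact: hT0 (leqnSn T0).
apply: le_trans (outer_mono nu _) (block_tail 0 (N %/ T) _ hBad) => //.
move=> X [XB [r [Xr r0 rN]]]; split => //; exists r; split => //.
have hr := bpoint_mem_ray XB Xr; set q := (N %/ T)%N.
have bound i : phi (r (i * T)%N) <= p1 + i%:R * ((Lam + e) * T%:R) +
    (bad_count T 0 Bad r i)%:R * (p1 + L0 * T%:R).
  elim: i => [|i IH].
    by rewrite mul0n r0 /bad_count big_ord0 !mul0r !addr0 ler_norm.
  have -> : r (i.+1 * T)%N = r (i * T)%N ** block T 0 r i by rewrite /block !add0n (gmulKV grp).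
  apply: le_trans (phiM _ _) _; rewrite /bad_count big_ord_recr /= -/(bad_count T 0 Bad r i).
  have pos : 0 <= (Lam + e) * T%:R by rewrite mulr_ge0 // addr_ge0 // ltW.
  have pos2 : 0 <= p1 + L0 * T%:R by rewrite addr_ge0 // mulr_ge0.
  have lb : len (block T 0 r i) = T by exact: block_len.
  have step : phi (block T 0 r i) <= (Lam + e) * T%:R +
      (block T 0 r i \in Bad (r (0 + i * T)%N))%:R * (p1 + L0 * T%:R).
    case: (boolP (_ \in _)) => [_|].
      have := lipschitz_le phiL (g := block T 0 r i) (h := one) (k := T).
      rewrite [d _ one]dC (wd1 S grp) lb => /(_ (leqnn _)).
      by have := ler_norm (phi one); rewrite -/p1 /= mul1r; lra.
    rewrite mem_filter mem_sph // lb eqxx andbT -leNgt ler_norml /= => /andP[_ h].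
    by rewrite mul0r; lra.
  rewrite natrD -natr1 !mulrDl mul1r; move: IH step; lra.
have qT : (q * T <= N)%N by exact: leq_trunc_div.
have NqT : (N - q * T <= T)%N by rewrite /q {1}(divn_eq N T) addKn ltnW // ltn_mod.
have h1 := bound q.
have h2 : phi (r N) <= phi (r (q * T)%N) + L0 * T%:R.
  by apply: (lipschitz_le phiL); rewrite dC hr.
have h3 : q%:R * T%:R <= N%:R :> R by rewrite -natrM ler_nat.
have h4 : q%:R * ((Lam + e) * T%:R) <= (Lam + e) * N%:R.
  by rewrite mulrCA ler_wpM2l // addr_ge0 // ltW.
have h5 : p1 + L0 * T%:R <= e * N%:R.
  by apply: le_trans hN0 _; rewrite [e * _]mulrC ler_pM2r // ler_nat.
set b := bad_count T 0 Bad r q in h1 *.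
have h6 : e * N%:R < b%:R * (p1 + L0 * T%:R) by move: rN; lra.
have h7 : b%:R * (p1 + L0 * T%:R) <= b%:R * ((p1 + L0) * T%:R).
  by rewrite ler_wpM2l // mulrDl lerD2r ler_peMr.
have h8 : e * (q%:R * T%:R) <= e * N%:R by rewrite ler_pM2l.
have Tp : 0 < T%:R :> R by [].
have h9 : e * q%:R < b%:R * (p1 + L0).
  by rewrite -(ltr_pM2r Tp) -!mulrA; lra.
have h10 : b%:R * (p1 + L0) <= b%:R * (k.+1%:R * e) by rewrite ler_wpM2l.
rewrite -(ltr_nat R) natrM -(ltr_pM2l e0); lra.
Qed.

Lemma sum_residues (f : nat -> nat) T q :
  (\sum_(s < T) \sum_(i < q) f (s + i * T) = \sum_(k < q * T) f k)%N.
Proof.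
rewrite exchange_big /=; elim: q => [|q IH]; first by rewrite !big_ord0.
rewrite big_ord_recr /= IH mulSnr -(big_mkord xpredT f) -(big_mkord xpredT (fun k => f k)).
rewrite [RHS](big_cat_nat _ (n := q * T)) ?leq_addr //=.
congr (_ + _)%N.
by have := @big_addn nat 0%N addn 0 (q * T + T) (q * T) xpredT f; rewrite add0n addKn big_mkord => ->.
Qed.

(* Katznelson-Weiss: follow the good jumps, and move by one step at bad times. *)
Lemma greedy_lower (y : nat -> R) (bad : pred nat) (T : nat) (v : R) :
  (forall k m, y k - L0 * m%:R <= y (k + m)%N) ->
  (forall k, ~~ bad k -> exists m, [/\ (0 < m)%N, (m <= T)%N & y k + v * m%:R <= y (k + m)%N]) ->
  forall N, y 0%N + v * N%:R - (L0 + `|v|) * ((\sum_(k < N) bad k)%:R + T%:R) <= y N.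
Proof.
move=> yL good N; set A := L0 + `|v|; have A0 : 0 <= A by rewrite addr_ge0.
suff H k : (k <= N)%N ->
    y k + v * (N - k)%:R - A * ((\sum_(k <= i < N) bad i)%:R + T%:R) <= y N.
  by have := H 0%N (leq0n _); rewrite subn0 big_mkord.
have [n] := ubnP (N - k); elim: n => // n IH in k *; rewrite ltnS => Nk kN.
have [->|kneq] := eqVneq k N.
  by rewrite subnn big_geq // mulr0 addr0 add0r gerBl mulr_ge0.
have ltk : (k < N)%N by rewrite ltn_neqAle kneq.
case: (boolP (bad k)) => [bk|/good[m [m0 mT hm]]].
  have := IH k.+1 ltac:(by move: Nk ltk; clear; lia) ltk.
  have h1 := yL k 1%N; rewrite addn1 mulr1 in h1.
  rewrite [in X in _ -> X](big_ltn ltk) bk natrD [true%:R]/=.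
  have -> : (N - k)%:R = (N - k.+1)%:R + 1 :> R by rewrite natr1 subnSK.
  have := ler_norm v; rewrite /A; move: (\sum_(k.+1 <= i < N) bad i)%N => B.
  rewrite !mulrDr mulr1; move: h1; lra.
have [le|lt] := leqP (k + m) N.
  have := IH (k + m)%N ltac:(by move: Nk ltk m0 le; clear; lia) le.
  have -> : (N - k)%:R = (N - (k + m))%:R + m%:R :> R.
    by rewrite -natrD; congr _%:R; move: le; clear; lia.
  have : A * (\sum_(k + m <= i < N) bad i)%:R <= A * (\sum_(k <= i < N) bad i)%:R.
    rewrite ler_wpM2l // ler_nat (big_cat_nat _ (n := k + m) (m := k)) ?leq_addr //=.
    exact: leq_addl.
  rewrite !mulrDr; move: hm; lra.
have h1 := yL k (N - k)%N; rewrite subnKC // in h1.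
have h2 : (N - k)%:R <= T%:R :> R by rewrite ler_nat; move: lt mT; clear; lia.
have h3 : A * (N - k)%:R <= A * T%:R by rewrite ler_wpM2l.
have h4 : v * (N - k)%:R <= `|v| * (N - k)%:R by rewrite ler_wpM2r // ler_norm.
have h5 : 0 <= A * (\sum_(k <= i < N) bad i)%:R by rewrite mulr_ge0.
move: h1 h3 h4 h5; rewrite /A !mulrDl !mulrDr; lra.
Qed.

(** Bad times occur anywhere, whereas [block_tail] concerns consecutive blocks. Sorting times by
    residue modulo [T] gives one decomposition into blocks for each offset [s < T], and one of them
    contains many bad blocks; hence the factor [T]. *)
Lemma lower_tail (u : dir) e : 0 < e -> exists T N0 : nat, (0 < T)%N /\ forall N, (N0 <= N)%N ->
  outer nu [set X | Bd X /\ exists r, [/\ X r, r 0%N = one &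
    phi (r N) < (Lam - 3 * e) * N%:R]] <= T%:R * (C' * C * 2 ^- (N %/ T)).
Proof.
move=> e0; set v := Lam - e; set A := L0 + `|v|; have A0 : 0 <= A by rewrite addr_ge0.
have [k hk] : exists k : nat, 2 * A / e <= k.+1%:R.
  by exists (Num.trunc (2 * A / e)); exact/ltW/truncnS_gt.
rewrite ler_pdivrMr // in hk.
have C1 := C_ge1; have C0 : 0 < C by apply: lt_le_trans C1.
have [|K [a [K0 a0 aS hbad]]] := @few_bad_blocks e ((4 * C) ^- k.+1 * C) e0.
  by rewrite mulr_gt0 // invr_gt0 exprn_gt0 // mulr_gt0.
have amono i j : (i <= j)%N -> (a i <= a j)%N.
  move=> /subnK <-; elim: (j - i)%N => [//|n IH]; rewrite addSn.
  exact: leq_trans IH (ltnW (aS _)).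
have apos j : (0 < j)%N -> (0 < a j)%N.
  by move=> j0; apply: leq_trans (amono 1%N j j0); rewrite -{1}a0 aS.
set T := a K in hbad; have T0 : (0 < T)%N by exact: apos.
have [N0 hN0] : exists N0 : nat, A * T%:R / e <= N0%:R.
  by exists (Num.trunc (A * T%:R / e)).+1; exact/ltW/truncnS_gt.
rewrite ler_pdivrMr // in hN0.
exists T, (N0 + T)%N; split => // N N0N.
pose Bad h := bad_blocks e a K (act u h).
(* One block more than [N %/ T], so that the starting times for all offsets together cover those
   below [N]. *)
pose E s := [set X : BdT R mul inv one S | Bd X /\ exists r, [/\ X r, r 0%N = one &
  ((N %/ T).+1 < bad_count T s Bad r (N %/ T).+1 * k.+1)%N]].
have hE s : outer nu (E s) <= C' * C * 2 ^- (N %/ T).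
  apply: le_trans (@block_tail k.+1 T s Bad (N %/ T).+1 isT (fun h => hbad (act u h))) _.
  by rewrite ler_pM2l ?mulr_gt0 // lef_pV2 ?posrE ?exprn_gt0 // ler_weXn2l ?ler1n.
apply: (@le_trans _ _ (outer nu (\big[setU/set0]_(s <- iota 0 T) E s))); last first.
  apply: le_trans (outer_sum nu _ _) _.
  rewrite [leRHS]mulr_natl -[X in _ *+ X](size_iota 0 T) -(count_predT (iota 0 T)).
  by rewrite -iter_addr_0 -big_const_seq; apply: ler_sum => s _; exact: hE.
apply: outer_mono => X [XB [r [Xr r0 rN]]]; have hr := bpoint_mem_ray XB Xr.
suff [s sT XE] : exists2 s, s \in iota 0 T & E s X by exact: (mem_bigU sT XE).
pose bad n := inv (r n) ** r (n + T)%N \in Bad (r n).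
have good n : ~~ bad n -> exists m, [/\ (0 < m)%N, (m <= T)%N &
    ell u (r n) + v * m%:R <= ell u (r (n + m)%N)].
  move=> nb; apply: contrapT => hn; move/negP: nb; apply.
  have lb : len (inv (r n) ** r (n + T)%N) = T.
    by rewrite -/(d (r n) (r (n + T)%N)) hr ?leq_addr // addKn.
  rewrite /bad /Bad /bad_blocks mem_filter mem_sph // lb eqxx andbT; apply/asboolP.
  exists (fun i => inv (r n) ** r (n + i)%N); split.
    split; rewrite ?addn0 ?(gmulV grp) ?lb // => i j /andP[ij _].
    by rewrite (wdM S grp) hr ?leq_add2l // subnDl.
  move=> j /andP[j0 jK]; rewrite addr0 ltNge; apply/negP => h; apply: hn.
  exists (a j); split; [exact: apos | exact: amono |].
  have := ellM u (r n) (inv (r n) ** r (n + a j)%N); rewrite (gmulKV grp) /v; move: h; lra.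
have yL n m : ell u (r n) - L0 * m%:R <= ell u (r (n + m)%N).
  rewrite lerBlDr; apply: (lipschitz_le (ellL u)).
  by rewrite hr ?leq_addr // addKn.
have := greedy_lower (y := fun n => ell u (r n)) yL good N.
rewrite r0 ell1 add0r -/A => h1.
have h2 := ell_le u (r N).
have eN : A * T%:R <= e * N%:R.
  by apply: le_trans hN0 _; rewrite [e * _]mulrC ler_pM2r // ler_nat (leq_trans (leq_addr T N0)).
set B := (\sum_(n < N) bad n)%N in h1.
(* Of the [3 * e], one is spent in [v] and one on [A * T]; the bad times must account for the
   third. *)
have h3 : e * N%:R < A * B%:R.
  by move: h1 rN; rewrite /v mulrDr !mulrBl; lra.
apply: contrapT => hn.
have hs s : (s < T)%N -> (bad_count T s Bad r (N %/ T).+1 * k.+1 <= (N %/ T).+1)%N.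
  move=> sT; rewrite leqNgt; apply/negP => lt; apply: hn; exists s.
    by rewrite mem_iota.
  by split => //; exists r.
have hB : (B * k.+1 <= T * (N %/ T).+1)%N.
  have h4 : (B <= \sum_(n < (N %/ T).+1 * T) bad n)%N.
    rewrite /B -!(big_mkord xpredT (fun n => nat_of_bool (bad n))).
    rewrite [leqRHS](big_cat_nat _ (n := N)) //= ?leq_addr //.
    by rewrite ltnW // ltn_ceil.
  apply: leq_trans (leq_mul h4 (leqnn k.+1)) _.
  rewrite -(sum_residues (fun n => nat_of_bool (bad n))) big_distrl /=.
  rewrite -[X in (_ <= X * _)%N](card_ord T) -sum_nat_const; apply: leq_sum => s _.
  apply: leq_trans (hs s (ltn_ord s)); rewrite leq_mul2r; apply/orP; right.
  by apply: leq_sum => i _; rewrite /bad /block mulSnr addnA.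
have h5 : (T * (N %/ T).+1 <= 2 * N)%N.
  rewrite mulnS mulnC; have := leq_trunc_div N T.
  by have := leq_trans (leq_addl N0 T) N0N; clear; lia.
have h6 : B%:R * k.+1%:R <= 2 * N%:R :> R.
  by rewrite -!natrM ler_nat (leq_trans hB h5).
have h7 : A * (B%:R * k.+1%:R) <= A * (2 * N%:R) by rewrite ler_wpM2l.
have N1 : 0 <= N%:R :> R by [].
have h8 : 2 * A * N%:R <= k.+1%:R * e * N%:R by rewrite ler_wpM2r.
have k1 : 0 < k.+1%:R :> R by [].
have h9 : e * N%:R * k.+1%:R < A * B%:R * k.+1%:R by rewrite ltr_pM2r.
move: h7 h8 h9; lra.
Qed.

Lemma large_deviations (u : dir) e : 0 < e -> exists (B : R) (T N0 : nat), [/\ 0 < B, (0 < T)%N &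
  forall N, (N0 <= N)%N ->
  outer nu [set X | Bd X /\ exists r, [/\ X r, r 0%N = one &
    3 * e * N%:R < `|phi (r N) - Lam * N%:R|]] <= B * 2 ^- (N %/ T)].
Proof.
move=> e0; have [T1 [N1 [T10 h1]]] := upper_tail e0; have [T2 [N2 [T20 h2]]] := lower_tail u e0.
have C1 := C_ge1; have C0 : 0 < C by apply: lt_le_trans C1.
have CC : 0 < C' * C by rewrite mulr_gt0.
exists ((1 + T2%:R) * (C' * C)), (maxn T1 T2), (maxn N1 N2); split.
- by rewrite mulr_gt0 // ltr_wpDr.
- by rewrite leq_max T10.
move=> N; rewrite geq_max => /andP[n1 n2].
pose F1 := [set X : BdT R mul inv one S | Bd X /\ exists r, [/\ X r, r 0%N = one &
  (Lam + 3 * e) * N%:R < phi (r N)]].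
pose F2 := [set X : BdT R mul inv one S | Bd X /\ exists r, [/\ X r, r 0%N = one &
  phi (r N) < (Lam - 3 * e) * N%:R]].
apply: (@le_trans _ _ (outer nu (\big[setU/set0]_(b <- [:: true; false]) if b then F1 else F2))).
  apply: outer_mono => X [XB [r [Xr r0]]]; rewrite !big_cons big_nil setU0.
  rewrite ltNge ler_norml => /negP h.
  have [h3|h3] := ltP ((Lam + 3 * e) * N%:R) (phi (r N)); first by left; split => //; exists r.
  right; split => //; exists r; split => //; rewrite ltNge; apply/negP => h4.
  by apply: h; apply/andP; split; move: h3 h4; lra.
apply: le_trans (outer_sum nu _ _) _; rewrite !big_cons big_nil addr0 !mulrDl mul1r.
have mono T' : (0 < T')%N -> (T' <= maxn T1 T2)%N ->
    C' * C * 2 ^- (N %/ T') <= C' * C * 2 ^- (N %/ maxn T1 T2) :> R.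
  move=> T'0 le; rewrite ler_pM2l // lef_pV2 ?posrE ?exprn_gt0 // ler_weXn2l ?ler1n //.
  exact: leq_div2l.
apply: lerD; first exact: le_trans (h1 N n1) (mono T1 T10 (leq_maxl _ _)).
apply: le_trans (h2 N n2) _; rewrite -[leRHS]mulrA ler_wpM2l //.
exact: mono T2 T20 (leq_maxr _ _).
Qed.

End Stage.

End Deviations.

(** * From exponential bounds to the limit superior *)

Lemma limn_esup_elog_lt0 (R : realType) (o : nat -> R) (B : R) (T N0 : nat) :
  0 < B -> (0 < T)%N -> (forall N, (N0 <= N)%N -> 0 <= o N <= B * 2 ^- (N %/ T)) ->
  (limn_esup (fun n => elog (o n)%:E * (n%:R^-1)%:E) < 0)%E.
Proof.
move=> B0 T0 ho; have l2 : 0 < ln 2 :> R by rewrite ln_gt0 // ltr1n.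
have T1 : 0 < T%:R :> R by rewrite ltr0n.
(* Half of the rate [ln 2 / T]; the other half absorbs [ln B] and the rounding in [n %/ T]. *)
pose a : R := ln 2 / (2 * T%:R); have a0 : 0 < a by rewrite divr_gt0 // mulr_gt0.
have [N1 hN1] : exists N1 : nat, (`|ln B| + ln 2) / a <= N1%:R.
  by exists (Num.trunc ((`|ln B| + ln 2) / a)).+1; exact/ltW/truncnS_gt.
rewrite ler_pdivrMr // in hN1.
apply: (@le_lt_trans _ _ ((- a)%:E)); last by rewrite lte_fin oppr_lt0.
rewrite limn_esup_lim; apply: lime_le; first exact: is_cvg_esups.
exists (N0 + N1).+1 => // M /= hM; apply: ge_ereal_sup => _ [n /= nM <-].
have nN : ((N0 + N1).+1 <= n)%N by apply: leq_trans hM nM.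
have n0 : 0 < n%:R :> R by rewrite ltr0n (leq_trans _ nN).
have n1 : N1%:R <= n%:R :> R.
  by rewrite ler_nat (leq_trans _ nN) // (leq_trans (leq_addl N0 N1)).
have /andP[on0 onB] := ho n (leq_trans (leq_trans (leq_addr N1 N0) (leqnSn _)) nN).
rewrite /elog; case: ifPn => [op|_]; last by rewrite mulNyr gtr0_sg ?invr_gt0 // mul1e leNye.
rewrite -EFinM lee_fin ler_pdivrMr //.
have h1 : ln (o n) <= ln B - (n %/ T)%:R * ln 2.
  rewrite mulr_natl -lnXn ?posrE // -ln_div ?posrE ?exprn_gt0 //.
  by rewrite ler_ln ?posrE ?divr_gt0 ?exprn_gt0.
have h2 : n%:R <= ((n %/ T)%:R + 1) * T%:R :> R.
  by rewrite natr1 -natrM ler_nat ltnW // ltn_ceil.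
have h3 : n%:R * (2 * a) <= ((n %/ T)%:R + 1) * ln 2.
  have -> : 2 * a = ln 2 / T%:R by rewrite /a; field; rewrite gt_eqF.
  by rewrite mulrA ler_pdivrMr // mulrAC ler_pM2r.
have h4 : N1%:R * a <= n%:R * a by rewrite ler_pM2r.
have := ler_norm (ln B); lra.
Qed.

Unset Implicit Arguments.
Set Strict Implicit.
Set Printing Implicit Defensive.

Theorem theorem1p10 (R : realType) (G : eqType) (mul : G -> G -> G) (inv : G -> G)
  (one : G) (S : seq G) (d : nat) (rho : G -> 'M[R]_d) (N : 'cV[R]_d -> R)
  (lam Lam : R) (nu : probability (BdT R mul inv one S) R) :
  is_group mul inv one ->
  symmetric_set inv S -> generates mul one S ->
  hyperbolic R mul inv one S ->
  non_elementary mul inv one ->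
  is_rep mul one rho -> strongly_irreducible rho -> is_vnorm N -> proximal N rho ->
  1 < lam -> growth_rate mul one S lam ->
  @is_PS R G mul inv one S lam nu ->
  0 <= Lam ->
  {ae nu, forall X, Bd mul inv one S X -> forall r, X r ->
     (fun n : nat => ln (opnorm N (rho (r n))) / n%:R) @ \oo --> Lam} ->
  forall eps : R, 0 < eps ->
  (limn_esup (fun n : nat =>
      elog (mu_ext nu [set X | Bd mul inv one S X /\
              forall r, X r -> r 0%N = one ->
                (eps < `|ln (opnorm N (rho (r n))) / n%:R - Lam|)%R ])
      * ((n%:R)^-1)%:E) < 0)%E.
Proof.
move=> grp symS genS hyp _ rep irr vN [_ [M [rkM _]]] lam1 growth PS Lam0 ae_op eps eps0.
(* The rank-one limit in proximality excludes dimension 0. *)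
have d_gt0 : (0 < d)%N by rewrite -rkM rank_leq_row.
have [D H4] := hyperbolic_four_point hyp.
have lower := sphere_lower grp genS lam1 growth.
have [C C1 upper] := sphere_upper grp symS genS H4 lam1 growth.
have [R1 [c [C' [c0 C'0 /choice[U hU]]]]] := exists_shadow_sets grp symS genS H4 lam1 lower upper PS.
have [L0 L0_ge0 [phiL ellL]] := log_lipschitz grp symS genS d_gt0 rep.
have [Fs [ce ell_tr]] := ell_transversal d_gt0 rep irr.
have [K K1 hK] := opnorm_nm vN d_gt0.
have K0 : 0 < K by apply: lt_le_trans K1.
have op_lognorm g : `|ln (opnorm N (rho g)) - lognorm rho g| <= ln K.
  have [h1 h2] := hK (rho g); have n0 := nm_rep_gt0 d_gt0 rep g.
  have on0 : 0 < opnorm N (rho g) by apply: lt_le_trans h1; rewrite mulr_gt0 // invr_gt0.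
  rewrite /lognorm ler_norml; apply/andP; split.
    rewrite lerBrDl addrC -lnV ?posrE // -lnM ?posrE ?invr_gt0 //.
    by rewrite ler_ln ?posrE // ?mulr_gt0 ?invr_gt0.
  by rewrite lerBlDr -lnM ?posrE // ler_ln ?posrE ?mulr_gt0.
have phi_ae : {ae nu, forall X, Bd mul inv one S X -> forall r, X r ->
    (fun n : nat => lognorm rho (r n) / n%:R) @ \oo --> Lam}.
  apply: (negligibleS _ ae_op) => X hn hX; apply: hn => XB r Xr; have /cvgrPdist_lt cv := hX XB r Xr.
  apply/cvgrPdist_lt => e e0; have [n0 _ hn0] := cv (e / 2) ltac:(lra).
  have [n1 hn1] : exists n1 : nat, ln K * 2 / e <= n1%:R.
    by exists (Num.trunc (ln K * 2 / e)).+1; exact/ltW/truncnS_gt.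
  rewrite ler_pdivrMr // in hn1.
  exists (n0 + n1).+1 => // n /= hn.
  have np : 0 < n%:R :> R by rewrite ltr0n (leq_trans _ hn).
  have h1 := hn0 n (leq_trans (leq_trans (leq_addr n1 n0) (leqnSn _)) hn).
  have h2 : n1%:R <= n%:R :> R.
    by rewrite ler_nat (leq_trans (leq_trans (leq_addl n0 n1) (leqnSn _)) hn).
  have h3 : `|ln (opnorm N (rho (r n))) / n%:R - lognorm rho (r n) / n%:R| <= e / 2.
    rewrite -mulrBl normrM [`|n%:R^-1|]gtr0_norm ?invr_gt0 // ler_pdivrMr //.
    apply: le_trans (op_lognorm _) _.
    have : n1%:R * e <= n%:R * e by rewrite ler_pM2r.
    lra.
  have := ler_normD (Lam - ln (opnorm N (rho (r n))) / n%:R)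
    (ln (opnorm N (rho (r n))) / n%:R - lognorm rho (r n) / n%:R).
  rewrite addrA subrK; move: h1; rewrite /=; lra.
have u0 : dir R d.
  exists (delta_mx 0 (Ordinal d_gt0)); apply/eqP => /matrixP/(_ 0 (Ordinal d_gt0)).
  by rewrite !mxE !eqxx => /eqP; rewrite oner_eq0.
(* [large_deviations] then works at scale [3 * (eps / 6) = eps / 2]; the other half absorbs the
   bounded difference between [opnorm] and [nm] on the logarithmic scale. *)
have e0 : 0 < eps / 6 by lra.
have mU g : measurable (U g) by have [] := hU g.
have UBd g : U g `<=` Bd mul inv one S by have [] := hU g.
have Unear g X r : U g X -> X r -> r 0%N = one ->
    (wdist mul inv one S (r (wlen mul one S g)) g <= R1)%N.
  by move=> UX Xr r0; have [_ _ h _ _] := hU g; exact: (h X r UX Xr r0).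
have Umem X r n : Bd mul inv one S X -> X r -> r 0%N = one -> U (r n) X.
  move=> XB Xr r0; have [_ _ _ h _] := hU (r n); apply: (h X r XB Xr r0).
  by rewrite (ray_len grp n (bpoint_mem_ray XB Xr) r0).
have Ulow g : c / lam ^+ wlen mul one S g <= outer nu (U g).
  by rewrite -lee_fin -outer_measurable //; have [_ _ _ _ []] := hU g.
have Uup g : outer nu (U g) <= C' / lam ^+ wlen mul one S g.
  by rewrite -lee_fin -outer_measurable //; have [_ _ _ _ []] := hU g.
have [B [T [N0 [B0 T0 hdev]]]] := large_deviations grp symS genS H4 lam1 lower upper
  c0 C'0 mU UBd Unear Umem Ulow Uup L0_ge0 phiL phi_ae ellL (ellM rep) (ell1 rep) ell_tr Lam0
  (lognormM d_gt0 rep) (ell_le d_gt0 rep) u0 e0.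
have [n1 hn1] : exists n1 : nat, ln K * 2 / eps <= n1%:R.
  by exists (Num.trunc (ln K * 2 / eps)).+1; exact/ltW/truncnS_gt.
rewrite ler_pdivrMr // in hn1.
under eq_fun do rewrite outerE.
apply: (@limn_esup_elog_lt0 _ _ B T (N0 + n1).+1 B0 T0) => n hn.
rewrite outer_ge0 /=.
apply: le_trans (hdev n (leq_trans (leq_trans (leq_addr n1 N0) (leqnSn _)) hn)).
(* Every boundary point has a ray from [one], so a deviation along all rays implies one along some
   ray. *)
apply: outer_mono => X [XB hX]; split => //.
have [r [Xr hr r0]] := bpoint_ray grp symS genS H4 XB.
exists r; split => //.
have np : 0 < n%:R :> R by rewrite ltr0n (leq_trans _ hn).
have h1 := hX r Xr r0.
have h2 : n1%:R <= n%:R :> R.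
  by rewrite ler_nat (leq_trans (leq_trans (leq_addl N0 n1) (leqnSn _)) hn).
have h3 : eps * n%:R < `|ln (opnorm N (rho (r n))) - Lam * n%:R|.
  rewrite -ltr_pdivlMr // -[n%:R^-1]gtr0_norm ?invr_gt0 // -normrM mulrBl.
  by rewrite mulfK // gt_eqF.
have h4 := op_lognorm (r n).
have h5 : n1%:R * eps <= n%:R * eps by rewrite ler_pM2r.
have := ler_normD (ln (opnorm N (rho (r n))) - lognorm rho (r n)) (lognorm rho (r n) - Lam * n%:R).
rewrite addrA subrK; lra.
Qed.
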